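(* Let $\mathcal A$ be a right accessible surjective operator ideal and let $X$ be a Banach space. Then: (a) $X$ has the $\mathcal A$-approximation property if and only if $$(\mathcal A^{min})^{sur}(Y,X)=\mathcal A^{min}(Y,X)$$ for all Banach spaces $Y$. (b) The dual space $X^*$ has the $\mathcal A$-approximation property if and only if $$((\mathcal A^{dual})^{min})^{inj}(X,Y)=(\mathcal A^{dual})^{min}(X,Y)$$ for all Banach spaces $Y$.
   Context: Operator ideals are quasi-normed operator ideals $(\mathcal A,\alpha)$ between Banach spaces in the sense of Pietsch (with complete components). $\mathcal B,\mathcal K,\overline{\mathcal F},\mathcal F$ denote the bounded, compact, approximable (operator-norm limits of finite rank) and finite rank operators. $B_X$ is the closed unit ball of $X$. Composition: $T\in\mathcal A_1\circ\mathcal A_2(X,Y)$ iff $T=U\circ V$ with $V\in\mathcal A_2(X,Z)$, $U\in\mathcal A_1(Z,Y)$ for some Banach space $Z$. $\mathcal A^{min}=\overline{\mathcal F}\circ\mathcal A\circ\overline{\mathcal F}$. Dual: $T\in\mathcal A^{dual}(X,Y)$ iff $T^*\in\mathcal A(Y^*,X^* )$, with $\alpha^{dual}(T)=\alpha(T^* )$. Injective hull: let $i_Y:Y\hookrightarrow\ell_\infty(B_{Y^*})$, $i_Y(y)=(y^*(y))_{y^*\in B_{Y^*}}$. Then $T\in\mathcal A^{inj}(X,Y)$ iff $i_Y\circ T\in\mathcal A$, with $\alpha^{inj}(T)=\alpha(i_Y\circ T)$. Surjective hull: let $q_X:\ell_1(B_X)\to X$, $q_X((\lambda_b)_b)=\sum_b\lambda_b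 b$. Then $T\in\mathcal A^{sur}(X,Y)$ iff $T\circ q_X\in\mathcal A$, with $\alpha^{sur}(T)=\alpha(T\circ q_X)$; $\mathcal A$ is surjective if $\mathcal A^{sur}=\mathcal A$. Right accessible (standard, Defant–Floret): for every finite-dimensional $M$, Banach space $Y$, $T\in\mathcal A(M,Y)$ and $\epsilon>0$ there are a finite-dimensional subspace $N\subset Y$ and $S\in\mathcal A(M,N)$ with $T=I_N\circ S$ ($I_N:N\hookrightarrow Y$ the inclusion) and $\alpha(S)\le(1+\epsilon)\alpha(T)$. $\mathcal A$-approximation property: the composition norm on $\mathcal A\circ\mathcal K$ is $\alpha_\kappa(T)=\inf\{\alpha(T_1)\|T_2\|: T=T_1\circ T_2,\ T_1\in\mathcal A,\ T_2\in\mathcal K\}$. For a compact subset $K$ of a Banach space $E$, call a Banach space $Z$ admissible for $(E,K)$ if $Z$ is a linear subspace of $E$ with its own complete norm such that the formal inclusion $i_Z:Z\to E$ is a compact operator, $K\subset i_Z(B_Z)$, and for every $g\in Z^*$ and $\epsilon>0$ there is $f\in E^*$ with $|f(z)-g(z)|<\epsilon$ for all $z\in B_Z$ (such $Z$ always exist). For $T\in\mathcal A(E,G)$ put $\|T\|_K=\inf\{\alpha_\kappa(T\circ i_Z): Z\text{ admissible for }(E,K)\}$. The family $\{\|\cdot\|_K: K\subset E\text{ compact}\}$ defines the topology $\lambda_{\mathcal A}$ on $\mathcal A(E,G)$. A Banach space $X$ has the $\mathcal A$-approximation property if for every Banach space $Y$, $\mathcal F(Y,X)$ is dense in $\mathcal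 A(Y,X)$ in the topology $\lambda_{\mathcal A}$. *)

(* Defs.v *)
From HB Require Import structures.
From mathcomp Require Import all_boot all_order all_algebra.
From mathcomp Require Import complex finmap.
From mathcomp Require Import all_classical all_reals.
From mathcomp Require Import ereal topology normedtype esum sequences.
From mathcomp.analysis Require summability.

Set Implicit Arguments.
Unset Strict Implicit.
Unset Printing Implicit Defensive.

Import Order.TTheory GRing.Theory Num.Theory.
Import numFieldNormedType.Exports.

Local Open Scope classical_set_scope.
Local Open Scope ring_scope.

Variant scalar_kind := RealScalars | ComplexScalars.

Definition scalars (R : realType) (k : scalar_kind) : numFieldType :=
  match k with RealScalars => R | ComplexScalars => R[i]%C end.

Section Scalars.
Variables (R : realType) (k : scalar_kind).
Local Notation K := (scalars R k).

(* The library's norms take values in the scalar field, so for complex scalars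
   the real number meant is re `|v|; emb is the inclusion of R into K. *)
Definition re : K -> R :=
  match k return scalars R k -> R with
  | RealScalars => fun x => x | ComplexScalars => fun z => complex.Re z end.

Definition emb : R -> K :=
  match k return R -> scalars R k with
  | RealScalars => fun x => x | ComplexScalars => fun x => (x%:C)%C end.

Lemma reK_ge0 (x : K) : 0 <= x -> emb (re x) = x.
Proof.
rewrite /re /emb; case: k x => //= x x0.
by apply: RRe_real; rewrite ger0_real.
Qed.

Lemma embK x : re (emb x) = x.
Proof. by rewrite /re /emb; case: k. Qed.

Lemma emb_le x y : (emb x <= emb y) = (x <= y).
Proof. by rewrite /emb; case: k => //=; rewrite lecR. Qed.

Lemma emb_lt x y : (emb x < emb y) = (x < y).
Proof. by rewrite /emb; case: k => //=; rewrite ltcR. Qed.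

Lemma embD x y : emb (x + y) = emb x + emb y.
Proof. by rewrite /emb; case: k => //=; rewrite rmorphD. Qed.

Lemma embM x y : emb (x * y) = emb x * emb y.
Proof. by rewrite /emb; case: k => //=; rewrite rmorphM. Qed.

Lemma emb0 : emb 0 = 0.
Proof. by rewrite /emb; case: k. Qed.

Lemma re_le x y : x <= y -> re x <= re y.
Proof. by rewrite /re; case: k x y => //= x y; rewrite lecE => /andP[]. Qed.

Lemma re_norm_ge0 (a : K) : 0 <= re `|a|.
Proof. by rewrite -emb_le emb0 reK_ge0. Qed.

Definition rnorm (V : normedZmodType K) (v : V) : R := re `|v|.

Section RnormTheory.
Variable V : normedModType K.
Implicit Types u v : V.

Lemma rnormE v : `|v| = emb (rnorm v).
Proof. by rewrite /rnorm reK_ge0. Qed.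

Lemma rnorm_ge0 v : 0 <= rnorm v.
Proof. by rewrite -emb_le emb0 -rnormE. Qed.

Lemma rnormD u v : rnorm (u + v) <= rnorm u + rnorm v.
Proof. by rewrite -emb_le embD -!rnormE ler_normD. Qed.

Lemma rnormN v : rnorm (- v) = rnorm v.
Proof. by rewrite /rnorm normrN. Qed.

Lemma rnormB u v : rnorm (u - v) = rnorm (v - u).
Proof. by rewrite /rnorm distrC. Qed.

Lemma rnorm0 : rnorm (0 : V) = 0.
Proof. by rewrite /rnorm normr0 -emb0 embK. Qed.

Lemma rnorm0_eq0 v : rnorm v = 0 -> v = 0.
Proof. by move=> v0; apply: normr0_eq0; rewrite rnormE v0 emb0. Qed.

Lemma rnorm_le1 v : (`|v| <= 1) = (rnorm v <= 1).
Proof.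
rewrite rnormE -(@emb_le _ 1); congr (_ <= _).
by rewrite /emb; case: k.
Qed.

Lemma rnorm_dist u v : `|rnorm u - rnorm v| <= rnorm (u - v).
Proof.
rewrite ler_norml; apply/andP; split.
  by rewrite lerNl opprB lerBlDl rnormB (le_trans _ (rnormD _ _))// addrC subrK.
by rewrite lerBlDl (le_trans _ (rnormD _ _))// addrC subrK.
Qed.

Lemma rnorm_sum (I : Type) (s : seq I) (f : I -> V) :
  rnorm (\sum_(i <- s) f i) <= \sum_(i <- s) rnorm (f i).
Proof.
elim/big_ind2 : _ => // [|x1 x2 y1 y2 h1 h2]; first by rewrite rnorm0.
by rewrite (le_trans (rnormD _ _))// lerD.
Qed.

Lemma cvg_rnormP (T : Type) (F : set_system T) (f : T -> V) (l : V) :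
  Filter F ->
  (f @ F --> l) <-> (forall e : R, 0 < e -> \forall t \near F, rnorm (l - f t) < e).
Proof.
move=> FF; split=> [/cvgrPdist_lt h e e0|h].
  have := h (emb e); rewrite -emb0 emb_lt => /(_ e0).
  by apply: filterS => t; rewrite rnormE emb_lt.
apply/cvgrPdist_lt => e e0.
have eE : emb (re e) = e by rewrite reK_ge0 ?ltW.
have /h : 0 < re e by rewrite -emb_lt emb0 eE.
by apply: filterS => t; rewrite -emb_lt -rnormE eE.
Qed.

Lemma cvg_rnorm (T : Type) (F : set_system T) {FF : Filter F} (f : T -> V)
    (l : V) : f @ F --> l -> (fun t => rnorm (f t)) @ F --> rnorm l.
Proof.
move=> /cvg_rnormP h; apply/cvgrPdist_lt => e /h.
by apply: filterS => t; apply: le_lt_trans; exact: rnorm_dist.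
Qed.

Lemma rnorm_cauchyP (F : set_system V) : ProperFilter F ->
  cauchy F <-> (forall e : R, 0 < e -> exists v, F [set w | rnorm (v - w) <= e]).
Proof.
move=> FF; split=> [/cauchyP h e e0|h].
  have /h[v Fv] : 0 < emb e by rewrite -emb0 emb_lt.
  exists v; apply: filterS Fv => w; rewrite -ball_normE/= => h2.
  by rewrite -emb_le -rnormE ltW.
apply/cauchyP => e e0.
have eE : emb (re e) = e by rewrite reK_ge0 ?ltW.
have re0 : 0 < re e by rewrite -emb_lt emb0 eE.
have /h[v Fv] : 0 < re e / 2 by rewrite divr_gt0.
exists v; apply: filterS Fv => w /= h2; rewrite -ball_normE/=.
rewrite rnormE -eE emb_lt (le_lt_trans h2)//.
by rewrite ltr_pdivrMr// ltr_pMr// ltr1n.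
Qed.

End RnormTheory.

Lemma rnormZ (V : normedModType K) (a : K) (v : V) :
  rnorm (a *: v) = re `|a| * rnorm v.
Proof.
rewrite -[LHS]embK -[RHS]embK; congr re.
by rewrite embM -!rnormE normrZ.
Qed.

End Scalars.

Arguments re {R k}.
Arguments emb {R k}.
Arguments rnorm {R k V}.

Lemma complex_complete (R : realType)
    (F : set_system ((scalars R ComplexScalars)^o : normedModType _)) :
  ProperFilter F -> cauchy F -> cvg F.
Proof.
move=> FF /rnorm_cauchyP Fc.
pose I0 (z : R[i]) : R := complex.Im z.
pose R0 (z : R[i]) : R := complex.Re z.
have reR (z : R[i]) : `|R0 z| <= re (k := ComplexScalars) `|z|.
  by have := normc_ge_Re z; rewrite lecE => /andP[_].
have imR (z : R[i]) : `|I0 z| <= re (k := ComplexScalars) `|z|.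
  rewrite -normrN /I0 -ReiNIm (le_trans (reR _))// normrM.
  have -> : `|'i%C : R[i]| = 1 by rewrite normc_def /= expr0n expr1n add0r sqrtr1.
  by rewrite mulr1.
have cv (g : R[i] -> R) : (forall z w, g (z - w) = g z - g w) ->
    (forall z, `|g z| <= re (k := ComplexScalars) `|z|) ->
    exists l : R, g @ F --> l.
  move=> gB gle; apply/cvg_ex; apply: (@R_complete R (g @ F)).
  apply: cauchy_exP => e e0.
  have /Fc[v Fv] : 0 < e / 2 by rewrite divr_gt0.
  exists (g v); change (F (g @^-1` ball (g v) e)).
  apply: filterS Fv => w /= wv; rewrite -ball_normE/=.
  have -> : g v - g w = g ((v : R[i]) - (w : R[i])) by rewrite gB.
  apply: le_lt_trans (gle _) _; apply: le_lt_trans wv _; by rewrite ltr_pdivrMr// ltr_pMr// ltr1n.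
have [a Fa] : exists l : R, R0 @ F --> l by apply: cv => // -[? ?] [].
have [b Fb] : exists l : R, I0 @ F --> l by apply: cv => // -[? ?] [].
apply/cvg_ex; exists (a +i* b)%C; apply/cvg_rnormP => e e0.
have e2 : 0 < e / 2 by rewrite divr_gt0.
near=> z.
have za : `|a - R0 z| < e / 2 by near: z; move/cvgrPdist_lt : Fa; exact.
have zb : `|b - I0 z| < e / 2 by near: z; move/cvgrPdist_lt : Fb; exact.
rewrite [ltRHS]splitr; apply: le_lt_trans (ltrD za zb).
set u := (_ - _ : R[i]).
have -> : a - R0 z = R0 u by rewrite /u; case: (z : R[i]).
have -> : b - I0 z = I0 u by rewrite /u; case: (z : R[i]).
rewrite /rnorm [u in X in X <= _]complexE.
apply: (@le_trans _ _ (re (k := ComplexScalars) (`|(R0 u)%:C%C| + `|'i%C * (I0 u)%:C%C|))).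
  by apply: re_le; exact: ler_normD.
rewrite normrM !normc_def /= !expr0n !expr1n !add0r !addr0 sqrtr1 /=.
by rewrite !sqrtr_sqr mul1r /= mul0r subr0.
Unshelve. all: by end_near. Qed.

Lemma scalars_complete (R : realType) (k : scalar_kind)
    (F : set_system ((scalars R k)^o : normedModType _)) :
  ProperFilter F -> cauchy F -> cvg F.
Proof.
case: k F => F FF; last exact: complex_complete.
exact: (@R_complete R F FF).
Qed.

(* The scalar field as a Banach space over itself. An alias of (scalars R k)^o,
   because on R^o completeness is already keyed on R being a realType. *)
Definition scalar_space (R : realType) (k : scalar_kind) : Type :=
  (scalars R k)^o.

HB.instance Definition _ (R : realType) (k : scalar_kind) :=
  NormedModule.copy (scalar_space R k) (scalars R k)^o.
HB.instance Definition _ (R : realType) (k : scalar_kind) :=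
  Uniform_isComplete.Build (scalar_space R k) (@scalars_complete R k).

Notation Banach R k := (completeNormedModType (scalars R k)).

(* A normed space of W-valued functions is complete as soon as pointwise limits
   preserve its closed balls. *)
Lemma function_space_complete (R : realType) (k : scalar_kind)
    (V : normedModType (scalars R k)) (I : Type) (W : Banach R k)
    (ev : V -> I -> W) (c : I -> R) :
  (forall u v i, ev (u - v) i = ev u i - ev v i) ->
  (forall u v, (forall i, ev u i = ev v i) -> u = v) ->
  (forall v i, rnorm (ev v i) <= c i * rnorm v) ->
  (forall (F : set_system V) (f : I -> W) (M : R), ProperFilter F -> 0 <= M ->
     (forall i, ev^~ i @ F --> f i) -> F [set v | rnorm v <= M] ->
     exists2 v, (forall i, ev v i = f i) & rnorm v <= M) ->
  forall F : set_system V, ProperFilter F -> cauchy F -> cvg F.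
Proof.
move=> evB evI evc fatou F FF /rnorm_cauchyP Fc.
have cpos i : 0 < `|c i| + 1 by rewrite ltr_wpDl.
have evc' v i : rnorm (ev v i) <= (`|c i| + 1) * rnorm v.
  rewrite (le_trans (evc v i))// ler_wpM2r ?rnorm_ge0//.
  by rewrite (le_trans (ler_norm _))// lerDl.
have pw i : exists l : W, ev^~ i @ F --> l.
  apply/cvg_ex; apply: cauchy_cvg; apply/rnorm_cauchyP => e e0.
  have /Fc[v Fv] : 0 < e / (`|c i| + 1) by rewrite divr_gt0.
  exists (ev v i); change (F (ev^~ i @^-1` [set w | rnorm (ev v i - w) <= e])).
  apply: filterS Fv => w /= vw; rewrite -evB (le_trans (evc' _ _))//.
  by rewrite mulrC -ler_pdivlMr.
have [f Ff] := choice pw.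
have key (e : R) : 0 < e -> exists v0 u, [/\ F [set w | rnorm (v0 - w) <= e],
    (forall i, ev u i = f i - ev v0 i) & rnorm u <= e].
  move=> e0; have [v0 Fv0] := Fc e e0; exists v0.
  pose G := (fun w => w - v0) @ F.
  have [i||u uE ue] := fatou G (fun i => f i - ev v0 i) e _ (ltW e0).
  - apply/cvg_rnormP => d d0.
    change (F [set w | rnorm (f i - ev v0 i - ev (w - v0) i) < d]).
    move/cvg_rnormP : (Ff i) => /(_ d d0).
    apply: filterS => w /=.
    by rewrite evB opprB addrA subrK.
  - change (F [set w | rnorm (w - v0) <= e]).
    by apply: filterS Fv0 => w /=; rewrite rnormB.
  by exists u; split.
have [v0 [u0 [_ u0E _]]] := key 1 ltr01.
pose l := u0 - (- v0).
have lE i : ev l i = f i.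
  have ev0 : ev 0 i = 0 by rewrite -(subrr 0) evB subrr.
  by rewrite /l evB u0E -(sub0r v0) evB ev0 sub0r opprK subrK.
apply/cvg_ex; exists l; apply/cvg_rnormP => e e0.
have /key[v [u [Fv uE ue]]] : 0 < e / 2 / 2 by rewrite !divr_gt0.
have luv : l - v = u by apply: evI => i; rewrite evB lE uE.
apply: filterS Fv => w /= vw.
rewrite -(subrK v l) -addrA luv (le_lt_trans (rnormD _ _))//.
rewrite (le_lt_trans (lerD ue vw))// -splitr.
by rewrite ltr_pdivrMr// ltr_pMr// ltr1n.
Qed.

Lemma norm_leZ_eq (R : realType) (k : scalar_kind) (V : lmodType (scalars R k))
    (N : V -> R) : N 0 = 0 -> (forall a v, N (a *: v) <= re `|a| * N v) ->
  forall a v, emb (k := k) (N (a *: v)) = `|a| * emb (N v).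
Proof.
move=> N0 leZ a v; have [->|a0] := eqVneq a 0.
  by rewrite scale0r normr0 mul0r N0 emb0.
rewrite -(@reK_ge0 _ _ `|a|)// -embM; congr emb; apply/eqP.
rewrite eq_le leZ /= -(@emb_le R k) embM reK_ge0//.
rewrite -ler_pdivlMl ?normr_gt0// -normfV -(@reK_ge0 _ _ `|a^-1|)//.
by rewrite -embM emb_le -{1}(scalerK a0 v) leZ.
Qed.

Section Operators.
Variables (R : realType) (k : scalar_kind).
Local Notation K := (scalars R k).

Section OperatorType.
Variables X Y : normedModType K.

Definition bounded_linear : {pred X -> Y} :=
  [pred f : X -> Y | `[< linear f /\ exists c : R, forall x, rnorm (f x) <= c * rnorm x >]].

Lemma bounded_linearP f : reflect
  (linear f /\ exists c : R, forall x, rnorm (f x) <= c * rnorm x)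
  (f \in bounded_linear).
Proof. exact: asboolP. Qed.

Lemma bounded_linear_closed : submod_closed bounded_linear.
Proof.
split=> [|a f g].
  apply/bounded_linearP; split=> [b u v|]; first by rewrite /= scaler0 addr0.
  by exists 0 => x; rewrite rnorm0 mul0r.
move=> /bounded_linearP[fl [c fc]] /bounded_linearP[gl [d gd]].
apply/bounded_linearP; split=> [b u v|].
  rewrite !fctE fl gl !scalerDr !scalerA (mulrC b).
  by rewrite -!addrA; congr (_ + _); rewrite addrCA.
exists (re `|a| * c + d) => x; rewrite !fctE (le_trans (rnormD _ _))// mulrDl.
by rewrite lerD// rnormZ -mulrA ler_wpM2l// re_norm_ge0.
Qed.

HB.instance Definition _ :=
  GRing.isSubmodClosed.Build K (X -> Y) bounded_linear bounded_linear_closed.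

Record operator := Operator {
  op_fun :> X -> Y;
  op_fun_subproof : op_fun \in bounded_linear }.

HB.instance Definition _ := [isSub for op_fun].
HB.instance Definition _ := [Choice of operator by <:].
HB.instance Definition _ := [SubChoice_isSubLmodule of operator by <:].

Lemma op_linear (T : operator) : linear T.
Proof. by have /bounded_linearP[] := op_fun_subproof T. Qed.

HB.instance Definition _ (T : operator) :=
  GRing.isLinear.Build K X Y *:%R (op_fun T) (op_linear T).

Lemma op_bounded (T : operator) : exists c : R, forall x, rnorm (T x) <= c * rnorm x.
Proof. by have /bounded_linearP[] := op_fun_subproof T. Qed.

Lemma operatorP (S T : operator) : (forall x, S x = T x) -> S = T.
Proof. by move=> ST; apply/val_inj/funext. Qed.

Definition opnorm (T : operator) : R :=
  sup [set rnorm (T x) | x in [set x : X | `|x| <= 1]].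

Lemma opnorm_has_sup (T : operator) :
  has_sup [set rnorm (T x) | x in [set x : X | `|x| <= 1]].
Proof.
split; first by exists (rnorm (T 0)), 0 => //=; rewrite normr0.
have [c Tc] := op_bounded T; exists `|c| => _ [x /=+ <-].
rewrite rnorm_le1 => x1; rewrite (le_trans (Tc x))//.
rewrite (le_trans (ler_norm _))// normrM -[leRHS]mulr1 ler_wpM2l//.
by rewrite ger0_norm// rnorm_ge0.
Qed.

Lemma opnorm_ub (T : operator) x : rnorm (T x) <= opnorm T * rnorm x.
Proof.
have [->|x0] := eqVneq x 0; first by rewrite linear0 !rnorm0 mulr0.
have nx0 : rnorm x != 0 by apply: contra_neq x0 => /rnorm0_eq0.
have nx : 0 < rnorm x by rewrite lt_neqAle eq_sym nx0 rnorm_ge0.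
have eE : re `|emb (k := k) (rnorm x)^-1| = (rnorm x)^-1.
  by rewrite ger0_norm ?embK// -(@emb0 R k) emb_le invr_ge0 ltW.
rewrite -ler_pdivrMr// mulrC -eE -rnormZ -linearZ.
apply: sup_upper_bound; first exact: opnorm_has_sup.
by exists (emb (rnorm x)^-1 *: x) => //=; rewrite rnorm_le1 rnormZ eE mulVf.
Qed.

Lemma opnorm_le (T : operator) (c : R) : 0 <= c ->
  (forall x, rnorm (T x) <= c * rnorm x) -> opnorm T <= c.
Proof.
move=> c0 Tc; apply: ge_sup; first by have [] := opnorm_has_sup T.
move=> _ [x /=+ <-]; rewrite rnorm_le1 => x1.
by rewrite (le_trans (Tc x))// -[leRHS]mulr1 ler_wpM2l.
Qed.

Lemma opnorm_ge0 (T : operator) : 0 <= opnorm T.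
Proof.
apply: le_trans (rnorm_ge0 (T 0)) _.
apply: sup_upper_bound; first exact: opnorm_has_sup.
by exists 0 => //=; rewrite normr0.
Qed.

Lemma opnormD (S T : operator) : emb (k := k) (opnorm (S + T)) <= emb (opnorm S) + emb (opnorm T).
Proof.
rewrite -(@embD R k) emb_le; apply: opnorm_le => [|x].
  by rewrite addr_ge0 ?opnorm_ge0.
by rewrite (le_trans (rnormD _ _))// mulrDl lerD ?opnorm_ub.
Qed.

Lemma opnorm_leZ (a : K) (T : operator) : opnorm (a *: T) <= re `|a| * opnorm T.
Proof.
apply: opnorm_le => [|x]; first by rewrite mulr_ge0 ?opnorm_ge0 ?re_norm_ge0.
by rewrite rnormZ -mulrA ler_wpM2l ?opnorm_ub ?re_norm_ge0.
Qed.

Lemma opnormZ (a : K) (T : operator) : emb (opnorm (a *: T)) = `|a| * emb (opnorm T).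
Proof.
apply: norm_leZ_eq; last exact: opnorm_leZ.
apply/eqP; rewrite eq_le opnorm_ge0 andbT; apply: opnorm_le => // x.
by rewrite rnorm0 mul0r.
Qed.

Lemma opnorm_eq0 (T : operator) : emb (k := k) (opnorm T) = 0 -> T = 0.
Proof.
rewrite -(@emb0 R k) => /(congr1 (@re R k)); rewrite !embK => T0.
apply: operatorP => x; apply: rnorm0_eq0; apply/eqP.
by rewrite eq_le rnorm_ge0 andbT (le_trans (opnorm_ub T x))// T0 mul0r.
Qed.

HB.instance Definition _ := Lmodule_isNormed.Build K operator
  opnormD opnormZ opnorm_eq0.

Lemma rnorm_op (T : operator) : rnorm T = opnorm T.
Proof. exact: embK. Qed.

End OperatorType.

Lemma operator_complete (X : normedModType K) (Y : Banach R k)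
  (F : set_system (operator X Y)) : ProperFilter F -> cauchy F -> cvg F.
Proof.
apply: (@function_space_complete _ _ _ X Y (@op_fun X Y) rnorm) => //.
- by move=> S T /operatorP.
- by move=> T x; rewrite mulrC rnorm_op opnorm_ub.
move=> {}F f M FF M0 Ff FM.
have fM x : rnorm (f x) <= M * rnorm x.
  apply: (cvgr_to_le (cvg_rnorm (Ff x))); apply: filterS FM => T /=; rewrite rnorm_op => TM.
  by rewrite (le_trans (opnorm_ub _ _))// ler_wpM2r ?rnorm_ge0.
have fP : f \in @bounded_linear X Y.
  apply/bounded_linearP; split; last by exists M.
  move=> a u v; have h := Ff (a *: u + v).
  apply: (cvg_unique (@norm_hausdorff K Y) h).
  rewrite (_ : (fun T : operator X Y => T (a *: u + v)) =
               (fun T => a *: T u + T v)); last first.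
    by apply/funext => T; rewrite linearP.
  exact: cvgD (cvgZl_tmp (Ff u)) (Ff v).
exists (Operator fP) => //.
by rewrite rnorm_op opnorm_le.
Qed.

HB.instance Definition _ (X : normedModType K) (Y : Banach R k) :=
  Uniform_isComplete.Build (operator X Y) (@operator_complete X Y).

End Operators.

Section EllInf.
Variables (R : realType) (k : scalar_kind) (I : Type).
Local Notation K := (scalars R k).

Definition bounded_fun : {pred I -> (scalar_space R k)} :=
  [pred f : I -> (scalar_space R k) | `[< exists c : R, forall i, rnorm (f i) <= c >]].

Lemma bounded_funP f :
  reflect (exists c : R, forall i, rnorm (f i) <= c) (f \in bounded_fun).
Proof. exact: asboolP. Qed.

Lemma bounded_fun_closed : submod_closed bounded_fun.
Proof.
split=> [|a f g]; first by apply/bounded_funP; exists 0 => i; rewrite rnorm0.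
move=> /bounded_funP[c fc] /bounded_funP[d gd]; apply/bounded_funP.
exists (re `|a| * c + d) => i; rewrite !fctE (le_trans (rnormD _ _))//.
by rewrite lerD// rnormZ ler_wpM2l// re_norm_ge0.
Qed.

HB.instance Definition _ :=
  GRing.isSubmodClosed.Build K (I -> (scalar_space R k)) bounded_fun bounded_fun_closed.

Record ell_inf := EllInf {
  ell_inf_fun :> I -> (scalar_space R k);
  ell_inf_fun_subproof : ell_inf_fun \in bounded_fun }.

HB.instance Definition _ := [isSub for ell_inf_fun].
HB.instance Definition _ := [Choice of ell_inf by <:].
HB.instance Definition _ := [SubChoice_isSubLmodule of ell_inf by <:].

Implicit Types x y : ell_inf.

(* The point 0 only matters for empty I, where sup would be taken over set0. *)
Definition supnorm x : R := sup (0 |` [set rnorm (x i) | i in [set: I]]).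

Lemma supnorm_has_sup x : has_sup (0 |` [set rnorm (x i) | i in [set: I]]).
Proof.
split; first by exists 0; left.
have /bounded_funP[c xc] := ell_inf_fun_subproof x.
exists `|c| => _ [->//|[i _ <-]].
exact: le_trans (xc i) (ler_norm _).
Qed.

Lemma supnorm_ge0 x : 0 <= supnorm x.
Proof. by apply: sup_upper_bound; [exact: supnorm_has_sup|left]. Qed.

Lemma supnorm_ub x i : rnorm (x i) <= supnorm x.
Proof. by apply: sup_upper_bound; [exact: supnorm_has_sup|right; exists i]. Qed.

Lemma supnorm_le x (c : R) : 0 <= c ->
  (forall i, rnorm (x i) <= c) -> supnorm x <= c.
Proof.
move=> c0 xc; apply: ge_sup; first by have [] := supnorm_has_sup x.
by move=> _ [->//|[i _ <-]].
Qed.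

Lemma supnormD x y :
  emb (k := k) (supnorm (x + y)) <= emb (supnorm x) + emb (supnorm y).
Proof.
rewrite -embD emb_le; apply: supnorm_le => [|i].
  by rewrite addr_ge0 ?supnorm_ge0.
by rewrite (le_trans (rnormD _ _))// lerD ?supnorm_ub.
Qed.

Lemma supnormZ (a : K) x : emb (supnorm (a *: x)) = `|a| * emb (supnorm x).
Proof.
apply: norm_leZ_eq => [|{}a {}x].
  apply/eqP; rewrite eq_le supnorm_ge0 andbT; apply: supnorm_le => // i.
  by rewrite rnorm0.
apply: supnorm_le => [|i]; first by rewrite mulr_ge0 ?supnorm_ge0 ?re_norm_ge0.
by rewrite rnormZ ler_wpM2l ?supnorm_ub ?re_norm_ge0.
Qed.

Lemma ell_infP x y : (forall i, x i = y i) -> x = y.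
Proof. by move=> xy; apply/val_inj/funext. Qed.

Lemma supnorm_eq0 x : emb (k := k) (supnorm x) = 0 -> x = 0.
Proof.
rewrite -(@emb0 R k) => /(congr1 (@re R k)); rewrite !embK => x0.
apply: ell_infP => i; apply: rnorm0_eq0; apply/eqP.
by rewrite eq_le rnorm_ge0 andbT (le_trans (supnorm_ub x i))// x0.
Qed.

HB.instance Definition _ := Lmodule_isNormed.Build K ell_inf
  supnormD supnormZ supnorm_eq0.

Lemma rnorm_ell_inf x : rnorm x = supnorm x.
Proof. exact: embK. Qed.

Lemma ell_inf_complete (F : set_system ell_inf) :
  ProperFilter F -> cauchy F -> cvg F.
Proof.
apply: (@function_space_complete R k ell_inf I (scalar_space R k) ell_inf_fun (fun=> 1)) => //.
- exact: ell_infP.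
- by move=> x i; rewrite mul1r rnorm_ell_inf supnorm_ub.
move=> {}F f M FF M0 Ff FM.
have fM i : rnorm (f i) <= M.
  apply: (cvgr_to_le (cvg_rnorm (Ff i))); apply: filterS FM => x /=.
  by rewrite rnorm_ell_inf; apply: le_trans; exact: supnorm_ub.
have fP : f \in bounded_fun by apply/bounded_funP; exists M.
exists (EllInf fP) => //.
by rewrite rnorm_ell_inf supnorm_le.
Qed.

HB.instance Definition _ := Uniform_isComplete.Build ell_inf ell_inf_complete.

End EllInf.

Section Ell1.
Variables (R : realType) (k : scalar_kind) (I : choiceType).
Local Notation K := (scalars R k).

Local Open Scope ereal_scope.
Definition esum_norm (f : I -> (scalar_space R k)) : \bar R :=
  \esum_(i in [set: I]) (rnorm (f i))%:E.
Local Close Scope ereal_scope.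

Lemma esum_norm_ge0 f : (0 <= esum_norm f)%E.
Proof. by apply: esum_ge0 => i _; rewrite lee_fin rnorm_ge0. Qed.

Lemma esum_norm_fset f (A : {fset I}) :
  ((\sum_(i <- A) rnorm (f i))%:E <= esum_norm f)%E.
Proof.
apply: ereal_sup_ubound; exists [set` A]; first by split.
by rewrite fsbig_finite//= set_fsetK sumEFin.
Qed.

Lemma esum_norm_le f (x : \bar R) :
  (forall A : {fset I}, ((\sum_(i <- A) rnorm (f i))%:E <= x)%E) ->
  (esum_norm f <= x)%E.
Proof.
move=> fx; apply: ge_ereal_sup => _ [A [finA _] <-].
by rewrite fsbig_finite//= sumEFin.
Qed.

Definition summable_fun : {pred I -> (scalar_space R k)} :=
  [pred f : I -> (scalar_space R k) | (esum_norm f < +oo)%E].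

Lemma summable_funP f : reflect
  (exists c : R, forall A : {fset I}, \sum_(i <- A) rnorm (f i) <= c)
  (f \in summable_fun).
Proof.
apply: (iffP idP) => [f1|[c fc]]; last first.
  rewrite inE (@le_lt_trans _ _ c%:E) ?ltry//; apply: esum_norm_le => A.
  by rewrite lee_fin.
exists (fine (esum_norm f)) => A.
rewrite -lee_fin fineK ?esum_norm_fset// ge0_fin_numE//.
exact: esum_norm_ge0.
Qed.

Lemma summable_fun_closed : submod_closed summable_fun.
Proof.
split=> [|a f g].
  by apply/summable_funP; exists 0 => A; rewrite big1// => i _; rewrite rnorm0.
move=> /summable_funP[c fc] /summable_funP[d gd]; apply/summable_funP.
exists (re `|a| * c + d) => A.
rewrite (@le_trans _ _ (\sum_(i <- A) (re `|a| * rnorm (f i) + rnorm (g i))))//.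
  by apply: ler_sum => i _; rewrite !fctE (le_trans (rnormD _ _))// rnormZ.
by rewrite big_split/= -mulr_sumr lerD// ler_wpM2l ?re_norm_ge0.
Qed.

HB.instance Definition _ :=
  GRing.isSubmodClosed.Build K (I -> (scalar_space R k)) summable_fun summable_fun_closed.

Record ell1 := Ell1 {
  ell1_fun :> I -> (scalar_space R k);
  ell1_fun_subproof : ell1_fun \in summable_fun }.

HB.instance Definition _ := [isSub for ell1_fun].
HB.instance Definition _ := [Choice of ell1 by <:].
HB.instance Definition _ := [SubChoice_isSubLmodule of ell1 by <:].

Implicit Types x y : ell1.

Definition norm1 x : R := fine (esum_norm x).

Lemma norm1E x : (norm1 x)%:E = esum_norm x.
Proof.
rewrite fineK// ge0_fin_numE ?esum_norm_ge0//.
exact: (ell1_fun_subproof x).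
Qed.

Lemma norm1_ge0 x : 0 <= norm1 x.
Proof. by rewrite fine_ge0 ?esum_norm_ge0. Qed.

Lemma norm1_ub x (A : {fset I}) : \sum_(i <- A) rnorm (x i) <= norm1 x.
Proof. by rewrite -lee_fin norm1E esum_norm_fset. Qed.

Lemma norm1_le x (c : R) :
  (forall A : {fset I}, \sum_(i <- A) rnorm (x i) <= c) -> norm1 x <= c.
Proof.
by move=> xc; rewrite -lee_fin norm1E esum_norm_le// => A; rewrite lee_fin.
Qed.

Lemma norm1_ub1 x i : rnorm (x i) <= norm1 x.
Proof. by have := norm1_ub x [fset i]%fset; rewrite big_seq_fset1. Qed.

Lemma norm1D x y :
  emb (k := k) (norm1 (x + y)) <= emb (norm1 x) + emb (norm1 y).
Proof.
rewrite -embD emb_le; apply: norm1_le => A.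
rewrite (@le_trans _ _ (\sum_(i <- A) (rnorm (x i) + rnorm (y i))))//.
  by apply: ler_sum => i _; rewrite rnormD.
by rewrite big_split/= lerD ?norm1_ub.
Qed.

Lemma norm1Z (a : K) x : emb (norm1 (a *: x)) = `|a| * emb (norm1 x).
Proof.
apply: norm_leZ_eq => [|{}a {}x].
  apply/eqP; rewrite eq_le norm1_ge0 andbT; apply: norm1_le => A.
  by rewrite big1// => i _; rewrite rnorm0.
apply: norm1_le => A; under eq_bigr do rewrite rnormZ.
by rewrite -mulr_sumr ler_wpM2l ?norm1_ub ?re_norm_ge0.
Qed.

Lemma ell1P x y : (forall i, x i = y i) -> x = y.
Proof. by move=> xy; apply/val_inj/funext. Qed.

Lemma norm1_eq0 x : emb (k := k) (norm1 x) = 0 -> x = 0.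
Proof.
rewrite -(@emb0 R k) => /(congr1 (@re R k)); rewrite !embK => x0.
apply: ell1P => i; apply: rnorm0_eq0; apply/eqP.
by rewrite eq_le rnorm_ge0 andbT (le_trans (norm1_ub1 x i))// x0.
Qed.

HB.instance Definition _ := Lmodule_isNormed.Build K ell1
  norm1D norm1Z norm1_eq0.

Lemma rnorm_ell1 x : rnorm x = norm1 x.
Proof. exact: embK. Qed.

Lemma ell1_complete (F : set_system ell1) :
  ProperFilter F -> cauchy F -> cvg F.
Proof.
apply: (@function_space_complete R k ell1 I (scalar_space R k) ell1_fun (fun=> 1)) => //.
- exact: ell1P.
- by move=> x i; rewrite mul1r rnorm_ell1 norm1_ub1.
move=> {}F f M FF M0 Ff FM.
have fM (A : {fset I}) : \sum_(i <- A) rnorm (f i) <= M.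
  have h : (fun x : ell1 => \sum_(i <- A) rnorm (x i)) @ F -->
      \sum_(i <- A) rnorm (f i).
    apply: cvg_big => [|i _]; last exact: cvg_rnorm (Ff i).
    exact: add_continuous.
  apply: (cvgr_to_le h); apply: filterS FM => x /=.
  by rewrite rnorm_ell1; apply: le_trans; exact: norm1_ub.
have fP : f \in summable_fun by apply/summable_funP; exists M.
exists (Ell1 fP) => //.
by rewrite rnorm_ell1 norm1_le.
Qed.

HB.instance Definition _ := Uniform_isComplete.Build ell1 ell1_complete.

End Ell1.

Section ClosedSubspace.
Variables (R : realType) (k : scalar_kind) (Y : Banach R k).
Local Notation K := (scalars R k).

(* A finite-dimensional subspace is automatically closed, so restricting to
   closed subspaces (which are Banach spaces) loses none of them. *)
Record closed_subspace := ClosedSubspace {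
  subspace_pred :> {pred Y};
  subspace_submod : submod_closed subspace_pred;
  subspace_closed : closed [set` subspace_pred] }.

Variable N : closed_subspace.

HB.instance Definition _ := GRing.isSubmodClosed.Build K Y
  (subspace_pred N) (subspace_submod N).

Record subspace_type := SubspaceType {
  subspace_val :> Y;
  subspace_valP : subspace_val \in subspace_pred N }.

HB.instance Definition _ := [isSub for subspace_val].
HB.instance Definition _ := [Choice of subspace_type by <:].
HB.instance Definition _ := [SubChoice_isSubLmodule of subspace_type by <:].

Implicit Types x y : subspace_type.

Lemma subspace_normD x y : `|val (x + y)| <= `|val x| + `|val y|.
Proof. exact: ler_normD. Qed.

Lemma subspace_normZ (a : K) x : `|val (a *: x)| = `|a| * `|val x|.
Proof. exact: normrZ. Qed.

Lemma subspace_norm0_eq0 x : `|val x| = 0 -> x = 0.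
Proof. by move=> /normr0_eq0 x0; apply: val_inj. Qed.

HB.instance Definition _ := Lmodule_isNormed.Build K subspace_type
  subspace_normD subspace_normZ subspace_norm0_eq0.

Lemma rnorm_subspace x : rnorm x = rnorm (val x).
Proof. by []. Qed.

Lemma subspace_complete (F : set_system subspace_type) :
  ProperFilter F -> cauchy F -> cvg F.
Proof.
apply: (@function_space_complete _ _ _ unit Y (fun x _ => val x)
  (fun=> 1)) => //.
- by move=> x y /(_ tt) xy; apply: val_inj.
- by move=> x i; rewrite mul1r.
move=> {}F f M FF M0 /(_ tt) Ff FM.
have fN : f tt \in subspace_pred N.
  apply: (closed_cvg _ (@subspace_closed N) _ _ Ff).
  by apply: nearW => x; exact: subspace_valP.
have fM : rnorm (f tt) <= M.
  by apply: (cvgr_to_le (cvg_rnorm Ff)); exact: filterS FM.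
by exists (SubspaceType fN) => //= -[].
Qed.

HB.instance Definition _ :=
  Uniform_isComplete.Build subspace_type subspace_complete.

End ClosedSubspace.

#[global] Existing Instance summability.totally_filter.

Section CanonicalOperators.
Variables (R : realType) (k : scalar_kind).
Local Notation K := (scalars R k).
Local Notation dual X := (operator X (scalar_space R k)).
Implicit Types X Y Z : Banach R k.

Lemma id_op_subproof X : idfun \in @bounded_linear R k X X.
Proof.
by apply/bounded_linearP; split=> //; exists 1 => x; rewrite mul1r.
Qed.

Definition id_op X : operator X X := Operator (id_op_subproof X).

Lemma comp_op_subproof X Y Z (U : operator Z Y) (V : operator X Z) :
  U \o V \in @bounded_linear R k X Y.
Proof.
apply/bounded_linearP; split=> [a u v|]; first by rewrite /= !linearP.
exists (opnorm U * opnorm V) => x /=.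
rewrite (le_trans (opnorm_ub _ _))// -mulrA ler_wpM2l ?opnorm_ge0//.
exact: opnorm_ub.
Qed.

Definition comp_op X Y Z (U : operator Z Y) (V : operator X Z) : operator X Y :=
  Operator (comp_op_subproof U V).

Lemma adjoint_subproof X Y (T : operator X Y) :
  (fun phi : dual Y => comp_op phi T) \in @bounded_linear R k (dual Y) (dual X).
Proof.
apply/bounded_linearP; split=> [a u v|]; first exact: operatorP.
exists (opnorm T) => phi; rewrite !rnorm_op; apply: opnorm_le => [|x].
  by rewrite mulr_ge0 ?opnorm_ge0.
rewrite mulrAC mulrC (le_trans (opnorm_ub phi (T x)))// ler_wpM2l ?opnorm_ge0//.
exact: opnorm_ub.
Qed.

Definition adjoint X Y (T : operator X Y) : operator (dual Y) (dual X) :=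
  Operator (adjoint_subproof T).

Lemma subspace_incl_subproof Y (N : closed_subspace Y) :
  @subspace_val R k Y N \in @bounded_linear R k (subspace_type N) Y.
Proof.
by apply/bounded_linearP; split=> //; exists 1 => x; rewrite mul1r rnorm_subspace.
Qed.

Definition subspace_incl Y (N : closed_subspace Y) :
  operator (subspace_type N) Y := Operator (subspace_incl_subproof N).

Definition unit_ball (X : Banach R k) : choiceType := {x : X | `|x| <= 1}.

Definition ball_eval Y (y : Y) (phi : unit_ball (dual Y)) : scalar_space R k :=
  (val phi : dual Y) y.

Lemma ball_eval_le Y (y : Y) (phi : unit_ball (dual Y)) :
  rnorm (ball_eval y phi) <= rnorm y.
Proof.
rewrite (le_trans (opnorm_ub _ _))// -[leRHS]mul1r ler_wpM2r ?rnorm_ge0//.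
by rewrite -rnorm_op -rnorm_le1 (valP phi).
Qed.

Lemma ball_eval_bounded Y (y : Y) :
  ball_eval y \in @bounded_fun R k (unit_ball (dual Y)).
Proof. by apply/bounded_funP; exists (rnorm y) => phi; exact: ball_eval_le. Qed.

Lemma inj_embedding_subproof Y : (fun y : Y => EllInf (ball_eval_bounded y)) \in
  @bounded_linear R k Y (ell_inf R k (unit_ball (dual Y))).
Proof.
apply/bounded_linearP; split=> [a u v|].
  by apply: ell_infP => phi; rewrite /= /ball_eval linearP.
exists 1 => y; rewrite rnorm_ell_inf mul1r supnorm_le ?rnorm_ge0// => phi.
exact: ball_eval_le.
Qed.

Definition inj_embedding Y : operator Y (ell_inf R k (unit_ball (dual Y))) :=
  Operator (inj_embedding_subproof Y).

Section SurQuotient.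
Variable X : Banach R k.
Local Notation ell1_ball := (ell1 R k (unit_ball X)).

Definition ball_terms (l : ell1_ball) (b : unit_ball X) : X :=
  (l b : K) *: (val b : X).

Lemma ball_terms_le l b : rnorm (ball_terms l b) <= rnorm (l b).
Proof.
rewrite rnormZ -[leRHS]mulr1 ler_wpM2l ?re_norm_ge0//.
by rewrite -rnorm_le1 (valP b).
Qed.

Lemma partial_sumE l (A : {fset unit_ball X}) :
  summability.partial_sum (ball_terms l) A = \sum_(b <- A) ball_terms l b.
Proof. by rewrite [RHS]big_seq_fsetE. Qed.

Lemma ball_terms_cvg l :
  cvg (summability.partial_sum (ball_terms l) @ summability.totally).
Proof.
apply: cauchy_cvg; apply/rnorm_cauchyP => e e0.
have [A lA] : exists A : {fset unit_ball X},
    norm1 l - e < \sum_(b <- A) rnorm (l b).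
  apply: contrapT => /forallNP h.
  have : norm1 l <= norm1 l - e.
    by apply: norm1_le => A; rewrite leNgt; apply/negP/h.
  by rewrite leNgt gtrBl e0.
exists (summability.partial_sum (ball_terms l) A).
exists A => // B /= AB; rewrite !partial_sumE rnormB.
have split_sum (V : nmodType) (f : unit_ball X -> V) :
    \sum_(b <- B) f b =
    \sum_(b <- A) f b + \sum_(b <- B | b \notin A) f b.
  rewrite (bigID (mem A))/=; congr (_ + _).
  rewrite -big_filter; apply: perm_big; apply: uniq_perm.
  - exact/filter_uniq/fset_uniq.
  - exact: fset_uniq.
  - move=> b; rewrite mem_filter; apply: andb_idr => bA.
    exact: (fsubsetP AB).
rewrite split_sum addrC addKr -big_filter (le_trans (rnorm_sum _ _))//.
rewrite (@le_trans _ _ (\sum_(b <- B | b \notin A) rnorm (l b)))//.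
  by rewrite big_filter; apply: ler_sum => b _; exact: ball_terms_le.
have := norm1_ub l B; rewrite split_sum => lB.
rewrite -(lerD2l (\sum_(b <- A) rnorm (l b))) (le_trans lB)//.
by rewrite -lerBlDr ltW.
Qed.

Arguments ball_terms_cvg : clear implicits.

Lemma sur_quotient_subproof :
  (fun l => summability.sum (ball_terms l)) \in
    @bounded_linear R k ell1_ball X.
Proof.
apply/bounded_linearP; split=> [a u v|].
  apply: cvg_lim; first exact: norm_hausdorff.
  rewrite (_ : summability.partial_sum _ = (fun A =>
    a *: summability.partial_sum (ball_terms u) A +
    summability.partial_sum (ball_terms v) A)); last first.
    apply/funext => A; rewrite !partial_sumE scaler_sumr -big_split/=.
    by apply: eq_bigr => b _; rewrite /ball_terms scalerA -scalerDl.
  exact: cvgD (cvgZl_tmp (ball_terms_cvg u)) (ball_terms_cvg v).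
exists 1 => l; rewrite mul1r rnorm_ell1.
apply: (cvgr_to_le (cvg_rnorm (ball_terms_cvg l))).
apply: nearW => A; rewrite partial_sumE (le_trans (rnorm_sum _ _))//.
rewrite (le_trans _ (norm1_ub l A))//.
by apply: ler_sum => b _; exact: ball_terms_le.
Qed.

Definition sur_quotient : operator ell1_ball X := Operator sur_quotient_subproof.

End SurQuotient.

End CanonicalOperators.

Arguments subspace_incl {R k Y} N.
Arguments sur_quotient {R k} X.
Arguments inj_embedding {R k} Y.
Arguments id_op {R k} X.
Arguments comp_op {R k X Y Z} U V.
Arguments adjoint {R k X Y} T.
Arguments unit_ball {R k} X.

Notation dual X := (operator X (scalar_space _ _)).

Unset Implicit Arguments.

Section OperatorIdeals.
Variables (R : realType) (k : scalar_kind).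
Local Notation K := (scalars R k).

Definition op_class := forall X Y : Banach R k, set (operator X Y).

Definition finite_dimensional {V : lmodType K} (S : set V) : Prop :=
  exists n (e : 'I_n -> V), forall v, S v ->
    exists c : 'I_n -> K, v = \sum_(i < n) c i *: e i.

Definition finite_rank : op_class := fun X Y =>
  [set T | finite_dimensional (range T)].

Definition approximable : op_class := fun X Y => closure (finite_rank X Y).

Definition compact_op : op_class := fun X Y =>
  [set T | precompact (T @` [set x | `|x| <= 1])].

Definition comp_class (A1 A2 : op_class) : op_class := fun X Y =>
  [set T | exists (Z : Banach R k) (U : operator Z Y) (V : operator X Z),
     [/\ A1 Z Y U, A2 X Z V & T = comp_op U V]].

Definition min_class (A : op_class) : op_class :=
  comp_class approximable (comp_class A approximable).

Definition dual_class (A : op_class) : op_class := fun X Y =>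
  [set T | A (dual Y) (dual X) (adjoint T)].

Definition inj_hull (A : op_class) : op_class := fun X Y =>
  [set T | A _ _ (comp_op (inj_embedding Y) T)].

Definition sur_hull (A : op_class) : op_class := fun X Y =>
  [set T | A _ _ (comp_op T (sur_quotient X))].

(* Pietsch's quasi-normed operator ideals with complete components. The
   quasi-norm is only meaningful on the members of the ideal. *)
Record operator_ideal := OperatorIdeal {
  member :> forall X Y : Banach R k, set (operator X Y);
  qnorm : forall {X Y : Banach R k}, operator X Y -> R;
  ideal_id : member _ _ (id_op (scalar_space R k));
  ideal_add : forall (X Y : Banach R k) (S T : operator X Y),
    member X Y S -> member X Y T -> member X Y (S + T);
  ideal_comp : forall (X0 X Y Y0 : Banach R k) (U : operator Y Y0)
      (T : operator X Y) (V : operator X0 X),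
    member X Y T -> member X0 Y0 (comp_op U (comp_op T V));
  qnorm_ge0 : forall (X Y : Banach R k) (T : operator X Y),
    member X Y T -> 0 <= qnorm T;
  qnorm_id : qnorm (id_op (scalar_space R k)) = 1;
  qnorm_add : exists2 kappa : R, 1 <= kappa &
    forall (X Y : Banach R k) (S T : operator X Y), member X Y S -> member X Y T ->
      qnorm (S + T) <= kappa * (qnorm S + qnorm T);
  qnorm_comp : forall (X0 X Y Y0 : Banach R k) (U : operator Y Y0)
      (T : operator X Y) (V : operator X0 X), member X Y T ->
    qnorm (comp_op U (comp_op T V)) <= rnorm U * qnorm T * rnorm V;
  ideal_complete : forall (X Y : Banach R k) (T : nat -> operator X Y),
    (forall n, member X Y (T n)) ->
    (forall e : R, 0 < e ->
       exists N, forall m n, (N <= m)%N -> (N <= n)%N -> qnorm (T m - T n) < e) ->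
    exists2 S : operator X Y, member X Y S &
      forall e : R, 0 < e ->
        exists N, forall n, (N <= n)%N -> qnorm (T n - S) < e }.

Arguments qnorm A {X Y} T : rename.

Implicit Type A : operator_ideal.

(* A^sur = A as quasi-normed ideals: same components and same quasi-norm. *)
Definition surjective_ideal A : Prop :=
  (forall X Y : Banach R k, sur_hull A X Y = A X Y) /\
  (forall (X Y : Banach R k) (T : operator X Y), A X Y T ->
     qnorm A (comp_op T (sur_quotient X)) = qnorm A T).

Definition right_accessible A : Prop :=
  forall (M Y : Banach R k) (T : operator M Y) (e : R),
    finite_dimensional [set: M] -> A M Y T -> 0 < e ->
    exists (N : closed_subspace Y) (S : operator M (subspace_type N)),
      [/\ finite_dimensional [set` N], A _ _ S, T = comp_op (subspace_incl N) S
        & qnorm A S <= (1 + e) * qnorm A T].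

(* Infima are taken in \bar R, so that an empty one is +oo. *)
Definition kappa_norm A {X Y : Banach R k} (T : operator X Y) : \bar R :=
  ereal_inf [set r | exists (Z : Banach R k) (T1 : operator Z Y)
      (T2 : operator X Z),
    [/\ A Z Y T1, compact_op X Z T2, T = comp_op T1 T2
      & r = (qnorm A T1 * rnorm T2)%:E]].

(* A linear subspace Z of E with its own complete norm is a Banach space Z with
   an injective linear map iZ into E, the formal inclusion. *)
Definition admissible {E : Banach R k} (C : set E) {Z : Banach R k}
    (iZ : operator Z E) : Prop :=
  [/\ injective iZ, compact_op Z E iZ, C `<=` iZ @` [set z | `|z| <= 1]
    & forall (g : dual Z) (e : R), 0 < e -> exists f : dual E,
        forall z, `|z| <= 1 -> rnorm (f (iZ z) - g z) < e].

Definition lambda_norm A {E G : Banach R k} (C : set E) (T : operator E G) :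
    \bar R :=
  ereal_inf [set r | exists (Z : Banach R k) (iZ : operator Z E),
    admissible C iZ /\ r = kappa_norm A (comp_op T iZ)].

(* Neighbourhoods of T in A(E, G) for the translation-invariant topology whose
   neighbourhoods of 0 are generated by the sets where one lambda_norm is < e. *)
Definition lambda_nbhs A {E G : Banach R k} (T : operator E G) :
    set (set (operator E G)) :=
  [set U | exists n (C : 'I_n -> set E) (e : R),
    [/\ forall i, compact (C i), 0 < e
      & forall S, A E G S ->
          (forall i, (lambda_norm A (C i) (S - T)%R < e%:E)%E) -> U S]].

Definition approximation_property A (X : Banach R k) : Prop :=
  forall (Y : Banach R k) (T : operator Y X), A Y X T ->
  forall U, lambda_nbhs A T U -> (U `&` finite_rank Y X) !=set0.

End OperatorIdeals.

Arguments finite_dimensional {R k V} S.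
Arguments member {R k} A X Y _ : rename.
Arguments qnorm {R k} A {X Y} T : rename.
Arguments kappa_norm {R k} A {X Y} T.
Arguments admissible {R k E} C {Z} iZ.
Arguments lambda_norm {R k} A {E G} C T.
Arguments lambda_nbhs {R k} A {E G} T _.
Arguments finite_rank {R k}.
Arguments approximable {R k}.
Arguments compact_op {R k}.
Arguments comp_class {R k}.
Arguments min_class {R k}.
Arguments dual_class {R k}.
Arguments inj_hull {R k}.
Arguments sur_hull {R k}.
Arguments surjective_ideal {R k}.
Arguments right_accessible {R k}.
Arguments approximation_property {R k}.

(* Main.v *)
(* Write R_U for the range of an operator U with its quotient norm; if A is
   surjective, the inclusion of R_U belongs to A as soon as U does.

   Right accessibility yields that A^min contains every limit, for the
   quasi-norm of A, of finite rank operators: such a limit is a rapidly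
   converging series of finite rank operators, each of which factors through
   finite-dimensional spaces, and the factors are assembled on l_infty-sums.
   Let q be the quotient map from l_1(B_Y) onto Y.  In particular T o q is in
   A^min whenever T is a compact operator on Y followed by a member of A,
   because compact operators on l_1 are approximable.  Conversely, if
   T o q = U o V is in A^min, then T corestricts to a compact operator into
   R_U, so (A^min)^sur = A o K.

   The A-approximation property of X turns a factorization T = U o C, with C
   compact and U in A, into approximations S o C by finite rank operators for
   the quasi-norm of A.  Conversely, for a compact C, a c_0-type interpolation
   space between a space mapped compactly onto a set containing C and Y is an
   admissible Z: a sliding hump shows that its functionals are continuous for
   the norm of Y on its unit ball, and Hahn-Banach approximates them by
   functionals on Y.  If T o i_Z is in A^min, it is then approximated by
   S o i_Z with S of finite rank on Y.

   Part (b) dualizes this: A^dual is an operator ideal, compact operators into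
   l_infty are approximable, a compact operator has a bidual with values in its
   target, so finite rank approximations of T^* may be taken weak*-continuous,
   and T o i_Z : Z -> X^* has a preadjoint-like partner X -> Z^* in K o A^dual. *)

Require Import Defs.
From HB Require Import structures.
From mathcomp Require Import all_boot all_order all_algebra.
From mathcomp Require Import complex finmap.
From mathcomp Require Import all_classical all_reals.
From mathcomp Require Import ereal topology normedtype.
From mathcomp.analysis Require summability.
From mathcomp Require Import ring lra.

Set Implicit Arguments.
Unset Strict Implicit.
Unset Printing Implicit Defensive.

Import Order.TTheory GRing.Theory Num.Theory.
Import numFieldNormedType.Exports.

Local Open Scope classical_set_scope.
Local Open Scope ring_scope.

(** Both halves rest on one interface, [finite_rank_factors]: a finite rank operator is (finite
    rank) o (member) o (finite rank), with a uniform constant. For A it is right accessibility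
    applied to the inclusion of the range, a member of A by surjectivity. For the dual ideal it is
    read off the range of the adjoint, which sits in a dual space and is brought back by the
    reflexivity of finite-dimensional spaces. The obstacle in assembling such factors is that A has
    only a quasi-norm, with some constant kappa: partial sums are under control when the terms decay
    like (2 kappa)^-n. The outer factors of the n-th term are scaled by 2^-(n+1), so that their
    series are approximable, and the middle one pays 4^(n+1); hence approximants are taken at the
    rate (8 kappa)^-n. Only membership in A^min is at stake, so lifts through quotients may cost a
    factor 2. In (b) the inclusion of Z passes through a second interpolation space, because
    compactness is spent twice: once to put the partner of T into the dual ideal, once to make its
    composition with the embedding into l_infty approximable. *)

Section Emb.
Variables (R : realType) (k : scalar_kind).
Local Notation K := (scalars R k).

Lemma emb1 : emb (k := k) (1 : R) = 1.
Proof. by rewrite /emb; case: k. Qed.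

Lemma embN (x : R) : emb (k := k) (- x) = - emb x.
Proof. by apply/eqP; rewrite -addr_eq0 -embD addNr emb0. Qed.

Lemma emb_eq0 (x : R) : (emb (k := k) x == 0) = (x == 0).
Proof. by rewrite -(@emb0 R k); apply/eqP/eqP => [/(congr1 re)|->//]; rewrite !embK. Qed.

Lemma re_norm_emb (x : R) : re `|emb (k := k) x| = `|x|.
Proof.
have [x0|x0] := leP 0 x.
  by rewrite !ger0_norm// ?embK// -(@emb0 R k) emb_le.
by rewrite !ltr0_norm// -?embN ?embK// -(@emb0 R k) emb_lt.
Qed.

Lemma re_normM (a b : K) : re `|a * b| = re `|a| * re `|b|.
Proof.
by rewrite normrM -[RHS](embK k) embM !reK_ge0.
Qed.

Lemma re_norm1 : re `|1 : K| = 1.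
Proof. by rewrite normr1 -emb1 embK. Qed.

Lemma re1 : re (1 : K) = 1.
Proof. by rewrite -emb1 embK. Qed.

Lemma re_norm0 : re `|0 : K| = 0.
Proof. by rewrite normr0 -(emb0 R k) embK. Qed.

Lemma reD (a b : K) : re (a + b) = re a + re b.
Proof. by move: a b; rewrite /re; case: k => //= -[? ?] [? ?]. Qed.

Lemma re_embM (t : R) (a : K) : re (emb t * a) = t * re a.
Proof.
by move: a; rewrite /re /emb; case: k => //= -[a b] /=; rewrite mul0r subr0.
Qed.

Lemma re_le_norm (a : K) : re a <= re `|a|.
Proof.
move: a; rewrite /re; case: k => /= a; first exact: ler_norm.
apply: le_trans (ler_norm _) _.
by have := normc_ge_Re a; rewrite lecE => /andP[_].
Qed.

Lemma re_norm_eq0 (a : K) : re `|a| = 0 -> a = 0.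
Proof. by move=> h; apply/eqP; rewrite -normr_eq0 -(reK_ge0 (normr_ge0 a)) h emb0. Qed.

End Emb.

(** * The Hahn-Banach theorem over real or complex scalars *)

Lemma functional_of_real_part (R : realType) (k : scalar_kind)
    (V : lmodType (scalars R k)) (rho : V -> R) :
  (forall u v, rho (u + v) = rho u + rho v) ->
  (forall (t : R) v, rho (emb (k := k) t *: v) = t * rho v) ->
  exists G : V -> scalars R k,
    (forall a u v, G (a *: u + v) = a * G u + G v) /\ (forall v, re (G v) = rho v).
Proof.
case: k V rho => V rho rhoD rhoZ; first by exists rho; split=> // a u v;
  rewrite rhoD rhoZ.
pose I : R[i] := 'i%C.
(* A complex-linear functional is recovered from its real part, since Im G(v) = - Re G(iv). *)
exists (fun v => (rho v -i* rho (I *: v))%C); split=> // -[x y] u v.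
have aE : (x +i* y)%C = (emb (k := ComplexScalars) x : R[i]) + (emb (k :=
  ComplexScalars) y : R[i]) * I.
  by rewrite /emb /=; apply/eqP;
    rewrite eq_complex /= !(mulr0, mul0r, mulr1, addr0, add0r, subr0) !eqxx.
have rhoa w : rho ((x +i* y)%C *: w) = x * rho w + y * rho (I *: w).
  by rewrite aE scalerDl -scalerA rhoD !rhoZ.
have II w : I *: (I *: w) = - w.
  by rewrite scalerA -expr2 sqr_i scaleN1r.
have rhoN w : rho (- w) = - rho w.
  by rewrite -scaleN1r -(@emb1 R ComplexScalars) -embN rhoZ mulN1r.
have -> : I *: ((x +i* y)%C *: u + v) = (x +i* y)%C *: (I *: u) + I *: v.
  by rewrite scalerDr !scalerA mulrC.
rewrite !rhoD !rhoa II rhoN; apply/eqP; rewrite eq_complex /=; apply/andP; split;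
  apply/eqP; ring.
Qed.

Section HahnBanach.
Variables (R : realType) (k : scalar_kind).
Local Notation K := (scalars R k).
Variables (V : lmodType K) (p : V -> R).
Hypothesis pD : forall u v, p (u + v) <= p u + p v.
Hypothesis pZ : forall a v, p (a *: v) <= re `|a| * p v.

Let p0 : p 0 <= 0.
Proof. by have := pZ 0 0; rewrite scale0r re_norm0 mul0r. Qed.

(** Partial real-linear functionals are taken as graphs, so that extension is inclusion and chains
    are united as sets. Single-valuedness follows from domination, since [p 0 <= 0]. *)
Definition dominated_graph (G : set (V * R)) :=
  [/\ forall u v r s, G (u, r) -> G (v, s) -> G (u + v, r + s),
      forall v r (t : R), G (v, r) -> G (emb t *: v, t * r)
    & forall v r, G (v, r) -> r <= p v].

Lemma dominated_graph_fun G v r s : dominated_graph G -> G (v, r) -> G (v, s) -> r = s.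
Proof.
move=> [GD GZ Gp].
suff le x y : G (v, x) -> G (v, y) -> x <= y.
  by move=> Gr Gs; apply/eqP; rewrite eq_le !le.
move=> Gx Gy; have := GD _ _ _ _ Gx (GZ _ _ (-1) Gy).
rewrite embN emb1 scaleN1r subrr => /Gp/le_trans/(_ p0).
by rewrite mulN1r subr_le0.
Qed.

Lemma dominated_graph_extend G v0 : dominated_graph G -> G !=set0 ->
  exists2 G', dominated_graph G' & G `<=` G' /\ exists c, G' (v0, c).
Proof.
move=> [GD GZ Gp] [[v1 r1] Gv1].
(* The value at [v0] has to lie between all s - p (u - v0) and all p (u + v0) - s. Subadditivity
   makes these bounds compatible; the supremum of the lower ones is chosen. *)
pose E := [set r | exists u s, G (u, s) /\ r = s - p (u - v0)].
have Eub u s : G (u, s) -> ubound E (p (u + v0) - s).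
  move=> Gu _ [v [r [Gv ->]]]; rewrite lerBlDr addrAC lerBrDr.
  rewrite (le_trans (Gp _ _ (GD _ _ _ _ Gv Gu)))//.
  have -> : v + u = (u + v0) + (v - v0) by rewrite addrACA subrr addr0 addrC.
  exact: pD.
have Esup : has_sup E.
  by split; [exists (r1 - p (v1 - v0)), v1, r1|exists (p (v1 + v0) - r1); exact: Eub].
pose c := sup E.
have cle u s : G (u, s) -> s + c <= p (u + v0).
  by move=> /Eub h; rewrite addrC -lerBrDr; apply: ge_sup h; case: Esup.
have cge u s : G (u, s) -> s - c <= p (u - v0).
  move=> Gu; rewrite lerBlDr addrC -lerBlDr; apply: sup_upper_bound => //.
  by exists u, s.
exists [set x | exists u s (t : R), G (u, s) /\ x = (u + emb t *: v0, s + t * c)].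
  split.
  - move=> _ _ _ _ [u [r [t [Gu [-> ->]]]]] [v [s [t' [Gv [-> ->]]]]].
    exists (u + v), (r + s), (t + t'); split; first exact: GD.
    by rewrite embD scalerDl mulrDl addrACA [r + _ + _]addrACA.
  - move=> _ _ a [u [r [t [Gu [-> ->]]]]].
    exists (emb a *: u), (a * r), (a * t); split; first exact: GZ.
    by rewrite scalerDr scalerA embM mulrDr mulrA.
  move=> _ _ [u [r [t [Gu [-> ->]]]]].
  have [t0|t0|->] := ltgtP t 0; last first.
  - by rewrite emb0 scale0r mul0r !addr0; exact: Gp.
  - have := cle _ _ (GZ _ _ t^-1 Gu).
    rewrite -(ler_pM2l t0) mulrDr mulrA divff ?gt_eqF// mul1r => h.
    apply: le_trans h _; rewrite -ler_pdivlMl//.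
    have := pZ (emb t^-1) (u + emb t *: v0).
    by rewrite re_norm_emb gtr0_norm ?invr_gt0// scalerDr scalerA -embM mulVf ?gt_eqF//
      emb1 scale1r.
  have nt0 : 0 < - t by rewrite oppr_gt0.
  have := cge _ _ (GZ _ _ (- t)^-1 Gu).
  rewrite -(ler_pM2l nt0) mulrBr mulrA divff ?gt_eqF// mul1r mulNr opprK => h.
  apply: le_trans h _; rewrite -ler_pdivlMl//.
  have := pZ (emb (- t)^-1) (u + emb t *: v0).
  rewrite re_norm_emb gtr0_norm ?invr_gt0// scalerDr scalerA -embM invrN mulNr mulVf
    ?lt_eqF//.
  by rewrite !embN emb1 scaleN1r.
split; last first.
  exists c, 0, 0, 1; rewrite add0r emb1 scale1r add0r mul1r; split=> //.
  by have := GZ _ _ 0 Gv1; rewrite emb0 scale0r mul0r.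
by move=> [u s] Gu; exists u, s, 0; rewrite emb0 scale0r mul0r !addr0.
Qed.

Lemma hahn_banach_graph G0 : dominated_graph G0 -> G0 !=set0 ->
  exists2 rho : V -> R,
    [/\ forall u v, rho (u + v) = rho u + rho v,
        forall (t : R) v, rho (emb t *: v) = t * rho v
      & forall v, rho v <= p v]
    & forall v r, G0 (v, r) -> rho v = r.
Proof.
move=> G0d [x0 G0x].
(* The property is imposed on the union with [G0] rather than on sets containing [G0], so that it
   also holds for the union of the empty chain. *)
have [|A [PA Amax]] := @Zorn_bigcup _ [set G | dominated_graph (G `|` G0)].
  move=> F FP Ftot.
  have sub X : F X -> X `|` G0 `<=` (\bigcup_(Y in F) Y) `|` G0.
    by move=> FX; apply: setSU => x Xx; exists X.
  have pick x y : ((\bigcup_(Y in F) Y) `|` G0) x -> ((\bigcup_(Y in F) Y) `|` G0) y ->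
      exists H, [/\ dominated_graph H, H `<=` (\bigcup_(Y in F) Y) `|` G0, H x & H y].
    move=> [[X FX Xx]|x1] [[Y FY Yy]|y1].
    - have [XY|YX] := Ftot _ _ FX FY.
        by exists (Y `|` G0); split; [exact: FP|exact: sub|left; exact: XY|left].
      by exists (X `|` G0); split; [exact: FP|exact: sub|left|left; exact: YX].
    - by exists (X `|` G0); split; [exact: FP|exact: sub|left|right].
    - by exists (Y `|` G0); split; [exact: FP|exact: sub|right|left].
    - by exists G0; split=> //; exact: subsetUr.
  split.
  - by move=> u v r s Gu Gv; have [H [[HD _ _] HG Hu Hv]] := pick _ _ Gu Gv; exact/HG/HD.
  - by move=> v r t Gv; have [H [[_ HZ _] HG Hv _]] := pick _ _ Gv Gv; exact/HG/HZ.
  - by move=> v r Gv; have [H [[_ _ Hp] _ Hv _]] := pick _ _ Gv Gv; exact: Hp.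
set G := A `|` G0 in PA.
have Gtot v : exists r, G (v, r).
  apply: contrapT => nG.
  have [|G' G'd [GG' [c G'c]]] := dominated_graph_extend v PA; first by exists x0; right.
  apply: (Amax G'); last first.
    by rewrite /= setUidl// => x xG; apply: GG'; right.
  split; first by move=> x xA; apply: GG'; left.
  by move=> h; apply: nG; exists c; left; exact: h.
have [rho Grho] := choice Gtot.
have uniq v r : G (v, r) -> rho v = r by move=> Gr;
  exact: (dominated_graph_fun PA (Grho v) Gr).
case: (PA) => GD GZ Gp.
exists rho; first split.
- by move=> u v; apply: uniq; apply: GD; exact: Grho.
- by move=> t v; apply: uniq; apply: GZ; exact: Grho.
- by move=> v; apply: Gp; exact: Grho.
- by move=> v r h; apply: uniq; right.
Qed.

(** Formulated along a linear map [j] instead of a subspace: it is applied to graphs such as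
    [z |-> (i z, z)] and to maps that need not be injective. The real part of [g] is extended
    first. *)
Theorem hahn_banach (W : lmodType K) (j : W -> V) (g : W -> K) :
  linear j -> (forall a u v, g (a *: u + v) = a * g u + g v) ->
  (forall w, re `|g w| <= p (j w)) ->
  exists2 G : V -> K,
    (forall a u v, G (a *: u + v) = a * G u + G v) /\ (forall v, re `|G v| <= p v)
    & forall w, G (j w) = g w.
Proof.
move=> jL gL gp.
have jD u v : j (u + v) = j u + j v by have := jL 1 u v; rewrite !scale1r.
have j0 : j 0 = 0 by apply: (addrI (j 0)); rewrite -jD !addr0.
have jZ a u : j (a *: u) = a *: j u by have := jL a u 0; rewrite j0 !addr0.
have gD u v : g (u + v) = g u + g v by have := gL 1 u v; rewrite scale1r mul1r.
have g0 : g 0 = 0 by apply: (addrI (g 0)); rewrite -gD !addr0.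
have gZ a u : g (a *: u) = a * g u by have := gL a u 0; rewrite g0 !addr0.
pose G0 := [set x | exists w, x = (j w, re (g w))].
have [||rho [rhoD rhoZ rhop] rhoE] := @hahn_banach_graph G0.
- split.
  + by move=> _ _ _ _ [u [-> ->]] [v [-> ->]]; exists (u + v); rewrite jD gD reD.
  + by move=> _ _ t [u [-> ->]]; exists (emb t *: u); rewrite jZ gZ re_embM.
  + by move=> _ _ [u [-> ->]]; apply: le_trans (gp u); exact: re_le_norm.
- by exists (j 0, re (g 0)), 0.
have {}rhoE w : rho (j w) = re (g w) by apply: rhoE; exists w.
have rhoZ' : forall (t : R) v, rho (emb (k := k) t *: v) = t * rho v := rhoZ.
have [G [GL Gre]] := functional_of_real_part rhoD rhoZ'.
have GD x y : G (x + y) = G x + G y by have := GL 1 x y; rewrite scale1r mul1r.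
have G0' : G 0 = 0 by apply: (addrI (G 0)); rewrite -GD !addr0.
have GZ a u : G (a *: u) = a * G u by have := GL a u 0; rewrite G0' !addr0.
(* Multiplying by a scalar that turns a value into its modulus converts bounds on real parts into
   bounds on moduli. *)
have rot (a : K) : exists2 b : K, b * a = `|a| & re `|b| <= 1.
  have [->|a0] := eqVneq a 0; first by exists 0;
    rewrite ?mul0r ?normr0// -(@emb0 R k) embK.
  exists (`|a| / a); first by rewrite mulfVK.
  by rewrite normrM normr_id normfV divff ?normr_eq0// re1.
exists G; first split=> // v.
  have [b bE b1] := rot (G v).
  rewrite -bE -GZ Gre (le_trans (rhop _))// (le_trans (pZ _ _))//.
  have pv0 : 0 <= p v.
    have := pD v (- v); have := pZ (-1) v; have := rhop 0.
    rewrite -Gre G0' -{1}(@emb0 R k) embK subrr scaleN1r normrN1 re1 mul1r; lra.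
  by rewrite -[leRHS]mul1r ler_wpM2r.
move=> w; apply/eqP; rewrite -subr_eq0; apply/eqP/re_norm_eq0.
have [b bE _] := rot (G (j w) - g w).
rewrite -bE mulrBr -GZ -jZ -gZ -[X in _ - X]opprK opprK reD -mulN1r -(@emb1 R k) -embN
  re_embM.
by rewrite Gre rhoE mulN1r subrr.
Qed.

End HahnBanach.

Section Functionals.
Variables (R : realType) (k : scalar_kind).
Local Notation K := (scalars R k).
Local Notation dual X := (operator X (scalar_space R k)).

Lemma rnorm_gt0 (X : normedModType K) (x : X) : x != 0 -> 0 < rnorm x.
Proof.
move=> x0; rewrite lt_neqAle rnorm_ge0 andbT eq_sym.
by apply: contra_neq x0 => /rnorm0_eq0.
Qed.

Lemma operator_exists (X Y : normedModType K) (f : X -> Y) (c : R) :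
  linear f -> 0 <= c -> (forall x, rnorm (f x) <= c * rnorm x) ->
  exists2 T : operator X Y, (forall x, T x = f x) & rnorm T <= c.
Proof.
move=> fl c0 fc.
have fP : f \in @bounded_linear R k X Y by apply/bounded_linearP; split=> //; exists c.
by exists (Operator fP) => //; rewrite rnorm_op opnorm_le.
Qed.

Lemma rnorm_apply (X Y : normedModType K) (T : operator X Y) x :
  rnorm (T x) <= rnorm T * rnorm x.
Proof. by rewrite rnorm_op opnorm_ub. Qed.

Lemma rnorm_le_op (X Y : normedModType K) (T : operator X Y) c : 0 <= c ->
  (forall x, rnorm (T x) <= c * rnorm x) -> rnorm T <= c.
Proof. by rewrite rnorm_op; exact: opnorm_le. Qed.

Lemma rnorm_apply_ball (X Y : normedModType K) (T : operator X Y) x :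
  rnorm x <= 1 -> rnorm (T x) <= rnorm T.
Proof.
by move=> x1; rewrite (le_trans (rnorm_apply T x))// -[leRHS]mulr1 ler_wpM2l// rnorm_ge0.
Qed.

Lemma rnorm_comp (X Y Z : Banach R k) (U : operator Z Y) (V : operator X Z) :
  rnorm (comp_op U V) <= rnorm U * rnorm V.
Proof.
apply: rnorm_le_op => [|x]; first by rewrite mulr_ge0 ?rnorm_ge0.
rewrite (le_trans (rnorm_apply U _))// -mulrA ler_wpM2l ?rnorm_ge0//.
exact: rnorm_apply.
Qed.

Lemma rnorm_scalar (a : scalar_space R k) : rnorm a = re `|a : K|.
Proof. by []. Qed.

Lemma rnorm_le_ball (X Y : normedModType K) (T : operator X Y) c : 0 <= c ->
  (forall x, rnorm x <= 1 -> rnorm (T x) <= c) -> rnorm T <= c.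
Proof.
move=> c0 Tc; rewrite rnorm_op; apply: ge_sup; first by have [] := opnorm_has_sup T.
by move=> _ [x /=+ <-]; rewrite rnorm_le1; exact: Tc.
Qed.

Lemma hahn_banach_dual (W : lmodType K) (X : normedModType K) (j : W -> X) (g : W -> K)
  (c : R) :
  0 <= c -> linear j -> (forall a u v, g (a *: u + v) = a * g u + g v) ->
  (forall w, re `|g w| <= c * rnorm (j w)) ->
  exists2 f : dual X, rnorm f <= c & forall w, f (j w) = g w.
Proof.
move=> c0 jl gl gc.
have pD u v : c * rnorm (u + v : X) <= c * rnorm u + c * rnorm v.
  by rewrite -mulrDr ler_wpM2l ?rnormD.
have pZ a v : c * rnorm (a *: v : X) <= re `|a| * (c * rnorm v).
  by rewrite rnormZ mulrCA.
have [G [Gl Gc] Gj] := hahn_banach pD pZ jl gl gc.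
have [f fE fc] := @operator_exists X (scalar_space R k) G c Gl c0 Gc.
by exists f => // w; rewrite fE.
Qed.

Lemma norming_functional (X : normedModType K) (x : X) :
  exists2 f : dual X, rnorm f <= 1 & f x = emb (rnorm x).
Proof.
have [|||f f1 fx] := @hahn_banach_dual K^o X (fun a => a *: x) (fun a => a * emb (rnorm
  x)) 1 ler01.
- by move=> a u v /=; rewrite scalerDl scalerA.
- by move=> a u v; rewrite mulrDl -[a *: u]/(a * u) mulrA.
- by move=> a; rewrite mul1r rnormZ re_normM re_norm_emb (ger0_norm (rnorm_ge0 x)).
by exists f => //; have := fx 1; rewrite scale1r mul1r.
Qed.

Lemma functional_separates (X : normedModType K) (x : X) :
  (forall f : dual X, f x = 0) -> x = 0.
Proof.
have [f _ fx] := norming_functional x.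
move=> /(_ f); rewrite fx => h; apply: rnorm0_eq0.
by rewrite -(@embK R k (rnorm x)) h -(@emb0 R k) embK.
Qed.

Lemma rnorm_le_dual (X : normedModType K) (x : X) (c : R) :
  (forall f : dual X, rnorm f <= 1 -> rnorm (f x) <= c) -> rnorm x <= c.
Proof.
have [f f1 fx] := norming_functional x.
move=> /(_ f f1); rewrite fx rnorm_scalar re_norm_emb ger0_norm//.
exact: rnorm_ge0.
Qed.

End Functionals.

(** * Biorthogonal systems for an abstract pairing *)

Section Biorthogonal.
Variables (R : realType) (k : scalar_kind).
Local Notation K := (scalars R k).
Variables (V F : lmodType K) (b : V -> F -> K).
Hypothesis bDl : forall a u v f, b (a *: u + v) f = a * b u f + b v f.
Hypothesis bDr : forall v a f g, b v (a *: f + g) = a * b v f + b v g.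
Hypothesis bsep : forall v, (forall f, b v f = 0) -> v = 0.

Let b0l f : b 0 f = 0.
Proof. by apply: (addrI (b 0 f)); have := bDl 1 0 0 f; rewrite scale1r mul1r !addr0. Qed.
Let b0r v : b v 0 = 0.
Proof. by apply: (addrI (b v 0)); have := bDr v 1 0 0; rewrite scale1r mul1r !addr0. Qed.
Let bZl a v f : b (a *: v) f = a * b v f.
Proof. by have := bDl a v 0 f; rewrite b0l !addr0. Qed.
Let bZr a v f : b v (a *: f) = a * b v f.
Proof. by have := bDr v a f 0; rewrite b0r !addr0. Qed.
Let bBl u v f : b (u - v) f = b u f - b v f.
Proof. by rewrite -scaleN1r addrC bDl mulN1r addrC. Qed.
Let bBr v f g : b v (f - g) = b v f - b v g.
Proof. by rewrite -scaleN1r addrC bDr mulN1r addrC. Qed.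
Let bsuml (I : Type) (s : seq I) (u : I -> V) f :
  b (\sum_(i <- s) u i) f = \sum_(i <- s) b (u i) f.
Proof.
elim: s => [|i s ih]; first by rewrite !big_nil b0l.
by rewrite !big_cons -[u i]scale1r bDl mul1r ih scale1r.
Qed.
Let bsumr (I : Type) (s : seq I) v (g : I -> F) :
  b v (\sum_(i <- s) g i) = \sum_(i <- s) b v (g i).
Proof.
elim: s => [|i s ih]; first by rewrite !big_nil b0r.
by rewrite !big_cons -[g i]scale1r bDr mul1r ih scale1r.
Qed.

(** Induction on the spanning list, in the manner of Gram-Schmidt: what the system leaves over of a
    new vector is zero, or is detected by some [g], which is then corrected to vanish on the earlier
    vectors. The pairing is abstract because it serves both vectors tested by functionals and
    functionals tested by vectors. *)
Lemma biorthogonal_system (S : set V) : finite_dimensional S ->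
  exists n (y : 'I_n -> V) (f : 'I_n -> F),
    (forall i j, b (y i) (f j) = (i == j)%:R) /\
    (forall v, S v -> v = \sum_i b v (f i) *: y i).
Proof.
move=> [m [e eS]].
suff [n [y [f [yf ye]]]] : exists n (y : 'I_n -> V) (f : 'I_n -> F),
    (forall i j, b (y i) (f j) = (i == j)%:R) /\
    (forall i, e i = \sum_j b (e i) (f j) *: y j).
  exists n, y, f; split=> // v /eS[c ->].
  under [RHS]eq_bigr do rewrite bsuml scaler_suml.
  rewrite exchange_big /=; apply: eq_bigr => i _.
  rewrite [in LHS](ye i) scaler_sumr; apply: eq_bigr => j _.
  by rewrite bZl scalerA.
elim: m e {eS} => [|m ih] e.
  by exists 0%N, (fun=> 0), (fun=> 0); split=> [[]|[]].
have [n [y [f [yf ye]]]] := ih (fun i => e (lift ord0 i)).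
pose r := e ord0 - \sum_j b (e ord0) (f j) *: y j.
have rf i : b r (f i) = 0.
  rewrite bBl bsuml (bigD1 i)//= bZl yf eqxx mulr1 big1 ?addr0 ?subrr// => j ji.
  by rewrite bZl yf (negbTE ji) mulr0.
have [r0|r0] := eqVneq r 0.
  exists n, y, f; split=> // i; have [j ->|->] := unliftP ord0 i; first exact: ye.
  by apply/eqP; rewrite -subr_eq0; apply/eqP.
have [g rg] : exists g, b r g != 0.
  apply: contrapT => h; move/eqP: r0; apply; apply: bsep => g.
  by apply: contrapT => /eqP h2; apply: h; exists g.
pose g' := (b r g)^-1 *: (g - \sum_j b (y j) g *: f j).
have yg' i : b (y i) g' = 0.
  rewrite bZr bBr bsumr (bigD1 i)//= bZr yf eqxx mulr1 big1 ?addr0 ?subrr ?mulr0// => j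
    ji.
  by rewrite bZr yf eq_sym (negbTE ji) mulr0.
have rg' : b r g' = 1.
  rewrite bZr bBr bsumr big1 ?subr0 ?mulVf// => j _.
  by rewrite bZr rf mulr0.
exists n.+1, (fun i => oapp y r (unlift ord0 i)), (fun i => oapp f g' (unlift ord0 i)).
split.
  move=> i j; have [i' ->|->] := unliftP ord0 i; have [j' ->|->] := unliftP ord0 j;
    rewrite ?unlift_none ?liftK //= ?(inj_eq lift_inj) ?yf ?yg' ?rf ?rg' //.
move=> i; rewrite big_ord_recl !unlift_none /=.
under eq_bigr do rewrite liftK /=.
have [j ->|->] := unliftP ord0 i; last first.
  have -> : b (e ord0) g' = 1.
    by rewrite -rg' bBl bsuml [X in _ - X]big1 ?subr0// => j _; rewrite bZl yg' mulr0.
  by rewrite scale1r subrK.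
have -> : b (e (lift ord0 j)) g' = 0.
  by rewrite (ye j) bsuml big1// => l _; rewrite bZl yg' mulr0.
by rewrite scale0r add0r; exact: ye.
Qed.

End Biorthogonal.

(** * Finite nets and precompactness *)

Section TotallyBounded.
Variables (R : realType) (k : scalar_kind).
Local Notation K := (scalars R k).

Lemma closure_rnormP (V : normedModType K) (A : set V) v :
  closure A v <-> forall e : R, 0 < e -> exists2 a, A a & rnorm (v - a) <= e.
Proof.
split=> [Av e e0|h B].
  have /Av[a [Aa]] : nbhs v [set w | rnorm (v - w) <= e].
    apply/nbhs_ballP; exists (emb e); first by rewrite /= -(@emb0 R k) emb_lt.
    move=> w; rewrite -ball_normE /= => /ltW.
    by rewrite rnormE emb_le.
  by exists a.
move=> /nbhs_ballP[e /= e0 Be].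
have eE : emb (re e) = e by rewrite reK_ge0 ?ltW.
have re0 : 0 < re e by rewrite -(@emb_lt R k) emb0 eE.
have [|a Aa va] := h (re e / 2); first by rewrite divr_gt0.
exists a; split=> //; apply: Be; rewrite -ball_normE /= rnormE -eE emb_lt.
by rewrite (le_lt_trans va)// ltr_pdivrMr// ltr_pMr// ltr1n.
Qed.

Definition totally_bounded (V : normedModType K) (I : Type) (f : I -> V) :=
  forall e : R, 0 < e -> exists n (s : 'I_n -> V), forall i, exists j, rnorm (f i - s
    j) <= e.

(** Moves a net into the family itself, by keeping one member for every centre that is hit. *)
Lemma choose_net (I : Type) (n : nat) (P : I -> 'I_n -> Prop) :
  (forall i, exists j, P i j) ->
  exists m (s : 'I_m -> I), forall i, exists l j, P i j /\ P (s l) j.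
Proof.
move=> Pt; have [[i0]|I0] := pselect (exists i : I, True); last first.
  have s0 : 'I_0 -> I by case.
  by exists 0%N, s0 => i; case: I0; exists i.
have /choice[s Ps] : forall j : 'I_n, exists x, (exists i, P i j) -> P x j.
  move=> j; have [[i Pij]|h] := pselect (exists i, P i j); first by exists i.
  by exists i0 => /h.
exists n, s => i; have [j Pij] := Pt i; exists j, j; split=> //.
by apply: Ps; exists i.
Qed.

Lemma totally_bounded_net (V : normedModType K) (I : Type) (f : I -> V) :
  totally_bounded f -> forall e : R, 0 < e ->
  exists n (s : 'I_n -> I), forall i, exists j, rnorm (f i - f (s j)) <= e.
Proof.
move=> ft e e0; have [|n [s fs]] := ft (e / 2); first by rewrite divr_gt0.
have [m [t ft']] := choose_net fs; exists m, t => i.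
have [l [j [ij lj]]] := ft' i; exists l.
rewrite -(subrK (s j) (f i)) -addrA (le_trans (rnormD _ _))//.
by rewrite [leRHS]splitr lerD// rnormB.
Qed.

Lemma bounded_scalars_net (I : Type) n (h : 'I_n -> I -> K) (M : R) :
  (forall j i, re `|h j i| <= M) -> forall e : R, 0 < e ->
  exists m (s : 'I_m -> I), forall i, exists l, forall j, re `|h j i - h j (s l)| <= e.
Proof.
move=> hM e e0.
(* It is enough to colour the points with finitely many colours so that equal colours mean close
   values; [choose_net] then keeps one point per colour. *)
suff [C [c cP]] : exists (C : finType) (c : I -> C), forall i i', c i = c i' ->
    forall j, re `|h j i - h j i'| <= e.
  have [|m [s cs]] := @choose_net I #|C| (fun i j => c i = enum_val j).
    by move=> i; exists (enum_rank (c i)); rewrite enum_rankK.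
  exists m, s => i; have [l [j [ij lj]]] := cs i.
  by exists l; apply: cP; rewrite ij lj.
have real_case (d : R) (g : 'I_n -> I -> R) : 0 < d -> (forall j i, `|g j i| <= M) ->
    exists (C : finType) (c : I -> C), forall i i', c i = c i' ->
    forall j, `|g j i - g j i'| <= d.
  move=> d0 gM.
  (* The interval [-M, M] is cut into cells of width [d], and a point is coloured by the cells of
     its values. *)
  pose N := (Num.truncn ((M + M) / d)).
  exists {ffun 'I_n -> 'I_N.+1}, (fun i => [ffun j => inord (Num.truncn ((g j i + M) /
    d))]).
  have bnd j i : 0 <= (g j i + M) / d <= (M + M) / d.
    have := gM j i; rewrite ler_norml => /andP[g1 g2].
    by rewrite divr_ge0 ?(ltW d0)//= ?ler_wpM2r ?invr_ge0 ?(ltW d0)// ?lerD2r//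
      -lerBlDr sub0r.
  have tr j i : (Num.truncn ((g j i + M) / d) < N.+1)%N.
    by rewrite ltnS /N; apply: le_truncn; have /andP[] := bnd j i.
  move=> i i' /ffunP ii' j; have := ii' j; rewrite !ffunE => /(congr1 val).
  rewrite /= !inordK// => tE.
  have /andP[b1 _] := bnd j i; have /andP[b2 _] := bnd j i'.
  have /andP[t1 t2] := truncn_itv b1; have /andP[t3 t4] := truncn_itv b2.
  rewrite tE in t1 t2.
  rewrite -(@ler_pM2r _ d^-1) ?invr_gt0// divff ?gt_eqF//.
  rewrite -(@gtr0_norm _ d^-1) ?invr_gt0// -normrM ler_norml.
  rewrite mulrBl; rewrite !mulrDl in t1 t2 t3 t4.
  move: t1 t2 t3 t4; rewrite -natr1; set a := g j i / d; set b := g j i' / d.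
  by move=> *; apply/andP; split; lra.
move: h hM; rewrite /re; case: k => /= h hM; first exact: real_case hM.
have e2 : 0 < e / 2 by rewrite divr_gt0.
have norm_le (z : R[i]) : complex.Re `|z| <= `|complex.Re z| + `|complex.Im z|.
  case: z => x y; rewrite normc_def /= -(@ler_pXn2r _ 2) ?nnegrE ?sqrtr_ge0 ?addr_ge0//.
  rewrite sqr_sqrtr ?addr_ge0 ?sqr_ge0// sqrrD !real_normK ?num_real//.
  by rewrite -addrA lerD2l lerDr mulrn_wge0// mulr_ge0.
have reM j i : `|complex.Re (h j i)| <= M.
  apply: le_trans (hM j i); have := normc_ge_Re (h j i).
  by rewrite lecE => /andP[_].
have im_le (z : R[i]) : `|complex.Im z| <= complex.Re `|z|.
  case: z => x y; rewrite normc_def /= -(@ler_pXn2r _ 2) ?nnegrE ?sqrtr_ge0//.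
  by rewrite sqr_sqrtr ?addr_ge0 ?sqr_ge0// real_normK ?num_real// lerDr sqr_ge0.
have imM j i : `|complex.Im (h j i)| <= M by apply: le_trans (hM j i); exact: im_le.
have [C [c cP]] := real_case _ (fun j i => complex.Re (h j i)) e2 reM.
have [D [d dP]] := real_case _ (fun j i => complex.Im (h j i)) e2 imM.
exists (C * D)%type, (fun i => (c i, d i)) => i i' [ci di] j.
rewrite (le_trans (norm_le _))// [leRHS]splitr.
move: (cP _ _ ci j) (dP _ _ di j); case: (h j i) => x y; case: (h j i') => x' y' /=.
exact: lerD.
Qed.

(** For every radius, an ultrafilter containing the closure has one of the finitely many balls
    around the net points as a member; it is therefore Cauchy. *)
Lemma totally_bounded_precompact (V : Banach R k) (I : Type) (f : I -> V) :
  totally_bounded f -> precompact (range f).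
Proof.
move=> ft; rewrite precompactE compact_ultra => F UF FA.
have Fc : cauchy F.
  apply/rnorm_cauchyP => e e0.
  have [|n [s fs]] := ft (e / 2); first by rewrite divr_gt0.
  have [[j Fj]|nFs] := pselect (exists j, F [set w | rnorm (s j - w) <= e]);
    first by exists (s j).
  have FI : F [set w | forall j, ~ rnorm (s j - w) <= e].
    apply: filter_forall => j.
    by have [h|//] := in_ultra_setVsetC [set w | rnorm (s j - w) <= e] UF; case: nFs;
      exists j.
  have [v [/closure_rnormP Av nv]] := filter_ex (filterI FA FI).
  have [|_ [i _ <-] vi] := Av (e / 2); first by rewrite divr_gt0.
  have [j ij] := fs i; case: (nv j).
  rewrite rnormB -(subrK (f i) v) -addrA (le_trans (rnormD _ _))//.
  by rewrite [leRHS]splitr lerD.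
have /cvg_ex[l Fl] : cvg F by exact: cauchy_cvg.
exists l; split=> //; apply: (closed_cvg _ (@closed_closure _ (range f)) _ _ Fl).
exact: FA.
Qed.

Lemma precompact_totally_bounded (V : normedModType K) (I : Type) (f : I -> V) :
  precompact (range f) -> totally_bounded f.
Proof.
rewrite precompactE compact_cover => h e e0.
have e0' : 0 < emb (k := k) e by rewrite -(@emb0 R k) emb_lt.
have [||D _ DA] := h V setT (fun v => ball v (emb e)).
- by move=> v _; exact: ball_open.
- by move=> v _; exists v => //; apply: ballxx.
exists #|` D|, (fun j => nth 0 D j) => i.
have [|v Dv] := DA (f i); first by apply: subset_closure; exists i.
rewrite -ball_normE /= => vi.
have vD : (index v D < #|` D|)%N by rewrite index_mem.
exists (Ordinal vD); rewrite /= nth_index// rnormB.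
by rewrite -(@emb_le R k) -rnormE ltW.
Qed.

Lemma compact_totally_bounded (V : normedModType K) (C : set V) :
  compact C -> totally_bounded (fun x : C => val x).
Proof.
move=> Cc; apply: precompact_totally_bounded.
rewrite (_ : range _ = C); first exact: compact_precompact (@norm_hausdorff _ V) Cc.
apply/seteqP; split=> [_ [x _ <-]|x Cx]; first exact: set_mem (valP x).
by exists (SigSub (mem_set Cx)).
Qed.

Lemma compact_opP (X Y : Banach R k) (T : operator X Y) :
  compact_op X Y T <-> totally_bounded (fun x : unit_ball X => T (val x)).
Proof.
have TE : T @` [set x | `|x| <= 1] = range (fun x : unit_ball X => T (val x)).
  apply/seteqP; split=> [_ [x x1 <-]|_ [x _ <-]]; first by exists (exist _ x x1).
  by exists (val x) => //; exact: valP x.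
rewrite /compact_op /= TE; split; first exact: precompact_totally_bounded.
exact: totally_bounded_precompact.
Qed.

End TotallyBounded.

(** * Finite rank, approximable and compact operators, and their adjoints *)

Section FiniteRank.
Variables (R : realType) (k : scalar_kind).
Local Notation K := (scalars R k).
Local Notation dual X := (operator X (scalar_space R k)).
Implicit Types X Y Z : Banach R k.

Lemma opDE (X Y : normedModType K) (S T : operator X Y) x : (S + T) x = S x + T x.
Proof. by []. Qed.
Lemma opNE (X Y : normedModType K) (T : operator X Y) x : (- T) x = - T x.
Proof. by []. Qed.
Lemma opBE (X Y : normedModType K) (S T : operator X Y) x : (S - T) x = S x - T x.
Proof. by []. Qed.
Lemma opZE (X Y : normedModType K) (a : K) (T : operator X Y) x : (a *: T) x = a *: T x.
Proof. by []. Qed.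
Lemma op_sumE (X Y : normedModType K) (I : Type) (s : seq I) (P : pred I)
    (T : I -> operator X Y) x : (\sum_(i <- s | P i) T i) x = \sum_(i <- s | P i) T i x.
Proof. by elim/big_rec2 : _ => // i y S _ <-. Qed.

Lemma opvD (X Y : normedModType K) (T : operator X Y) x y : T (x + y) = T x + T y.
Proof. exact: raddfD. Qed.
Lemma opvB (X Y : normedModType K) (T : operator X Y) x y : T (x - y) = T x - T y.
Proof. exact: raddfB. Qed.
Lemma opvZ (X Y : normedModType K) (T : operator X Y) a x : T (a *: x) = a *: T x.
Proof. exact: linearZ. Qed.
Lemma opv0 (X Y : normedModType K) (T : operator X Y) : T 0 = 0.
Proof. exact: raddf0. Qed.
Lemma opv_sum (X Y : normedModType K) (T : operator X Y) (I : Type) (s : seq I) (P :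
  pred I)
    (x : I -> X) : T (\sum_(i <- s | P i) x i) = \sum_(i <- s | P i) T (x i).
Proof. exact: raddf_sum. Qed.
Lemma scalarZ (a : K) (x : scalar_space R k) : a *: x = a * (x : K).
Proof. by []. Qed.

Lemma comp_opBl X Y Z (U U' : operator Z Y) (V : operator X Z) :
  comp_op (U - U') V = comp_op U V - comp_op U' V.
Proof. exact: operatorP. Qed.
Lemma comp_opBr X Y Z (U : operator Z Y) (V V' : operator X Z) :
  comp_op U (V - V') = comp_op U V - comp_op U V'.
Proof. by apply: operatorP => x; rewrite /= raddfB. Qed.
Lemma comp_opA X Y Z (W : Banach R k) (T : operator Z W) (U : operator Y Z) (V :
  operator X Y) :
  comp_op T (comp_op U V) = comp_op (comp_op T U) V.
Proof. exact: operatorP. Qed.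

Lemma rank1_subproof X Y (g : dual X) (y : Y) :
  (fun x => (g x : K) *: y) \in @bounded_linear R k X Y.
Proof.
apply/bounded_linearP; split=> [a u v|].
  by rewrite linearP scalerDl -scalerA.
exists (rnorm g * rnorm y) => x; rewrite rnormZ mulrAC ler_wpM2r ?rnorm_ge0//.
exact: rnorm_apply.
Qed.

Definition rank1 X Y (g : dual X) (y : Y) : operator X Y := Operator (rank1_subproof g y).

Lemma rank1_norm X Y (g : dual X) (y : Y) : rnorm (rank1 g y) <= rnorm g * rnorm y.
Proof.
apply: rnorm_le_op => [|x]; first by rewrite mulr_ge0 ?rnorm_ge0.
by rewrite rnormZ mulrAC ler_wpM2r ?rnorm_ge0//; exact: rnorm_apply.
Qed.

(** Biorthogonal functionals make the coordinates of [T x] bounded functionals of [x], whereas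
    [finite_rank] only offers a spanning family. *)
Lemma finite_rank_rep X Y (T : operator X Y) : finite_rank X Y T ->
  exists n (y : 'I_n -> Y) (f : 'I_n -> dual Y),
    (forall i j, f j (y i) = (i == j)%:R) /\
    T = \sum_i rank1 (comp_op (f i) T) (y i).
Proof.
move=> /(@biorthogonal_system R k Y (dual Y) (fun y f => f y)) [].
- by move=> a u v f; rewrite linearP.
- by [].
- exact: functional_separates.
move=> n [y [f [yf TE]]]; exists n, y, f; split=> //.
by apply: operatorP => x; rewrite op_sumE [LHS](TE (T x))//; exists x.
Qed.

Lemma finite_rank_sum X Y n (g : 'I_n -> dual X) (y : 'I_n -> Y) :
  finite_rank X Y (\sum_i rank1 (g i) (y i)).
Proof.
exists n, y => _ [x _ <-]; exists (fun i => g i x); rewrite op_sumE.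
by apply: eq_bigr.
Qed.

Lemma finite_rank_eq X Y n (T : operator X Y) (g : 'I_n -> dual X) (y : 'I_n -> Y) :
  (forall x, T x = \sum_i (g i x : K) *: y i) -> finite_rank X Y T.
Proof.
move=> TE; rewrite (_ : T = \sum_i rank1 (g i) (y i)); first exact: finite_rank_sum.
by apply: operatorP => x; rewrite op_sumE TE.
Qed.

Lemma finite_rank0 X Y : finite_rank X Y 0.
Proof.
have g : 'I_0 -> dual X by case.
have y : 'I_0 -> Y by case.
by apply: (@finite_rank_eq _ _ 0 _ g y) => x; rewrite big_ord0.
Qed.

Lemma finite_rankD X Y (S T : operator X Y) :
  finite_rank X Y S -> finite_rank X Y T -> finite_rank X Y (S + T).
Proof.
move=> [m [e eS]] [n [f fT]].
exists (m + n)%N, (fun i : 'I_(m + n) => match fintype.split i with inl i => e i | inr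
  j => f j end).
move=> _ [x _ <-]; have [|c cE] := eS (S x); first by exists x.
have [|d dE] := fT (T x); first by exists x.
exists (fun i : 'I_(m + n) => match fintype.split i with inl i => c i | inr j => d j end).
rewrite opDE cE dE big_split_ord /=; congr (_ + _); apply: eq_bigr => i _.
  by rewrite (unsplitK (inl i)).
by rewrite (unsplitK (inr i)).
Qed.

Lemma finite_rankN X Y (T : operator X Y) : finite_rank X Y T -> finite_rank X Y (- T).
Proof.
move=> [m [e eT]]; exists m, e => _ [x _ <-].
have [|c cE] := eT (T x); first by exists x.
exists (fun i => - c i); rewrite opNE cE -sumrN.
by apply: eq_bigr => i _; rewrite scaleNr.
Qed.

Lemma finite_rankZ X Y a (T : operator X Y) : finite_rank X Y T -> finite_rank X Y (a
  *: T).
Proof.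
move=> [m [e eT]]; exists m, e => _ [x _ <-].
have [|c cE] := eT (T x); first by exists x.
exists (fun i => a * c i); rewrite opZE cE scaler_sumr.
by apply: eq_bigr => i _; rewrite scalerA.
Qed.

Lemma finite_rank_comp (X0 X Y Y0 : Banach R k) (U : operator Y Y0) (T : operator X Y)
  (V : operator X0 X) :
  finite_rank X Y T -> finite_rank X0 Y0 (comp_op U (comp_op T V)).
Proof.
move=> [n [e eT]]; exists n, (fun i => U (e i)) => _ [x _ <-] /=.
have [|c ->] := eT (T (V x)); first by exists (V x).
by exists c; rewrite raddf_sum /=; apply: eq_bigr => i _; rewrite linearZ.
Qed.

Lemma finite_rank_compl X Y Z (U : operator Z Y) (T : operator X Z) :
  finite_rank X Z T -> finite_rank X Y (comp_op U T).
Proof.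
move=> Tf; rewrite (_ : comp_op U T = comp_op U (comp_op T (id_op _)));
  last exact: operatorP.
exact: finite_rank_comp.
Qed.

Lemma finite_rank_compr X Y Z (T : operator Z Y) (V : operator X Z) :
  finite_rank Z Y T -> finite_rank X Y (comp_op T V).
Proof.
move=> Tf; rewrite (_ : comp_op T V = comp_op (id_op _) (comp_op T V));
  last exact: operatorP.
exact: finite_rank_comp.
Qed.

Lemma adjoint_rank1 X Y n (g : 'I_n -> dual X) (y : 'I_n -> Y) (phi : dual Y) :
  adjoint (\sum_i rank1 (g i) (y i)) phi = \sum_i (phi (y i) : K) *: g i.
Proof.
apply: operatorP => x; rewrite op_sumE /= op_sumE raddf_sum /=.
by apply: eq_bigr => i _; rewrite linearZ; exact: mulrC.
Qed.

Lemma eval_at_subproof X (x : X) :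
  (fun phi : dual X => phi x) \in @bounded_linear R k (dual X) (scalar_space R k).
Proof.
by apply/bounded_linearP; split=> //; exists (rnorm x) => phi; rewrite mulrC rnorm_apply.
Qed.

Definition eval_at X (x : X) : dual (dual X) := Operator (eval_at_subproof x).

Lemma eval_op_subproof X : @eval_at X \in @bounded_linear R k X (dual (dual X)).
Proof.
apply/bounded_linearP; split=> [a u v|].
  by apply: operatorP => phi; rewrite /= linearP.
exists 1 => x; rewrite mul1r; apply: rnorm_le_op => [|phi /=]; rewrite ?rnorm_ge0//.
by rewrite mulrC rnorm_apply.
Qed.

Definition eval_op X : operator X (dual (dual X)) := Operator (@eval_op_subproof X).

Lemma eval_opE X (x : X) (phi : dual X) : eval_op X x phi = phi x.
Proof. by []. Qed.

Lemma rnorm_eval X (x : X) : rnorm (eval_op X x) = rnorm x.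
Proof.
apply/eqP; rewrite eq_le; apply/andP; split.
  apply: rnorm_le_op => [|phi]; first exact: rnorm_ge0.
  by rewrite eval_opE mulrC rnorm_apply.
apply: rnorm_le_dual => f f1; rewrite -eval_opE.
by rewrite (le_trans (rnorm_apply_ball _ f1)).
Qed.

Lemma finite_rank_adjoint X Y (T : operator X Y) :
  finite_rank X Y T -> finite_rank (dual Y) (dual X) (adjoint T).
Proof.
move=> /finite_rank_rep [n [y [f [_ TE]]]].
apply: (@finite_rank_eq _ _ n _ (fun i => eval_op Y (y i)) (fun i => comp_op (f i) T))
  => phi.
by rewrite {1}TE adjoint_rank1.
Qed.

Lemma rnorm_adjoint X Y (T : operator X Y) : rnorm (adjoint T) <= rnorm T.
Proof.
apply: rnorm_le_op => [|phi]; first exact: rnorm_ge0.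
by rewrite mulrC; exact: rnorm_comp.
Qed.

Lemma adjointB X Y (S T : operator X Y) : adjoint (S - T) = adjoint S - adjoint T.
Proof. by apply: operatorP => phi; apply: operatorP => x; rewrite /= raddfB. Qed.
Lemma adjointD X Y (S T : operator X Y) : adjoint (S + T) = adjoint S + adjoint T.
Proof. by apply: operatorP => phi; apply: operatorP => x; rewrite /= raddfD. Qed.
Lemma adjoint_comp X Y Z (U : operator Z Y) (V : operator X Z) :
  adjoint (comp_op U V) = comp_op (adjoint V) (adjoint U).
Proof. by apply: operatorP => phi; exact: operatorP. Qed.

Lemma approximableP X Y (T : operator X Y) :
  approximable X Y T <-> forall e : R, 0 < e -> exists2 F, finite_rank X Y F & rnorm (T
    - F) <= e.
Proof. exact: closure_rnormP. Qed.

Lemma approximable_comp (X0 X Y Y0 : Banach R k) (U : operator Y Y0) (T : operator X Y)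
  (V : operator X0 X) :
  approximable X Y T -> approximable X0 Y0 (comp_op U (comp_op T V)).
Proof.
move=> /approximableP Ta; apply/approximableP => e e0.
have c0 : 0 < (rnorm U + 1) * (rnorm V + 1) by rewrite mulr_gt0 ?ltr_wpDl ?rnorm_ge0.
have [|F Ff TF] := Ta (e / ((rnorm U + 1) * (rnorm V + 1))); first by rewrite divr_gt0.
exists (comp_op U (comp_op F V)); first exact: finite_rank_comp.
rewrite -comp_opBr -comp_opBl (le_trans (rnorm_comp _ _))//.
rewrite (le_trans (ler_wpM2l (rnorm_ge0 _) (rnorm_comp _ _)))// mulrCA.
rewrite (@le_trans _ _ (rnorm (T - F) * ((rnorm U + 1) * (rnorm V + 1))))//.
  by rewrite ler_wpM2l ?rnorm_ge0// ler_pM ?rnorm_ge0// lerDl.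
by rewrite -ler_pdivlMr.
Qed.

Lemma approximable_compl X Y Z (U : operator Z Y) (T : operator X Z) :
  approximable X Z T -> approximable X Y (comp_op U T).
Proof.
move=> Tf; rewrite (_ : comp_op U T = comp_op U (comp_op T (id_op _)));
  last exact: operatorP.
exact: approximable_comp.
Qed.

Lemma approximable_compr X Y Z (T : operator Z Y) (V : operator X Z) :
  approximable Z Y T -> approximable X Y (comp_op T V).
Proof.
move=> Tf; rewrite (_ : comp_op T V = comp_op (id_op _) (comp_op T V));
  last exact: operatorP.
exact: approximable_comp.
Qed.

Lemma approximable_adjoint X Y (T : operator X Y) :
  approximable X Y T -> approximable (dual Y) (dual X) (adjoint T).
Proof.
move=> /approximableP Ta; apply/approximableP => e /Ta[F Ff TF].
exists (adjoint F); first exact: finite_rank_adjoint.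
by rewrite -adjointB (le_trans (rnorm_adjoint _)).
Qed.

Lemma approximable_compact X Y (T : operator X Y) :
  approximable X Y T -> compact_op X Y T.
Proof.
move=> /approximableP Ta; apply/compact_opP => e e0.
have e2 : 0 < e / 2 by rewrite divr_gt0.
have [F /finite_rank_rep [n [y [f [_ FE]]]] TF] := Ta _ e2.
pose M := \sum_i rnorm (comp_op (f i) F).
have hM i (x : unit_ball X) : re `|comp_op (f i) F (val x) : K| <= M.
  apply: (@le_trans _ _ (rnorm (comp_op (f i) F))).
    by apply: rnorm_apply_ball; rewrite -rnorm_le1; exact: valP x.
  by rewrite /M (bigD1 i)//= lerDl sumr_ge0// => j _; rewrite rnorm_ge0.
(* [F x] is governed by finitely many bounded scalars; an error in each of them is multiplied by at
   most [S], where the added 1 keeps the division meaningful. *)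
pose S := \sum_i rnorm (y i) + 1.
have S0 : 0 < S by rewrite ltr_wpDl// sumr_ge0// => j _; rewrite rnorm_ge0.
have [|m [s sP]] := bounded_scalars_net hM (e := e / 2 / S); first by rewrite divr_gt0.
exists m, (fun l => F (val (s l))) => x; have [l lP] := sP x; exists l.
rewrite -(subrK (F (val x)) (T (val x))) -addrA (le_trans (rnormD _ _))// [leRHS]splitr
  lerD//.
  rewrite -opBE (le_trans _ TF)//.
  by apply: rnorm_apply_ball; rewrite -rnorm_le1; exact: valP x.
have -> : F (val x) - F (val (s l)) =
    \sum_i (comp_op (f i) F (val x) - comp_op (f i) F (val (s l)) : K) *: y i.
  rewrite {1 2}FE !op_sumE -sumrB; apply: eq_bigr => i _.
  by rewrite scalerBl.
rewrite (le_trans (rnorm_sum _ _))//.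
rewrite (@le_trans _ _ (\sum_i e / 2 / S * rnorm (y i)))//.
  by apply: ler_sum => i _; rewrite rnormZ ler_wpM2r ?rnorm_ge0.
rewrite -mulr_sumr mulrAC ler_pdivrMr// ler_wpM2l ?(ltW e2)//.
by rewrite lerDl.
Qed.

Lemma compact_comp (X0 X Y Y0 : Banach R k) (U : operator Y Y0) (T : operator X Y) (V :
  operator X0 X) :
  compact_op X Y T -> rnorm V <= 1 -> compact_op X0 Y0 (comp_op U (comp_op T V)).
Proof.
move=> /compact_opP Tc V1; apply/compact_opP => e e0.
have U1 : 0 < rnorm U + 1 by rewrite ltr_wpDl ?rnorm_ge0.
have [|n [s Ts]] := Tc (e / (rnorm U + 1)); first by rewrite divr_gt0.
exists n, (fun j => U (s j)) => x.
have Vx1 : `|V (val x)| <= 1.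
  rewrite rnorm_le1 (le_trans _ V1)//.
  by apply: rnorm_apply_ball; rewrite -rnorm_le1; exact: valP x.
have [j js] := Ts (exist _ (V (val x)) Vx1); exists j.
rewrite /= -raddfB (le_trans (rnorm_apply _ _))//.
rewrite (le_trans (ler_wpM2l (rnorm_ge0 _) js))//.
by rewrite mulrCA -[leRHS]mulr1 ler_wpM2l ?(ltW e0)// ler_pdivrMr// mul1r lerDl.
Qed.

End FiniteRank.
Arguments eval_op {R k} X.

(** * Schauder's theorem, Helly's theorem and biduals of compact operators *)

Section Duality.
Variables (R : realType) (k : scalar_kind).
Local Notation K := (scalars R k).
Local Notation dual X := (operator X (scalar_space R k)).
Implicit Types X Y Z : Banach R k.

Lemma cauchy_seq_limit (V : Banach R k) (u : nat -> V) :
  (forall e : R, 0 < e -> exists N, forall n, (N <= n)%N -> rnorm (u N - u n) <= e) ->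
  exists l, forall e : R, 0 < e -> exists N, forall n, (N <= n)%N -> rnorm (l - u n) <= e.
Proof.
move=> uc.
have /cvg_ex[l /cvg_rnormP ul] : cvg (u @ \oo).
  apply: cauchy_cvg; apply/rnorm_cauchyP => e /uc[N uN].
  by exists (u N); exists N => // n /= Nn; exact: uN.
exists l => e /ul[N _ lN]; exists N => n Nn.
by apply: ltW; exact: lN.
Qed.

Lemma isometry_range_closed X (Y : normedModType K) (T : operator X Y) :
  (forall x, rnorm (T x) = rnorm x) -> closed (range T).
Proof.
move=> Ti v /closure_rnormP vT.
have /choice[x xv] : forall n : nat, exists x, rnorm (v - T x) <= n.+1%:R^-1.
  move=> n; have [|_ [x _ <-] vx] := vT n.+1%:R^-1; first by rewrite invr_gt0.
  by exists x.
have small (e : R) : 0 < e -> exists N, forall n, (N <= n)%N -> n.+1%:R^-1 <= e.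
  move=> e0; exists (Num.truncn e^-1) => n Nn.
  rewrite -[leRHS]invrK lef_pV2 ?posrE ?invr_gt0//.
  have := truncn_itv (ltW (_ : 0 < e^-1)); rewrite invr_gt0 => /(_ e0)/andP[_ /ltW h].
  by rewrite (le_trans h)// ler_nat.
have [e e0|l lx] := @cauchy_seq_limit X x.
  have [|N NP] := small (e / 2); first by rewrite divr_gt0.
  exists N => n Nn; rewrite -Ti opvB /=.
  rewrite -(subrK v (T (x N))) -addrA (le_trans (rnormD _ _))// [leRHS]splitr lerD//.
    by rewrite rnormB (le_trans (xv N))// NP.
  by rewrite (le_trans (xv n))// NP.
exists l => //; apply/eqP; rewrite eq_sym -subr_eq0; apply/eqP/rnorm0_eq0/eqP.
rewrite eq_le rnorm_ge0 andbT; apply/ler_addgt0Pl => e e0; rewrite addr0.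
have [|N NP] := small (e / 2); first by rewrite divr_gt0.
have [|M MP] := lx (e / 2); first by rewrite divr_gt0.
have vx := le_trans (xv (maxn N M)) (NP _ (leq_maxl _ _)).
have := MP _ (leq_maxr N M); rewrite rnormB -Ti opvB /= => xl.
by rewrite -(subrK (T (x (maxn N M))) v) -addrA (le_trans (rnormD _ _))// [leRHS]splitr
  lerD.
Qed.

Lemma rnorm_inj_embedding Y (y : Y) : rnorm (inj_embedding Y y) = rnorm y.
Proof.
apply/eqP; rewrite eq_le rnorm_ell_inf; apply/andP; split.
  by apply: supnorm_le => [|phi]; [exact: rnorm_ge0|exact: ball_eval_le].
apply: rnorm_le_dual => f; rewrite -rnorm_le1 => f1.
exact: (supnorm_ub (inj_embedding Y y) (exist _ f f1)).
Qed.

(** Functionals of the dual unit ball are equicontinuous, so up to [e] they are determined on the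
    image of the unit ball by their values on a finite net of it, and these values are finitely many
    bounded scalars. *)
Theorem schauder X Y (T : operator X Y) :
  compact_op X Y T -> compact_op (dual Y) (dual X) (adjoint T).
Proof.
move=> /compact_opP Tc; apply/compact_opP => e e0.
have e3 : 0 < e / 3 by rewrite divr_gt0.
have [n [s sP]] := totally_bounded_net Tc e3.
pose h j (phi : unit_ball (dual Y)) : K := (val phi : dual Y) (T (val (s j))).
have ball1 (V : normedModType K) (f : unit_ball (dual Y)) v : rnorm ((val f : dual Y)
  v) <= rnorm v.
  have f1 : rnorm (val f : dual Y) <= 1 by rewrite -rnorm_le1; exact: valP f.
  by rewrite (le_trans (rnorm_apply _ _))// -[leRHS]mul1r ler_wpM2r ?rnorm_ge0.
have hM j phi : re `|h j phi| <= rnorm T.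
  rewrite -rnorm_scalar (le_trans (ball1 Y _ _))//.
  by apply: rnorm_apply_ball; rewrite -rnorm_le1; exact: valP (s j).
have [m [t tP]] := bounded_scalars_net hM e3.
exists m, (fun l => adjoint T (val (t l))) => phi; have [l lP] := tP phi; exists l.
apply: rnorm_le_ball => [|x]; first exact: ltW.
rewrite -rnorm_le1 => x1; have [j jP] := sP (exist _ x x1).
rewrite opBE /=.
have -> : (val phi : dual Y) (T x) - (val (t l) : dual Y) (T x) =
    (val phi : dual Y) (T x - T (val (s j))) + ((h j phi : scalar_space R k) - h j (t
      l)) +
    (val (t l) : dual Y) (T (val (s j)) - T x).
  by rewrite !opvB /h /= !addrA !subrK.
have -> : e = e / 3 + e / 3 + e / 3 by lra.
rewrite (le_trans (rnormD _ _))// lerD//;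
  last by rewrite (le_trans (ball1 Y _ _))// rnormB.
rewrite (le_trans (rnormD _ _))// lerD//; first by rewrite (le_trans (ball1 Y _ _)).
exact: lP.
Qed.

(** If every solution [x] of the equations had norm above c = |zeta| + e, Hahn-Banach would give a
    functional of norm at most 1/c that is 1 on the solutions. It would be a combination of the
    given functionals, so [zeta] would take the value 1 on it, against |zeta|/c < 1. *)
Lemma helly Z n (g : 'I_n -> dual Z) (zeta : dual (dual Z)) (e : R) : 0 < e ->
  exists2 z, rnorm z <= rnorm zeta + e & forall i, g i z = zeta (g i).
Proof.
move=> e0.
have [||||m [h [z [hz gE]]]] := @biorthogonal_system R k (dual Z) Z (fun f z => f z) _ _ _
    [set f | exists i, f = g i].
- by [].
- by move=> f a u v; rewrite linearP.
- by move=> f f0; apply: operatorP => x; rewrite f0.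
- exists n, g => _ [i ->]; exists (fun j => (j == i)%:R).
  rewrite (bigD1 i)//= eqxx scale1r big1 ?addr0// => j /negbTE ->.
  by rewrite scale0r.
pose z0 := \sum_j (zeta (h j) : K) *: z j.
have hz0 j : h j z0 = zeta (h j).
  rewrite opv_sum (bigD1 j)//= opvZ hz eqxx big1 ?addr0; first exact: mulr1.
  by move=> i ij; rewrite opvZ hz eq_sym (negbTE ij) mulr0n scaler0.
pose c := rnorm zeta + e.
have c0 : 0 < c by rewrite ltr_wpDl// rnorm_ge0.
suff [x [xc hx]] : exists x, rnorm x <= c /\ forall j, h j x = zeta (h j).
  exists x => // i; have gi : [set f | exists i, f = g i] (g i) by exists i.
  rewrite (gE _ gi) op_sumE opv_sum; apply: eq_bigr => j _.
  by rewrite opZE hx opvZ.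
apply: contrapT => nx.
have big x : (forall j, h j x = zeta (h j)) -> c < rnorm x.
  by move=> hx; rewrite ltNge; apply/negP => xc; apply: nx; exists x.
(* The projection onto the common kernel of the [h j]; the solutions form the affine space [z0] +
   range of [P]. *)
pose P x := x - \sum_j (h j x : K) *: z j.
have hP x j : h j (P x) = 0.
  rewrite opvB opv_sum (bigD1 j)//= opvZ hz eqxx big1 ?addr0.
    by rewrite [_ *: _]mulr1 subrr.
  by move=> i ij; rewrite opvZ hz eq_sym (negbTE ij) mulr0n scaler0.
have PL a u v : P (a *: u + v) = a *: P u + P v.
  rewrite /P scalerBr scaler_sumr addrACA -opprD; congr (_ - _).
  rewrite -big_split /=; apply: eq_bigr => j _.
  by rewrite linearP scalerDl scalerA.
(* The functional that is 1 at [z0] and 0 on the common kernel; its bound is the assumption that all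
   solutions are long. *)
have [||||f fc fE] := @hahn_banach_dual R k (K^o * Z)%type Z
    (fun w => (w.1 : K) *: z0 + P w.2) (fun w => w.1) c^-1.
- by rewrite invr_ge0 ltW.
- by move=> a u v /=; rewrite PL scalerDl (scalerDr a (u.1 *: z0)) scalerA addrACA.
- by [].
- move=> [a x] /=; rewrite mulrC ler_pdivlMr//.
  have [->|a0] := eqVneq a 0; first by rewrite re_norm0 mul0r rnorm_ge0.
  have -> : a *: z0 + P x = a *: (z0 + a^-1 *: P x) by rewrite scalerDr scalerA divff//
    scale1r.
  rewrite rnormZ ler_wpM2l ?re_norm_ge0//; apply/ltW/big => j.
  by rewrite opvD /= hz0 opvZ /= hP scaler0 addr0.
have fz0 : f z0 = 1 :> K.
  have := fE (1, 0); rewrite /= scale1r (_ : P 0 = 0) ?addr0//.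
  by rewrite /P big1 ?subr0// => j _; rewrite raddf0 scale0r.
have fS : f = \sum_j (f (z j) : K) *: h j.
  apply: operatorP => x; have := fE (0, x); rewrite /= scale0r add0r opvB opv_sum /=.
  move/eqP; rewrite subr_eq0 => /eqP ->; rewrite op_sumE; apply: eq_bigr => j _.
  by rewrite opvZ; exact: mulrC.
have z1 : zeta f = 1 :> K.
  rewrite fS opv_sum -fz0 /z0 opv_sum; apply: eq_bigr => j _.
  by rewrite !opvZ /=; exact: mulrC.
have := rnorm_apply zeta f; rewrite z1 rnorm_scalar re_norm1.
apply/negP; rewrite -ltNge (@le_lt_trans _ _ (rnorm zeta * c^-1))//.
  by rewrite ler_wpM2l ?rnorm_ge0.
by rewrite ltr_pdivrMr// mul1r ltrDl.
Qed.

(** [S] is the bidual of [T] with values read in [Y]. The image of zeta is a limit of vectors [T z],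
    with [z] agreeing with zeta on a finite net of the image of the dual ball under the adjoint; and
    [Y] is closed in its bidual. *)
Lemma compact_bidual X Y (T : operator X Y) : compact_op X Y T ->
  exists S : operator (dual (dual X)) Y, forall zeta (phi : dual Y), phi (S zeta) =
    zeta (adjoint T phi).
Proof.
move=> /schauder/compact_opP Tc.
have yP zeta : exists y, adjoint (adjoint T) zeta = eval_op Y y.
  suff : closure (range (eval_op Y)) (adjoint (adjoint T) zeta).
    by move=> /(isometry_range_closed (@rnorm_eval _ _ Y))[y _ <-]; exists y.
  apply/closure_rnormP => e e0.
  (* The error is [zeta d - d z], where [d] is the distance to the net and Helly's [z] has norm at
     most |zeta| + 1; hence this sum. *)
  have c0 : 0 < rnorm zeta + (rnorm zeta + 1).
    by rewrite addrA ltr_wpDl// addr_ge0// rnorm_ge0.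
  have [|n [s sP]] := totally_bounded_net Tc (e := e / (rnorm zeta + (rnorm zeta + 1))).
    by rewrite divr_gt0.
  have [z z1 zE] := helly (fun j => adjoint T (val (s j))) zeta (@ltr01 R).
  exists (eval_op Y (T z)); first by exists (T z).
  apply: rnorm_le_ball => [|phi]; first exact: ltW.
  rewrite -rnorm_le1 => phi1; have [j jP] := sP (exist _ phi phi1).
  set d := adjoint T _ - _ in jP.
  have -> : (adjoint (adjoint T) zeta - eval_op Y (T z)) phi = zeta d - d z.
    rewrite opBE /d opvB /= -[in RHS]zE /=.
    by rewrite opprB addrA subrK.
  rewrite (le_trans (rnormD _ _))// rnormN.
  rewrite (@le_trans _ _ (rnorm d * (rnorm zeta + (rnorm zeta + 1))))//;
    last by rewrite -ler_pdivlMr.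
  rewrite mulrDr lerD//; first by rewrite mulrC rnorm_apply.
  by rewrite (le_trans (rnorm_apply _ _))// ler_wpM2l ?rnorm_ge0.
have [f fE] := choice yP.
have fE' zeta (phi : dual Y) : phi (f zeta) = zeta (adjoint T phi).
  by rewrite -eval_opE -fE.
have [|||S SE _] := @operator_exists R k (dual (dual X)) Y f (rnorm (adjoint (adjoint
  T))).
- move=> a u v; apply/eqP; rewrite -subr_eq0; apply/eqP/functional_separates => phi.
  by rewrite opvB linearP /= !fE' subrr.
- exact: rnorm_ge0.
- by move=> zeta; rewrite -rnorm_eval -fE; exact: rnorm_apply.
by exists S => zeta phi; rewrite SE fE'.
Qed.

Lemma coordinate_subproof (I : Type) (i : I) :
  (fun x : ell_inf R k I => x i) \in @bounded_linear R k (ell_inf R k I) (scalar_space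
    R k).
Proof.
by apply/bounded_linearP; split=> //; exists 1 => x;
  rewrite mul1r rnorm_ell_inf supnorm_ub.
Qed.

Definition coordinate (I : Type) (i : I) : dual (ell_inf R k I) := Operator
  (coordinate_subproof i).

Lemma rnorm_coordinate (I : Type) (i : I) : rnorm (coordinate i) <= 1.
Proof. by apply: rnorm_le_op => // x; rewrite mul1r rnorm_ell_inf supnorm_ub. Qed.

(** By Schauder's theorem the coordinates of [T] form a totally bounded family of functionals.
    Rounding each of them to a member of a finite net leaves finitely many functionals, multiplied
    by indicators of index sets. *)
Lemma compact_ell_inf_approximable X (I : Type) (T : operator X (ell_inf R k I)) :
  compact_op X (ell_inf R k I) T -> approximable X (ell_inf R k I) T.
Proof.
move=> /schauder/compact_opP Tc; apply/approximableP => e e0.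
have cb (i : I) : `|coordinate i| <= 1 by rewrite rnorm_le1 rnorm_coordinate.
have Ic : totally_bounded (fun i : I => adjoint T (coordinate i)).
  move=> d /Tc[n [s sP]]; exists n, s => i.
  by have [j jP] := sP (exist _ (coordinate i) (cb i)); exists j.
have [n [s sP]] := totally_bounded_net Ic e0.
have [c cP] := choice sP.
have chiP j : (fun i => (c i == j)%:R : scalar_space R k) \in @Defs.bounded_fun R k I.
  apply/Defs.bounded_funP; exists 1 => i; rewrite rnorm_scalar.
  by case: eqP => _; rewrite ?re_norm1 ?re_norm0.
pose F := \sum_j rank1 (comp_op (coordinate (s j)) T) (EllInf (chiP j)).
have ellsum (J : Type) (r : seq J) (f : J -> ell_inf R k I) i :
    (\sum_(j <- r) f j) i = \sum_(j <- r) f j i.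
  by elim/big_rec2 : _ => // j y S _ <-.
exists F; first exact: finite_rank_sum.
apply: rnorm_le_op => [|x]; first exact: ltW.
rewrite rnorm_ell_inf; apply: supnorm_le => [|i];
  first by rewrite mulr_ge0 ?rnorm_ge0 ?(ltW e0).
have -> : ((T - F) x) i = (adjoint T (coordinate i) - adjoint T (coordinate (s (c i)))) x.
  change (T x i - F x i = T x i - T x (s (c i))); congr (_ - _).
  rewrite /F op_sumE ellsum (bigD1 (c i))//= big1 ?addr0.
    by change ((T x (s (c i)) : K) * (c i == c i)%:R = T x (s (c i)) :> K);
      rewrite eqxx mulr1.
  move=> j jc; change ((T x (s j) : K) * (c i == j)%:R = 0 :> K).
  by rewrite eq_sym (negbTE jc) mulr0.
by rewrite (le_trans (rnorm_apply _ _))// ler_wpM2r ?rnorm_ge0.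
Qed.

End Duality.

(** * Operators on l_1 *)

Section EllOne.
Variables (R : realType) (k : scalar_kind) (I : choiceType).
Local Notation K := (scalars R k).
Local Notation ell1 := (ell1 R k I).
Implicit Types Z : Banach R k.

Lemma norm1_ub_seq (l : ell1) (s : seq I) : uniq s -> \sum_(i <- s) rnorm (l i) <=
  norm1 l.
Proof.
move=> us; apply: le_trans (norm1_ub l [fset x in s]%fset).
rewrite le_eqVlt; apply/orP; left; apply/eqP/perm_big; apply: uniq_perm => //.
by move=> b; rewrite !inE.
Qed.

Lemma sum_delta1_le (i : I) (A : {fset I}) :
  \sum_(j <- A) rnorm ((j == i)%:R : scalar_space R k) <= 1.
Proof.
rewrite (bigID (pred1 i)) /= [X in _ + X]big1 ?addr0; last first.
  by move=> j /negbTE ji; rewrite rnorm_scalar ji re_norm0.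
rewrite -big_filter (@le_trans _ _ (\sum_(j <- [:: i]) 1))//; last by rewrite big_seq1.
rewrite (eq_big_seq (fun=> 1)); last first.
  by move=> j; rewrite mem_filter /= => /andP[ji _]; rewrite rnorm_scalar ji re_norm1.
rewrite !big_const_seq !count_predT !iter_addr_0 ler_nat.
apply: uniq_leq_size; first exact/filter_uniq/fset_uniq.
by move=> j; rewrite mem_filter inE => /andP[].
Qed.

Lemma delta1_subproof (i : I) :
  (fun j => (j == i)%:R : scalar_space R k) \in @summable_fun R k I.
Proof. by apply/summable_funP; exists 1 => A; exact: sum_delta1_le. Qed.

Definition delta1 (i : I) : ell1 := Ell1 (delta1_subproof i).

Lemma ell1_sumE (J : Type) (s : seq J) (f : J -> ell1) i :
  (\sum_(j <- s) f j) i = \sum_(j <- s) f j i.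
Proof. by elim/big_rec2 : _ => // j y S _ <-. Qed.

Lemma ell1_truncE (l : ell1) (A : {fset I}) i :
  (\sum_(b <- A) (l b : K) *: delta1 b) i = if i \in A then l i else 0.
Proof.
rewrite ell1_sumE; case: ifPn => iA.
  rewrite (big_fsetD1 i)//= big_seq big1 ?addr0.
    by change ((l i : K) * (i == i)%:R = l i :> K); rewrite eqxx mulr1.
  move=> b; rewrite !inE => /andP[bi _].
  by change ((l b : K) * (i == b)%:R = 0 :> K); rewrite eq_sym (negbTE bi) mulr0.
rewrite big_seq big1// => b bA; change ((l b : K) * (i == b)%:R = 0 :> K).
by case: eqP => [ib|_]; [rewrite ib bA in iA|rewrite mulr0].
Qed.

Lemma ell1_trunc (l : ell1) (e : R) : 0 < e ->
  exists A : {fset I}, forall B : {fset I}, (A `<=` B)%fset ->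
    rnorm (l - \sum_(b <- B) (l b : K) *: delta1 b) <= e.
Proof.
move=> e0.
have [A lA] : exists A : {fset I}, norm1 l - e < \sum_(b <- A) rnorm (l b).
  apply: contrapT => /forallNP h.
  have : norm1 l <= norm1 l - e by apply: norm1_le => A; rewrite leNgt; apply/negP/h.
  by rewrite leNgt gtrBl e0.
exists A => B AB; rewrite rnorm_ell1; apply: norm1_le => C.
have -> : \sum_(i <- C) rnorm ((l - \sum_(b <- B) (l b : K) *: delta1 b) i) =
    \sum_(i <- C | i \notin B) rnorm (l i).
  rewrite [RHS]big_mkcond; apply: eq_bigr => i _.
  change (rnorm (l i - (\sum_(b <- B) (l b : K) *: delta1 b) i) =
    if i \notin B then rnorm (l i) else 0).
  by rewrite ell1_truncE; case: ifPn; rewrite ?subrr ?rnorm0 ?subr0.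
rewrite -(lerD2l (\sum_(b <- A) rnorm (l b))).
apply: (@le_trans _ _ (norm1 l)); last by rewrite -lerBlDr ltW.
rewrite -[X in _ + X]big_filter -big_cat; apply: norm1_ub_seq.
rewrite cat_uniq fset_uniq filter_uniq ?fset_uniq// andbT /=.
apply/hasPn => b; rewrite mem_filter => /andP[bB _]; apply: contra bB.
exact: (fsubsetP AB).
Qed.

Lemma ell1_op_norm Z (T : operator ell1 Z) (c : R) : 0 <= c ->
  (forall i, rnorm (T (delta1 i)) <= c) -> rnorm T <= c.
Proof.
move=> c0 Tc; apply: rnorm_le_op => // l; apply/ler_addgt0Pl => e e0.
have T0 : 0 < rnorm T + 1 by rewrite ltr_wpDl ?rnorm_ge0.
have [|A AP] := @ell1_trunc l (e / (rnorm T + 1)); first by rewrite divr_gt0.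
have {}AP := AP A (fsubset_refl A).
set l' := \sum_(b <- A) _ in AP.
rewrite -(subrK l' l) opvD (le_trans (rnormD _ _))// lerD//.
  rewrite (le_trans (rnorm_apply _ _))// (le_trans (ler_wpM2l (rnorm_ge0 _) AP))//.
  by rewrite mulrCA -[leRHS]mulr1 ler_wpM2l ?(ltW e0)// ler_pdivrMr// mul1r lerDl.
rewrite subrK /l' opv_sum (le_trans (rnorm_sum _ _))//.
rewrite (@le_trans _ _ (\sum_(b <- A) rnorm (l b) * c))//.
  by apply: ler_sum => b _; rewrite opvZ rnormZ ler_wpM2l ?re_norm_ge0.
by rewrite -mulr_suml mulrC ler_wpM2l// rnorm_ell1 norm1_ub.
Qed.

Lemma ell1_op_ext Z (S T : operator ell1 Z) :
  (forall i, S (delta1 i) = T (delta1 i)) -> S = T.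
Proof.
move=> ST; apply/eqP; rewrite -subr_eq0; apply/eqP/rnorm0_eq0/eqP.
rewrite eq_le rnorm_ge0 andbT; apply: ell1_op_norm => // i.
by rewrite opBE ST subrr rnorm0.
Qed.

(** The value at [l] is the limit of finite partial sums along the finite sets of indices, which is
    Cauchy because truncations of [l] are. This freedom on unit vectors is what lets l_1 lift
    through surjections. *)
Lemma ell1_op_exists Z (f : I -> Z) (c : R) : 0 <= c -> (forall i, rnorm (f i) <= c) ->
  exists2 T : operator ell1 Z, (forall i, T (delta1 i) = f i) & rnorm T <= c.
Proof.
move=> c0 fc.
pose F l (A : {fset I}) : Z := \sum_(b <- A) ((l : ell1) b : K) *: f b.
have FD a u v A : F (a *: u + v) A = a *: F u A + F v A.
  rewrite /F scaler_sumr -big_split /=; apply: eq_bigr => b _.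
  change ((a * (u b : K) + (v b : K)) *: f b = a *: ((u b : K) *: f b) + (v b : K) *: f
    b).
  by rewrite scalerDl scalerA.
have Fc l A : rnorm (F l A) <= c * rnorm l.
  rewrite (le_trans (rnorm_sum _ _))//.
  rewrite (@le_trans _ _ (\sum_(b <- A) rnorm (l b) * c))//.
    by apply: ler_sum => b _; rewrite rnormZ ler_wpM2l ?re_norm_ge0.
  by rewrite -mulr_suml mulrC ler_wpM2l// rnorm_ell1 norm1_ub.
have FT (l : ell1) A B : (A `<=` B)%fset -> F (\sum_(b <- A) (l b : K) *: delta1 b) B =
  F l A.
  move=> AB; rewrite /F (eq_bigr (fun b => if b \in A then (l b : K) *: f b else 0)).
    rewrite -big_mkcond -big_filter; apply: perm_big; apply: uniq_perm.
    - exact/filter_uniq/fset_uniq.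
    - exact: fset_uniq.
    - by move=> b; rewrite mem_filter; apply: andb_idr; exact: (fsubsetP AB).
  by move=> b _; rewrite ell1_truncE; case: ifP => //; rewrite scale0r.
have limP (l : ell1) : exists z, forall e : R, 0 < e ->
    exists A, forall B, (A `<=` B)%fset -> rnorm (z - F l B) <= e.
  have /cvg_ex[z /cvg_rnormP zP] : cvg (F l @ summability.totally).
    apply: cauchy_cvg; apply/rnorm_cauchyP => e e0.
    have cc : 0 < c * (1 + 1) + 1 by rewrite ltr_wpDl ?mulr_ge0.
    have [|A AP] := @ell1_trunc l (e / (c * (1 + 1) + 1)); first by rewrite divr_gt0.
    exists (F l A); exists A => // B /= AB.
    have FB : F l A - F l B = F (\sum_(b <- A) (l b : K) *: delta1 b - \sum_(b <- B) (l
      b : K) *: delta1 b) B.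
      by have := FD (-1) (\sum_(b <- B) (l b : K) *: delta1 b) (\sum_(b <- A) (l b : K)
        *: delta1 b) B;
        rewrite !scaleN1r addrC => ->; rewrite !FT// addrC.
    rewrite FB (le_trans (Fc _ _))//.
    set l1 := \sum_(b <- A) _; set l2 := \sum_(b <- B) _.
    have : rnorm (l1 - l2) <= e / (c * (1 + 1) + 1) * (1 + 1).
      rewrite -(subrK l l1) -addrA (le_trans (rnormD _ _))// mulrDr mulr1 lerD//;
        last exact: AP.
      by rewrite rnormB AP.
    move=> /(ler_wpM2l c0)/le_trans; apply.
    by rewrite mulrCA mulrAC ler_pdivrMr// ler_wpM2l ?(ltW e0)// lerDl.
  by exists z => e /zP[A _ AP]; exists A => B AB; apply: ltW; exact: AP.
have [g gP] := choice limP.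
have g_eq l z : (forall e : R, 0 < e -> exists A, forall B, (A `<=` B)%fset -> rnorm (z
  - F l B) <= e) ->
    g l = z.
  move=> zP; apply/eqP; rewrite -subr_eq0; apply/eqP/rnorm0_eq0/eqP.
  rewrite eq_le rnorm_ge0 andbT; apply/ler_addgt0Pl => e e0; rewrite addr0.
  have e2 : 0 < e / 2 by rewrite divr_gt0.
  have [A AP] := zP _ e2; have [B BP] := gP l _ e2.
  rewrite -(subrK (F l (A `|` B)%fset) (g l)) -addrA (le_trans (rnormD _ _))//
    [leRHS]splitr lerD//.
    by rewrite BP// fsubsetUr.
  by rewrite rnormB AP// fsubsetUl.
have gl : linear g.
  move=> a u v; apply: g_eq => e e0.
  have a0 : 0 < re `|a| + 1 by rewrite ltr_wpDl ?re_norm_ge0.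
  have [|A AP] := gP u (e / 2 / (re `|a| + 1)); first by rewrite !divr_gt0.
  have [|B BP] := gP v (e / 2); first by rewrite divr_gt0.
  exists (A `|` B)%fset => C; rewrite fsubUset => /andP[AC BC].
  rewrite FD opprD addrACA -scalerBr (le_trans (rnormD _ _))// [leRHS]splitr lerD//;
    last exact: BP.
  rewrite rnormZ (le_trans (ler_wpM2l (re_norm_ge0 _) (AP _ AC)))//.
  by rewrite mulrCA -[leRHS]mulr1 ler_wpM2l ?divr_ge0 ?(ltW e0)// ler_pdivrMr// mul1r
    lerDl.
have gc l : rnorm (g l) <= c * rnorm l.
  apply/ler_addgt0Pl => e e0; have [A AP] := gP l _ e0.
  rewrite -(subrK (F l A) (g l)) (le_trans (rnormD _ _))// lerD//.
  exact: (AP _ (fsubset_refl A)).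
have [T TE Tc] := operator_exists gl c0 gc.
exists T => // i; rewrite TE; apply: g_eq => e e0; exists [fset i]%fset => B.
rewrite fsub1set => iB; rewrite /F (big_fsetD1 i)//= eqxx scale1r big_seq big1.
  by rewrite addr0 subrr rnorm0 ltW.
by move=> b; rewrite !inE => /andP[/negbTE bi _]; rewrite bi scale0r.
Qed.

(** The norm of an operator on l_1 is controlled on unit vectors, so rounding each [T (delta1 i)] to
    a point of a finite net changes [T] by at most [e]. *)
Lemma totally_bounded_ell1_approximable Z (T : operator ell1 Z) :
  totally_bounded (fun i => T (delta1 i)) -> approximable ell1 Z T.
Proof.
move=> Tc; apply/approximableP => e e0.
have [n [s sP]] := Tc _ e0; have [c cP] := choice sP.
have chi j : exists g : operator ell1 (scalar_space R k), forall i, g (delta1 i) = (c i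
  == j)%:R.
  have [|g gE _] := @ell1_op_exists (scalar_space R k) (fun i => (c i == j)%:R) 1 ler01.
  - by move=> i; rewrite rnorm_scalar; case: eqP; rewrite ?re_norm1 ?re_norm0.
  by exists g.
have [g gE] := choice chi.
exists (\sum_j rank1 (g j) (s j)); first exact: finite_rank_sum.
apply: ell1_op_norm => [|i]; first exact: ltW.
rewrite opBE op_sumE (bigD1 (c i))//= gE eqxx scale1r big1 ?addr0//.
by move=> j jc; rewrite /= gE eq_sym (negbTE jc) scale0r.
Qed.

Lemma rnorm_delta1 i : rnorm (delta1 i) <= 1.
Proof. by rewrite rnorm_ell1; apply: norm1_le => A; exact: sum_delta1_le. Qed.

Lemma compact_ell1_approximable Z (T : operator ell1 Z) :
  compact_op _ Z T -> approximable ell1 Z T.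
Proof.
move=> /compact_opP Tc; apply: totally_bounded_ell1_approximable => e /Tc[n [s sP]].
exists n, s => i; have d1 : `|delta1 i| <= 1 by rewrite rnorm_le1 rnorm_delta1.
by have [j jP] := sP (exist _ (delta1 i) d1); exists j.
Qed.

End EllOne.

Lemma sur_quotient_delta1 (R : realType) (k : scalar_kind) (X : Banach R k) (b :
  unit_ball X) :
  sur_quotient X (delta1 R k b) = val b.
Proof.
apply: cvg_lim; first exact: norm_hausdorff.
apply/cvg_rnormP => e e0; exists [fset b]%fset => // B bB.
have {}bB : b \in B by apply: (fsubsetP bB); rewrite inE.
change (rnorm (val b - summability.partial_sum (ball_terms (delta1 R k b)) B) < e).
rewrite partial_sumE (big_fsetD1 b)//= /ball_terms /= eqxx scale1r big_seq big1.
  by rewrite addr0 subrr rnorm0.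
by move=> c; rewrite !inE => /andP[/negbTE cb _]; rewrite cb scale0r.
Qed.

(** * Completeness through series; ranges with quotient norm; l_infty-sums *)

Section Completeness.
Variables (R : realType) (k : scalar_kind).
Local Notation K := (scalars R k).

Lemma half_expn_small (e : R) : 0 < e -> exists N, forall n, (N <= n)%N -> (2^-1 : R)
  ^+ n <= e.
Proof.
move=> e0; exists (Num.truncn e^-1) => n Nn.
rewrite exprVn -[leRHS]invrK lef_pV2 ?posrE ?invr_gt0 ?exprn_gt0//.
have /truncn_itv/andP[_ /ltW h] : 0 <= e^-1 by rewrite invr_ge0 ltW.
rewrite (le_trans h)// (@le_trans _ _ n.+1%:R)// ?ler_nat ?ltnS//.
by rewrite -natrX ler_nat; exact: ltn_expl.
Qed.

Lemma half_expnS (n : nat) : (2^-1 : R) ^+ n.+1 + 2^-1 ^+ n.+1 = 2^-1 ^+ n.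
Proof. by rewrite exprS -mulrDl -[X in (X + X) * _]mul1r -splitr mul1r. Qed.

Lemma half_expn_gt0 n : 0 < (2^-1 : R) ^+ n.
Proof. by rewrite exprn_gt0// invr_gt0. Qed.

Lemma rnorm_series_tail (V : normedModType K) (u : nat -> V) (C : R) :
  (forall n, rnorm (u n) <= C * 2^-1 ^+ n.+1) ->
  forall m n, (m <= n)%N ->
    rnorm (\sum_(i < n) u i - \sum_(i < m) u i) <= C * (2^-1 ^+ m - 2^-1 ^+ n).
Proof.
move=> uC m; elim=> [|n ih].
  by rewrite leqn0 => /eqP ->; rewrite !subrr rnorm0 mulr0.
rewrite leq_eqVlt => /predU1P[<-|]; first by rewrite !subrr rnorm0 mulr0.
rewrite ltnS => /ih h; rewrite big_ord_recr /= addrAC (le_trans (rnormD _ _))//.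
rewrite (le_trans (lerD h (uC n)))// -mulrDr.
by rewrite -[in leLHS](half_expnS n) opprD addrA subrK.
Qed.

Lemma banach_series (V : Banach R k) (u : nat -> V) (C : R) : 0 <= C ->
  (forall n, rnorm (u n) <= C * 2^-1 ^+ n.+1) ->
  exists l, forall n, rnorm (l - \sum_(i < n) u i) <= C * 2^-1 ^+ n.
Proof.
move=> C0 uC.
have tail m n : (m <= n)%N -> rnorm (\sum_(i < n) u i - \sum_(i < m) u i) <= C * 2^-1
  ^+ m.
  move=> mn; rewrite (le_trans (rnorm_series_tail uC mn))// ler_wpM2l// gerBl.
  exact/ltW/half_expn_gt0.
have [e e0|l lP] := @cauchy_seq_limit R k V (fun n => \sum_(i < n) u i).
  have [|N NP] := @half_expn_small (e / (C + 1)); first by rewrite divr_gt0// ltr_wpDl.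
  exists N => n Nn; rewrite rnormB (le_trans (tail _ _ Nn))//.
  rewrite (le_trans (ler_wpM2l C0 (NP N (leqnn N))))// mulrCA -[leRHS]mulr1.
  by rewrite ler_wpM2l ?(ltW e0)// ler_pdivrMr ?ltr_wpDl// mul1r lerDl.
exists l => n; apply/ler_addgt0Pl => e /lP[N NP].
rewrite -(subrK (\sum_(i < maxn N n) u i) l) -addrA (le_trans (rnormD _ _))// lerD//.
  by rewrite NP// leq_maxl.
by rewrite tail// leq_maxr.
Qed.

(** Completeness is tested on geometrically decaying series only. This suits quotient norms, where
    lifts are chosen term by term. *)
Lemma series_complete (V : normedModType K) :
  (forall u : nat -> V, (forall n, rnorm (u n) <= 2^-1 ^+ n.+1) ->
     exists l (C : R), forall n, rnorm (l - \sum_(i < n) u i) <= C * 2^-1 ^+ n) ->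
  forall F : set_system V, ProperFilter F -> cauchy F -> cvg F.
Proof.
move=> Vc F FF /rnorm_cauchyP Fc.
(* Consecutive terms differ by at most 2^-(n+2) + 2^-(n+3), within the required 2^-(n+1). *)
have /choice[v vP] : forall n : nat, exists v, F [set w | rnorm (v - w) <= 2^-1 ^+ n.+2].
  by move=> n; apply: Fc; exact: half_expn_gt0.
pose u n := v n.+1 - v n.
have uP n : rnorm (u n) <= 2^-1 ^+ n.+1.
  have [w [/= w1 w2]] := filter_ex (filterI (vP n) (vP n.+1)).
  rewrite /u -(subrK w (v n.+1)) -addrA (le_trans (rnormD _ _))//.
  rewrite -(half_expnS n.+1) lerD//; last by rewrite rnormB.
  by rewrite (le_trans w2)// -(half_expnS n.+2) lerDl ltW// half_expn_gt0.
have [l [C lP]] := Vc u uP.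
apply/cvg_ex; exists (l + v 0%N); apply/cvg_rnormP => e e0.
have sumE n : \sum_(i < n) u i = v n - v 0%N.
  elim: n => [|n ih]; first by rewrite big_ord0 subrr.
  by rewrite big_ord_recr /= ih /u addrC subrKA.
have [|N NP] := @half_expn_small (e / (`|C| + 2)); first by rewrite divr_gt0// ltr_wpDl.
apply: filterS (vP N) => w /= vw.
have := lP N; rewrite sumE opprB addrA => lN.
rewrite -(subrK (v N) (l + v 0%N)) -addrA (le_lt_trans (rnormD _ _))//.
rewrite (le_lt_trans (lerD lN vw))//.
apply: (@le_lt_trans _ _ ((`|C| + 1) * 2^-1 ^+ N)).
  rewrite mulrDl mul1r lerD//.
    by rewrite ler_wpM2r ?ler_norm// ltW// half_expn_gt0.
  rewrite -(half_expnS N) (@le_trans _ _ (2^-1 ^+ N.+1))//.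
    by rewrite -(half_expnS N.+1) lerDl ltW// half_expn_gt0.
  by rewrite lerDl ltW// half_expn_gt0.
rewrite (le_lt_trans (ler_wpM2l _ (NP N (leqnn N))))// ?addr_ge0//.
rewrite mulrCA -[ltRHS]mulr1 ltr_pM2l// ltr_pdivrMr ?ltr_wpDl// mul1r.
by rewrite ltrD2l ltr1n.
Qed.

End Completeness.

(* The range of an operator U on Z, normed as the quotient of Z by the kernel. *)
Section ImageSpace.
Variables (R : realType) (k : scalar_kind) (Z X : Banach R k) (U : operator Z X).
Local Notation K := (scalars R k).

Definition image_pred : {pred X} := fun x => `[< exists z, U z = x >].

Lemma image_predP x : reflect (exists z, U z = x) (x \in image_pred).
Proof. exact: asboolP. Qed.

Lemma image_submod_closed : submod_closed image_pred.
Proof.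
split; first by apply/image_predP; exists 0; rewrite opv0.
move=> a _ _ /image_predP[u <-] /image_predP[v <-].
by apply/image_predP; exists (a *: u + v); rewrite opvD opvZ.
Qed.

HB.instance Definition _ := GRing.isSubmodClosed.Build K X image_pred image_submod_closed.

Record image_space := ImageSpace {
  image_val :> X;
  image_valP : image_val \in image_pred }.

HB.instance Definition _ := [isSub for image_val].
HB.instance Definition _ := [Choice of image_space by <:].
HB.instance Definition _ := [SubChoice_isSubLmodule of image_space by <:].

Implicit Types x y : image_space.

Definition image_lift x := [set z | U z = val x].

Definition image_norm x : R := inf [set rnorm z | z in image_lift x].

Lemma image_norm_has_inf x : has_inf [set rnorm z | z in image_lift x].
Proof.
split; last by exists 0 => _ [z _ <-]; exact: rnorm_ge0.
by have /image_predP[z zx] := image_valP x; exists (rnorm z), z.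
Qed.

Lemma image_norm_lb x z : U z = val x -> image_norm x <= rnorm z.
Proof. by move=> zx; apply: ge_inf; [case: (image_norm_has_inf x)|exists z]. Qed.

Lemma image_norm_lift x (e : R) : 0 < e ->
  exists2 z, U z = val x & rnorm z <= image_norm x + e.
Proof.
move=> e0; have [_ [z zx <-] zn] := inf_adherent e0 (image_norm_has_inf x).
by exists z => //; exact: ltW.
Qed.

Lemma image_norm_ge0 x : 0 <= image_norm x.
Proof.
apply: lb_le_inf; first by case: (image_norm_has_inf x).
by move=> _ [z _ <-]; exact: rnorm_ge0.
Qed.

Lemma image_normD x y : emb (k := k) (image_norm (x + y)) <= emb (image_norm x) + emb
  (image_norm y).
Proof.
rewrite -embD emb_le; apply/ler_addgt0Pl => e e0.
have e2 : 0 < e / 2 by rewrite divr_gt0.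
have [u ux un] := image_norm_lift x e2; have [v vy vn] := image_norm_lift y e2.
apply: (@le_trans _ _ (rnorm (u + v))); first by apply: image_norm_lb; rewrite opvD ux vy.
by rewrite (le_trans (rnormD _ _))// (le_trans (lerD un vn))// addrACA -splitr addrC.
Qed.

Lemma image_normZ (a : K) x : emb (image_norm (a *: x)) = `|a| * emb (image_norm x).
Proof.
apply: norm_leZ_eq => [|{}a {}x].
  apply/eqP; rewrite eq_le image_norm_ge0 andbT -(rnorm0 Z).
  by apply: image_norm_lb; rewrite opv0.
apply/ler_addgt0Pl => e e0; have a0 : 0 < re `|a| + 1 by rewrite ltr_wpDl ?re_norm_ge0.
have [|z zx zn] := image_norm_lift x (e := e / (re `|a| + 1)); first by rewrite divr_gt0.
apply: (@le_trans _ _ (rnorm (a *: z))); first by apply: image_norm_lb; rewrite opvZ zx.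
rewrite rnormZ (le_trans (ler_wpM2l (re_norm_ge0 _) zn))// mulrDr addrC lerD2r.
by rewrite mulrCA -[leRHS]mulr1 ler_wpM2l ?(ltW e0)// ler_pdivrMr// mul1r lerDl.
Qed.

Lemma rnorm_image_val x : rnorm (val x) <= rnorm U * image_norm x.
Proof.
apply/ler_addgt0Pl => e e0; have U0 : 0 < rnorm U + 1 by rewrite ltr_wpDl ?rnorm_ge0.
have [|z zx zn] := image_norm_lift x (e := e / (rnorm U + 1)); first by rewrite divr_gt0.
rewrite -zx (le_trans (rnorm_apply _ _))// (le_trans (ler_wpM2l (rnorm_ge0 _) zn))//.
rewrite mulrDr addrC lerD2r.
by rewrite mulrCA -[leRHS]mulr1 ler_wpM2l ?(ltW e0)// ler_pdivrMr// mul1r lerDl.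
Qed.

Lemma image_norm_eq0 x : emb (k := k) (image_norm x) = 0 -> x = 0.
Proof.
move/eqP; rewrite emb_eq0 => /eqP x0; apply: val_inj; apply: rnorm0_eq0; apply/eqP.
by rewrite eq_le rnorm_ge0 andbT (le_trans (rnorm_image_val x))// x0 mulr0.
Qed.

HB.instance Definition _ := Lmodule_isNormed.Build K image_space
  image_normD image_normZ image_norm_eq0.

Lemma rnorm_image x : rnorm x = image_norm x.
Proof. exact: embK. Qed.

(** The infimum in the quotient norm need not be attained; a slack of [rnorm x] gives the factor 2,
    and for x = 0 the lift is 0. *)
Lemma image_lift_exists x : exists2 z, U z = val x & rnorm z <= 2 * rnorm x.
Proof.
have [->|x0] := eqVneq x 0; first by exists 0; rewrite ?opv0// !rnorm0 mulr0.
have nx : 0 < rnorm x by exact: rnorm_gt0.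
have [z zx zn] := image_norm_lift x nx; exists z => //.
by rewrite -rnorm_image in zn; rewrite mulr_natl mulr2n.
Qed.

(** Lifts of the terms form an absolutely convergent series in [Z], and [U] maps its sum to the
    limit. *)
Lemma image_complete (F : set_system image_space) : ProperFilter F -> cauchy F -> cvg F.
Proof.
apply: series_complete => u uP.
have /choice[z zP] : forall n, exists z, U z = val (u n) /\ rnorm z <= 2 * 2^-1 ^+ n.+1.
  move=> n; have [z zx zn] := image_lift_exists (u n); exists z; split=> //.
  by rewrite (le_trans zn)// ler_wpM2l.
have [//||l lP] := @banach_series R k Z z 2; first by move=> n; case: (zP n).
have Ul : U l \in image_pred by apply/image_predP; exists l.
exists (ImageSpace Ul), 2 => n; apply: le_trans (lP n).
have valE : val (\sum_(i < n) u i) = \sum_(i < n) U (z i).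
  by rewrite raddf_sum; apply: eq_bigr => i _; case: (zP i).
by rewrite rnorm_image; apply: image_norm_lb; rewrite opvB opv_sum raddfB /= valE.
Qed.

HB.instance Definition _ := Uniform_isComplete.Build image_space image_complete.

Lemma image_incl_subproof : image_val \in @bounded_linear R k image_space X.
Proof.
apply/bounded_linearP; split=> //; exists (rnorm U) => x.
by rewrite rnorm_image; exact: rnorm_image_val.
Qed.

Definition image_incl : operator image_space X := Operator image_incl_subproof.

Lemma image_incl_inj : injective image_incl.
Proof. exact: val_inj. Qed.

(** Turns an inclusion of ranges into a factorization. Linearity is inherited from [T], since [S y]
    is the point [T y] of the range; the preimages only bound the norm. *)
Lemma image_corestrict (Y : Banach R k) (T : operator Y X) (c : R) : 0 <= c ->
  (forall y : Y, exists2 z, U z = T y & rnorm z <= c * rnorm y) ->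
  exists2 S : operator Y image_space, T = comp_op image_incl S & rnorm S <= c.
Proof.
move=> c0 Tc.
have TP (y : Y) : T y \in image_pred by have [z zE _] := Tc y; apply/image_predP;
  exists z.
have [|y|S SE Sc] := @operator_exists R k Y image_space (fun y : Y => ImageSpace (TP
  y)) c _ c0.
- by move=> a u v; apply: val_inj; rewrite /= linearP.
- have [z zE zc] := Tc y; apply: le_trans zc.
  by rewrite rnorm_image; exact: image_norm_lb.
by exists S => //; apply: operatorP => y; rewrite /= SE.
Qed.

End ImageSpace.

Section DirectSum.
Variables (R : realType) (k : scalar_kind) (I : Type) (Z : I -> Banach R k).
Local Notation K := (scalars R k).

Record bounded_sum := BoundedSum {
  bsum_fun :> forall i, Z i;
  bsum_subproof : exists c : R, forall i, rnorm (bsum_fun i) <= c }.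

Implicit Types x y : bounded_sum.

Lemma bsumP x y : (forall i, x i = y i) -> x = y.
Proof.
move: x y => [x xP] [y yP] /= xy;
  have {}xy : x = y by apply: functional_extensionality_dep.
by case: _ / xy in yP *; congr BoundedSum; exact: Prop_irrelevance.
Qed.

HB.instance Definition _ := gen_eqMixin bounded_sum.
HB.instance Definition _ := gen_choiceMixin bounded_sum.

Lemma bsum0_subproof : exists c : R, forall i, rnorm (0 : Z i) <= c.
Proof. by exists 0 => i; rewrite rnorm0. Qed.
Definition bsum0 := BoundedSum bsum0_subproof.

Lemma bsumN_subproof x : exists c : R, forall i, rnorm (- x i) <= c.
Proof. by have [c xc] := bsum_subproof x; exists c => i; rewrite rnormN; exact: xc. Qed.
Definition bsumN x := BoundedSum (bsumN_subproof x).

Lemma bsumD_subproof x y : exists c : R, forall i, rnorm (x i + y i) <= c.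
Proof.
have [c xc] := bsum_subproof x; have [d yd] := bsum_subproof y.
by exists (c + d) => i; apply: le_trans (rnormD _ _) _; apply: lerD;
  [exact: xc|exact: yd].
Qed.
Definition bsumD x y := BoundedSum (bsumD_subproof x y).

Lemma bsumZ_subproof (a : K) x : exists c : R, forall i, rnorm (a *: x i) <= c.
Proof.
have [c xc] := bsum_subproof x.
by exists (re `|a| * c) => i; rewrite rnormZ ler_wpM2l ?re_norm_ge0 ?xc.
Qed.
Definition bsumZ (a : K) x := BoundedSum (bsumZ_subproof a x).

Fact bsumDA : associative bsumD.
Proof. by move=> x y z; apply: bsumP => i; rewrite /= addrA. Qed.
Fact bsumDC : commutative bsumD.
Proof. by move=> x y; apply: bsumP => i; rewrite /= addrC. Qed.
Fact bsum0D : left_id bsum0 bsumD.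
Proof. by move=> x; apply: bsumP => i; rewrite /= add0r. Qed.
Fact bsumND : left_inverse bsum0 bsumN bsumD.
Proof. by move=> x; apply: bsumP => i; rewrite /= addNr. Qed.

HB.instance Definition _ := GRing.isZmodule.Build bounded_sum bsumDA bsumDC bsum0D bsumND.

Fact bsumZA (a b : K) x : bsumZ a (bsumZ b x) = bsumZ (a * b) x.
Proof. by apply: bsumP => i; rewrite /= scalerA. Qed.
Fact bsum1Z : left_id 1 bsumZ.
Proof. by move=> x; apply: bsumP => i; rewrite /= scale1r. Qed.
Fact bsumZDr : right_distributive bsumZ +%R.
Proof. by move=> a x y; apply: bsumP => i; rewrite /= scalerDr. Qed.
Fact bsumZDl x : {morph bsumZ^~ x : a b / a + b}.
Proof. by move=> a b; apply: bsumP => i; rewrite /= scalerDl. Qed.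

HB.instance Definition _ := GRing.Zmodule_isLmodule.Build K bounded_sum bsumZA bsum1Z
  bsumZDr bsumZDl.

(* The point 0 only matters for empty I. *)
Definition bsum_norm x : R := sup (0 |` [set rnorm (x i) | i in [set: I]]).

Lemma bsum_norm_has_sup x : has_sup (0 |` [set rnorm (x i) | i in [set: I]]).
Proof.
split; first by exists 0; left.
have [c xc] := bsum_subproof x; exists `|c| => _ [->//|[i _ <-]].
exact: le_trans (xc i) (ler_norm _).
Qed.

Lemma bsum_norm_ge0 x : 0 <= bsum_norm x.
Proof. by apply: sup_upper_bound; [exact: bsum_norm_has_sup|left]. Qed.

Lemma bsum_norm_ub x i : rnorm (x i) <= bsum_norm x.
Proof. by apply: sup_upper_bound; [exact: bsum_norm_has_sup|right; exists i]. Qed.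

Lemma bsum_norm_le x (c : R) : 0 <= c -> (forall i, rnorm (x i) <= c) -> bsum_norm x <= c.
Proof.
move=> c0 xc; apply: ge_sup; first by have [] := bsum_norm_has_sup x.
by move=> _ [->//|[i _ <-]].
Qed.

Lemma bsum_normD x y : emb (k := k) (bsum_norm (x + y)) <= emb (bsum_norm x) + emb
  (bsum_norm y).
Proof.
rewrite -embD emb_le; apply: bsum_norm_le => [|i];
  first by rewrite addr_ge0 ?bsum_norm_ge0.
by rewrite (le_trans (rnormD _ _))// lerD ?bsum_norm_ub.
Qed.

Lemma bsum_normZ (a : K) x : emb (bsum_norm (a *: x)) = `|a| * emb (bsum_norm x).
Proof.
apply: norm_leZ_eq => [|{}a {}x].
  by apply/eqP; rewrite eq_le bsum_norm_ge0 andbT; apply: bsum_norm_le => // i;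
    rewrite rnorm0.
apply: bsum_norm_le => [|i]; first by rewrite mulr_ge0 ?bsum_norm_ge0 ?re_norm_ge0.
by rewrite rnormZ ler_wpM2l ?bsum_norm_ub ?re_norm_ge0.
Qed.

Lemma bsum_norm_eq0 x : emb (k := k) (bsum_norm x) = 0 -> x = 0.
Proof.
move/eqP; rewrite emb_eq0 => /eqP x0; apply: bsumP => i; apply: rnorm0_eq0; apply/eqP.
by rewrite eq_le rnorm_ge0 andbT (le_trans (bsum_norm_ub x i))// x0.
Qed.

HB.instance Definition _ := Lmodule_isNormed.Build K bounded_sum
  bsum_normD bsum_normZ bsum_norm_eq0.

Lemma rnorm_bsum x : rnorm x = bsum_norm x.
Proof. exact: embK. Qed.

Lemma bsum_sumE (J : Type) (s : seq J) (f : J -> bounded_sum) i :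
  (\sum_(j <- s) f j) i = \sum_(j <- s) f j i.
Proof. by elim/big_rec2 : _ => // j y S _ <-. Qed.

Lemma bsum_complete (F : set_system bounded_sum) : ProperFilter F -> cauchy F -> cvg F.
Proof.
apply: series_complete => u uP.
have uPi i n : rnorm (u n i) <= 1 * 2^-1 ^+ n.+1.
  by rewrite mul1r (le_trans _ (uP n))// rnorm_bsum bsum_norm_ub.
have lim i : exists l, forall n, rnorm (l - \sum_(j < n) u j i) <= 1 * 2^-1 ^+ n.
  exact: (banach_series ler01 (uPi i)).
pose l i := sval (cid (lim i)).
have lP i n : rnorm (l i - \sum_(j < n) u j i) <= 1 * 2^-1 ^+ n := svalP (cid (lim i)) n.
have lb : exists c : R, forall i, rnorm (l i) <= c.
  exists 1 => i; have := lP i 0%N; by rewrite big_ord0 subr0 expr0 mulr1.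
exists (BoundedSum lb), 1 => n; rewrite rnorm_bsum; apply: bsum_norm_le => [|i].
  by rewrite mul1r ltW// half_expn_gt0.
change (rnorm (l i - (\sum_(j < n) u j) i) <= 1 * 2^-1 ^+ n).
by rewrite bsum_sumE.
Qed.

HB.instance Definition _ := Uniform_isComplete.Build bounded_sum bsum_complete.

Lemma bsum_proj_subproof i : (fun x : bounded_sum => x i) \in @bounded_linear R k
  bounded_sum (Z i).
Proof.
apply/bounded_linearP; split=> //; exists 1 => x.
by rewrite mul1r rnorm_bsum bsum_norm_ub.
Qed.

Definition bsum_proj i : operator bounded_sum (Z i) := Operator (bsum_proj_subproof i).

Lemma rnorm_bsum_proj i : rnorm (bsum_proj i) <= 1.
Proof. by apply: rnorm_le_op => // x; rewrite mul1r rnorm_bsum bsum_norm_ub. Qed.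

End DirectSum.

(** * Elementary inequalities and series in a quasi-normed ideal *)

Section Ideals.
Variables (R : realType) (k : scalar_kind) (A : operator_ideal R k).
Local Notation K := (scalars R k).
Local Notation dual X := (operator X (scalar_space R k)).
Implicit Types X Y Z : Banach R k.

Lemma rnorm_id X : rnorm (id_op X) <= 1.
Proof. by apply: rnorm_le_op => // x; rewrite mul1r. Qed.

Lemma comp_op1l X Y (T : operator X Y) : comp_op (id_op Y) T = T.
Proof. exact: operatorP. Qed.

Lemma comp_op1r X Y (T : operator X Y) : comp_op T (id_op X) = T.
Proof. exact: operatorP. Qed.

Lemma ideal_compl X Y Z (U : operator Z Y) (T : operator X Z) :
  A X Z T -> A X Y (comp_op U T).
Proof. by move=> AT; rewrite -[T]comp_op1r; exact: ideal_comp. Qed.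

Lemma ideal_compr X Y Z (T : operator Z Y) (V : operator X Z) :
  A Z Y T -> A X Y (comp_op T V).
Proof. by move=> AT; rewrite -[comp_op _ _]comp_op1l; exact: ideal_comp. Qed.

Lemma qnorm_compl X Y Z (U : operator Z Y) (T : operator X Z) :
  A X Z T -> qnorm A (comp_op U T) <= rnorm U * qnorm A T.
Proof.
move=> AT; rewrite -[T in leLHS]comp_op1r (le_trans (qnorm_comp _ _ _ _ _ _ _ _ _ _
  AT))//.
by rewrite -[leRHS]mulr1 ler_wpM2l ?rnorm_id// mulr_ge0 ?rnorm_ge0 ?qnorm_ge0.
Qed.

Lemma qnorm_compr X Y Z (T : operator Z Y) (V : operator X Z) :
  A Z Y T -> qnorm A (comp_op T V) <= qnorm A T * rnorm V.
Proof.
move=> AT; rewrite -[comp_op _ _]comp_op1l (le_trans (qnorm_comp _ _ _ _ _ _ _ _ _ _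
  AT))//.
by rewrite ler_wpM2r ?rnorm_ge0// -[leRHS]mul1r ler_wpM2r ?rnorm_id ?qnorm_ge0.
Qed.

Lemma ideal_scale X Y (a : K) (T : operator X Y) : A X Y T -> A X Y (a *: T).
Proof.
move=> AT; rewrite (_ : a *: T = comp_op (a *: id_op Y) T); first exact: ideal_compl.
exact: operatorP.
Qed.

Lemma qnorm_scale X Y (a : K) (T : operator X Y) : A X Y T ->
  qnorm A (a *: T) <= re `|a| * qnorm A T.
Proof.
move=> AT; rewrite (_ : a *: T = comp_op (a *: id_op Y) T); last exact: operatorP.
rewrite (le_trans (qnorm_compl _ AT))// ler_wpM2r ?qnorm_ge0//.
by rewrite rnormZ -[leRHS]mulr1 ler_wpM2l ?re_norm_ge0 ?rnorm_id.
Qed.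

Lemma ideal_opp X Y (T : operator X Y) : A X Y T -> A X Y (- T).
Proof. by move=> AT; rewrite -scaleN1r; exact: ideal_scale. Qed.

Lemma qnorm_opp X Y (T : operator X Y) : A X Y T -> qnorm A (- T) <= qnorm A T.
Proof.
by move=> AT; rewrite -scaleN1r (le_trans (qnorm_scale _ AT))// normrN re_norm1 mul1r.
Qed.

Lemma ideal_sub X Y (S T : operator X Y) : A X Y S -> A X Y T -> A X Y (S - T).
Proof. by move=> AS AT; apply: ideal_add => //; exact: ideal_opp. Qed.

Lemma ideal0 X Y : A X Y 0.
Proof.
rewrite (_ : 0 = comp_op (0 : operator (scalar_space R k) Y)
  (comp_op (id_op (scalar_space R k)) (0 : dual X))); last exact: operatorP.
exact/ideal_comp/ideal_id.
Qed.

Lemma qnorm0 X Y : qnorm A (0 : operator X Y) = 0.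
Proof.
apply/eqP; rewrite eq_le qnorm_ge0 ?andbT; last exact: ideal0.
have := qnorm_scale 0 (ideal0 X Y); rewrite scale0r => /le_trans; apply.
by rewrite re_norm0 mul0r.
Qed.

Lemma ideal_sum X Y n (T : 'I_n -> operator X Y) : (forall i, A X Y (T i)) -> A X Y
  (\sum_i T i).
Proof.
move=> AT; elim/big_ind : _ => //; first exact: ideal0.
by move=> S S'; exact: ideal_add.
Qed.

Lemma rank1_factor X Y (g : dual X) (y : Y) :
  rank1 g y = comp_op (rank1 (id_op (scalar_space R k)) y) (comp_op (id_op
    (scalar_space R k)) g).
Proof. exact: operatorP. Qed.

Lemma ideal_rank1 X Y (g : dual X) (y : Y) : A X Y (rank1 g y).
Proof. by rewrite rank1_factor; exact/ideal_comp/ideal_id. Qed.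

Lemma ideal_finite_rank X Y (T : operator X Y) : finite_rank X Y T -> A X Y T.
Proof.
move=> /finite_rank_rep[n [y [f [_ ->]]]]; apply: ideal_sum => i; exact: ideal_rank1.
Qed.

(** For a functional [f] and a vector [x], the number [f (T x)] times the identity of the scalars is
    a composition through [T], and the quasi-norm of that identity is normalized to 1. *)
Lemma rnorm_le_qnorm X Y (T : operator X Y) : A X Y T -> rnorm T <= qnorm A T.
Proof.
move=> AT; apply: rnorm_le_op => [|x]; first exact: qnorm_ge0.
apply: rnorm_le_dual => f f1.
have E : (f (T x) : K) *: id_op (scalar_space R k) =
    comp_op f (comp_op T (rank1 (id_op (scalar_space R k)) x)).
  apply: operatorP => a /=; rewrite !opvZ; exact: mulrC.
have [->|fx0] := eqVneq (f (T x) : K) 0.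
  by rewrite rnorm0 mulr_ge0 ?rnorm_ge0 ?qnorm_ge0.
have : qnorm A ((f (T x) : K) *: id_op (scalar_space R k)) <= qnorm A T * rnorm x.
  rewrite E (le_trans (qnorm_comp _ _ _ _ _ _ _ _ _ _ AT))//.
  rewrite -mulrA -[leRHS]mul1r ler_pM ?mulr_ge0 ?rnorm_ge0 ?qnorm_ge0// ler_wpM2l
    ?qnorm_ge0//.
  rewrite (le_trans (rank1_norm _ _))// -[leRHS]mul1r ler_wpM2r ?rnorm_ge0//.
  exact: rnorm_id.
apply: le_trans.
have A1 : A _ _ ((f (T x) : K) *: id_op (scalar_space R k)) by exact/ideal_scale/ideal_id.
have := qnorm_scale (f (T x) : K)^-1 A1.
rewrite scalerA mulVf// scale1r qnorm_id => h.
have n0 : 0 < rnorm (f (T x)) by exact: rnorm_gt0.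
rewrite -(@ler_pM2l _ (rnorm (f (T x)))^-1) ?invr_gt0// mulVf ?gt_eqF//.
apply: le_trans h _; rewrite ler_wpM2r ?qnorm_ge0//.
rewrite -(@ler_pM2r _ (rnorm (f (T x))))// mulVf ?gt_eqF// rnorm_scalar -re_normM mulVf//.
by rewrite re_norm1.
Qed.

Definition quasi_constant (kappa : R) := 1 <= kappa /\
  forall X Y (S T : operator X Y), A X Y S -> A X Y T ->
    qnorm A (S + T) <= kappa * (qnorm A S + qnorm A T).

Lemma quasi_constant_exists : exists kappa, quasi_constant kappa.
Proof. by have [kappa k1 kP] := qnorm_add R k A; exists kappa. Qed.

Lemma qnorm_sub kappa X Y (S T : operator X Y) : quasi_constant kappa ->
  A X Y S -> A X Y T -> qnorm A (S - T) <= kappa * (qnorm A S + qnorm A T).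
Proof.
move=> [k1 kP] AS AT; rewrite (le_trans (kP _ _ _ _ AS (ideal_opp AT)))//.
by rewrite ler_wpM2l ?(le_trans ler01 k1)// lerD2l qnorm_opp.
Qed.

(** The tail from n is [u n] plus the tail from n+1; adding them costs kappa, and kappa (q + q) is
    absorbed by one factor (2 kappa)^-1. The limit is identified in the operator norm, which the
    quasi-norm dominates. *)
Lemma ideal_series kappa X Y (u : nat -> operator X Y) (C : R) :
  quasi_constant kappa -> 0 <= C -> (forall n, A X Y (u n)) ->
  (forall n, qnorm A (u n) <= C * (2 * kappa)^-1 ^+ n.+1) ->
  exists2 S, A X Y S & forall n, rnorm (S - \sum_(i < n) u i) <= C * 2^-1 ^+ n.
Proof.
move=> [k1 kP] C0 Au uC.
have k0 : 0 < kappa := lt_le_trans ltr01 k1.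
have AT n : A X Y (\sum_(i < n) u i) by apply: ideal_sum.
have tail d n : qnorm A (\sum_(i < n + d) u i - \sum_(i < n) u i) <= C * (2 * kappa)^-1
  ^+ n.
  elim: d n => [|d ih] n.
    by rewrite addn0 subrr qnorm0 mulr_ge0// exprn_ge0// invr_ge0 mulr_ge0 ?(ltW k0).
  have -> : \sum_(i < n + d.+1) u i - \sum_(i < n) u i =
      u n + (\sum_(i < n.+1 + d) u i - \sum_(i < n.+1) u i).
    by rewrite addnS -addSn [X in _ + (_ - X)]big_ord_recr /= opprD addrCA [- _ -
      _]addrC addNKr.
  rewrite (le_trans (kP _ _ _ _ (Au n) (ideal_sub (AT _) (AT _))))//.
  rewrite (le_trans (ler_wpM2l (ltW k0) (lerD (uC n) (ih n.+1))))//.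
  have -> : kappa * (C * (2 * kappa)^-1 ^+ n.+1 + C * (2 * kappa)^-1 ^+ n.+1) =
      C * (2 * kappa)^-1 ^+ n * ((kappa + kappa) * (2 * kappa)^-1).
    by rewrite exprS; ring.
  have -> : kappa + kappa = 2 * kappa by rewrite mulr_natl mulr2n.
  by rewrite divff ?mulr1// mulf_neq0// gt_eqF.
have kn n : (2 * kappa)^-1 ^+ n <= (2^-1 : R) ^+ n.
  rewrite lerXn2r ?nnegrE ?invr_ge0 ?mulr_ge0 ?(ltW k0)//.
  by rewrite lef_pV2 ?posrE ?mulr_gt0// -[leLHS]mulr1 ler_wpM2l.
have tail' m n : (n <= m)%N -> qnorm A (\sum_(i < m) u i - \sum_(i < n) u i) <= C *
  2^-1 ^+ n.
  by move=> /subnKC <-; rewrite (le_trans (tail _ _))// ler_wpM2l.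
have small (e : R) : 0 < e -> exists N, forall n, (N <= n)%N -> C * 2^-1 ^+ n < e.
  move=> e0; have [|N NP] := @half_expn_small R (e / (C + 1));
    first by rewrite divr_gt0// ltr_wpDl.
  exists N => n /NP h; apply: le_lt_trans (ler_wpM2l C0 h) _.
  by rewrite mulrCA -[ltRHS]mulr1 ltr_pM2l// ltr_pdivrMr ?ltr_wpDl// mul1r ltrDl.
have [//|e e0|S AS SP] := @ideal_complete R k A X Y (fun n => \sum_(i < n) u i).
  have [|N NP] := small (e / kappa); first by rewrite divr_gt0.
  exists N => m n Nm Nn; have [mn|nm] := leqP m n.
    have h := ideal_sub (AT n) (AT m).
    rewrite -opprB (le_lt_trans (qnorm_opp h))// (le_lt_trans (tail' _ _ mn))//.
    by rewrite (lt_le_trans (NP m Nm))// ler_pdivrMr// ler_peMr// ltW.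
  rewrite (le_lt_trans (tail' _ _ (ltnW nm)))//.
  by rewrite (lt_le_trans (NP n Nn))// ler_pdivrMr// ler_peMr// ltW.
exists S => // n; apply/ler_addgt0Pl => e /SP[N NP].
rewrite -(subrK (\sum_(i < maxn N n) u i) S) -addrA (le_trans (rnormD _ _))// lerD//.
  rewrite rnormB (le_trans (rnorm_le_qnorm (ideal_sub (AT _) AS)))// ltW// NP//.
  exact: leq_maxl.
rewrite (le_trans (rnorm_le_qnorm (ideal_sub (AT _) (AT _))))// tail'//.
exact: leq_maxr.
Qed.

End Ideals.

(** * Cancelling quotient maps in a surjective ideal *)

Section SurjectiveIdeals.
Variables (R : realType) (k : scalar_kind) (A : operator_ideal R k).
Hypothesis A_sur : surjective_ideal A.
Local Notation K := (scalars R k).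
Implicit Types X Y Z W : Banach R k.

(** Preimages of the points of the unit ball define [L] on l_1 with [sur_quotient W] = [pi] o [L].
    So [T] o [sur_quotient W] is in A, and surjectivity of A cancels the quotient map. *)
Lemma surjective_lift X Z W (T : operator W X) (pi : operator Z W) (c : R) : 0 <= c ->
  (forall w, rnorm w <= 1 -> exists2 z, pi z = w & rnorm z <= c) ->
  A Z X (comp_op T pi) -> A W X T /\ qnorm A T <= qnorm A (comp_op T pi) * c.
Proof.
move=> c0 pic ATpi.
have /choice[z zP] : forall w : unit_ball W, exists z, pi z = val w /\ rnorm z <= c.
  by move=> w; have [|z zw zc] := pic (val w); [rewrite -rnorm_le1;
    exact: valP w|exists z].
have [|L LE Lc] := @ell1_op_exists R k (unit_ball W) Z z c c0; first by move=> w;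
  case: (zP w).
have qE : sur_quotient W = comp_op pi L.
  apply: ell1_op_ext => w; rewrite sur_quotient_delta1 /= LE.
  by case: (zP w).
have Tq : comp_op T (sur_quotient W) = comp_op (comp_op T pi) L by rewrite qE comp_opA.
have AT : A W X T.
  rewrite -(A_sur.1 W X); change (A _ _ (comp_op T (sur_quotient W))).
  by rewrite Tq; exact: ideal_compr.
split=> //; rewrite -(A_sur.2 _ _ _ AT) Tq (le_trans (qnorm_compr _ ATpi))//.
by rewrite ler_wpM2l ?qnorm_ge0.
Qed.

Lemma image_factor Z X (U : operator Z X) :
  exists2 S : operator Z (image_space U), U = comp_op (image_incl U) S & rnorm S <= 1.
Proof. by apply: image_corestrict => // z; exists z; rewrite ?mul1r. Qed.

Lemma ideal_image_incl Z X (U : operator Z X) : A Z X U ->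
  A _ X (image_incl U) /\ qnorm A (image_incl U) <= qnorm A U * 2.
Proof.
move=> AU; have [S US S1] := image_factor U.
have lift w : rnorm w <= 1 -> exists2 z, S z = w & rnorm z <= 2.
  move=> w1; have [z zw zn] := image_lift_exists w; exists z.
    by apply: image_incl_inj; rewrite -[RHS]zw [in RHS]US.
  by rewrite (le_trans zn)// ler_piMr.
by have := @surjective_lift X Z _ (image_incl U) S 2 (ler0n R 2) lift; rewrite -US; apply.
Qed.

End SurjectiveIdeals.

(** * The dual of an operator ideal is an operator ideal *)

Section DualIdeal.
Variables (R : realType) (k : scalar_kind) (A : operator_ideal R k).
Local Notation K := (scalars R k).
Local Notation dual X := (operator X (scalar_space R k)).
Implicit Types X Y Z W : Banach R k.

Lemma rnorm_le_adjoint X Y (T : operator X Y) : rnorm T <= rnorm (adjoint T).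
Proof.
apply: rnorm_le_op => [|x]; first exact: rnorm_ge0.
apply: rnorm_le_dual => f f1;
  change (rnorm ((adjoint T f) x) <= rnorm (adjoint T) * rnorm x).
rewrite (le_trans (rnorm_apply _ _))// ler_wpM2r ?rnorm_ge0//.
exact: rnorm_apply_ball.
Qed.

(** The scalar field is isometric to its dual, by multiples of the identity and by evaluation at 1.
    This carries the normalization at the identity over to the dual ideal. *)
Lemma adjoint_id_factor : exists (a : operator (scalar_space R k) (dual (scalar_space R
  k)))
    (b : operator (dual (scalar_space R k)) (scalar_space R k)),
  [/\ rnorm a <= 1, rnorm b <= 1,
     adjoint (id_op (scalar_space R k)) = comp_op a (comp_op (id_op (scalar_space R k))
       b) &
     id_op (scalar_space R k) = comp_op b (comp_op (adjoint (id_op (scalar_space R k)))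
       a)].
Proof.
exists (rank1 (id_op (scalar_space R k)) (id_op (scalar_space R k))), (eval_at (1 :
  scalar_space R k)).
have r1 : rnorm (1 : scalar_space R k) <= 1 by rewrite rnorm_scalar re_norm1.
split.
- rewrite (le_trans (rank1_norm _ _))// -[leRHS]mulr1 ler_pM ?rnorm_ge0//;
  exact: rnorm_id.
- by apply: rnorm_le_op => // phi;
  rewrite mulrC (le_trans (rnorm_apply phi 1))// ler_wpM2l ?rnorm_ge0.
- apply: operatorP => phi; apply: operatorP => s /=.
  by rewrite -[s in LHS]mulr1 -[s * 1]/(s *: (1 : scalar_space R k)) opvZ; exact: mulrC.
- by apply: operatorP => s /=; rewrite -[LHS]mulr1.
Qed.

Let dual_id : dual_class A (scalar_space R k) (scalar_space R k) (id_op (scalar_space R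
  k)).
Proof.
have [a [b [_ _ E _]]] := adjoint_id_factor.
by rewrite /dual_class /= E; exact/ideal_comp/ideal_id.
Qed.

Let dual_add X Y (S T : operator X Y) :
  dual_class A X Y S -> dual_class A X Y T -> dual_class A X Y (S + T).
Proof. by rewrite /dual_class /= adjointD; exact: ideal_add. Qed.

Lemma adjoint_comp3 (X0 X Y Y0 : Banach R k) (U : operator Y Y0) (T : operator X Y) (V
  : operator X0 X) :
  adjoint (comp_op U (comp_op T V)) = comp_op (adjoint V) (comp_op (adjoint T) (adjoint
    U)).
Proof. by rewrite !adjoint_comp comp_opA. Qed.

Let dual_comp (X0 X Y Y0 : Banach R k) (U : operator Y Y0) (T : operator X Y) (V :
  operator X0 X) :
  dual_class A X Y T -> dual_class A X0 Y0 (comp_op U (comp_op T V)).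
Proof. by rewrite /dual_class /= adjoint_comp3; exact: ideal_comp. Qed.

Let dual_qnorm X Y (T : operator X Y) : R := qnorm A (adjoint T).

Let dual_qnorm_ge0 X Y (T : operator X Y) : dual_class A X Y T -> 0 <= dual_qnorm T.
Proof. exact: qnorm_ge0. Qed.

Let dual_qnorm_id : dual_qnorm (id_op (scalar_space R k)) = 1.
Proof.
have [a [b [a1 b1 E1 E2]]] := adjoint_id_factor.
have Aid := ideal_id R k A.
apply/eqP; rewrite eq_le /dual_qnorm; apply/andP; split.
  rewrite E1 (le_trans (qnorm_comp _ _ _ _ _ _ _ _ _ _ Aid))// qnorm_id mulr1.
  by rewrite -[leRHS]mulr1 ler_pM ?rnorm_ge0.
rewrite -(qnorm_id R k A) [in leLHS]E2 (le_trans (qnorm_comp _ _ _ _ _ _ _ _ _ _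
  dual_id))//.
by rewrite -mulrA mulrCA -[leRHS]mulr1 ler_wpM2l ?qnorm_ge0// -[leRHS]mulr1 ler_pM
  ?rnorm_ge0.
Qed.

Let dual_qnorm_add : exists2 kappa : R, 1 <= kappa &
  forall X Y (S T : operator X Y), dual_class A X Y S -> dual_class A X Y T ->
    dual_qnorm (S + T) <= kappa * (dual_qnorm S + dual_qnorm T).
Proof.
have [kappa k1 kP] := qnorm_add R k A; exists kappa => // X Y S T AS AT.
by rewrite /dual_qnorm adjointD; exact: kP.
Qed.

Let dual_qnorm_comp (X0 X Y Y0 : Banach R k) (U : operator Y Y0) (T : operator X Y) (V
  : operator X0 X) :
  dual_class A X Y T ->
  dual_qnorm (comp_op U (comp_op T V)) <= rnorm U * dual_qnorm T * rnorm V.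
Proof.
move=> AT; rewrite /dual_qnorm adjoint_comp3 (le_trans (qnorm_comp _ _ _ _ _ _ _ _ _ _
  AT))//.
rewrite mulrAC [leRHS]mulrAC ler_wpM2r ?qnorm_ge0// [leRHS]mulrC.
by rewrite ler_pM ?rnorm_ge0 ?rnorm_adjoint.
Qed.

(** The limit in A of the adjoints has to be an adjoint itself: since the quasi-norm dominates the
    operator norm, the operators converge in norm, and the adjoint of their limit is that limit. *)
Let dual_complete X Y (T : nat -> operator X Y) :
  (forall n, dual_class A X Y (T n)) ->
  (forall e : R, 0 < e ->
     exists N, forall m n, (N <= m)%N -> (N <= n)%N -> dual_qnorm (T m - T n) < e) ->
  exists2 S : operator X Y, dual_class A X Y S &
    forall e : R, 0 < e -> exists N, forall n, (N <= n)%N -> dual_qnorm (T n - S) < e.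
Proof.
move=> AT Tc.
have [//|e /Tc[N NP]|S' AS' SP] := @ideal_complete R k A (dual Y) (dual X) (fun n =>
  adjoint (T n)).
  by exists N => m n Nm Nn; rewrite -adjointB; exact: NP.
have [e /Tc[N NP]|S lS] := @cauchy_seq_limit R k (operator X Y) T.
  exists N => n Nn; rewrite (le_trans (rnorm_le_adjoint _))//.
  rewrite adjointB (le_trans (rnorm_le_qnorm (ideal_sub (AT _) (AT _))))//.
  by rewrite -adjointB ltW// NP.
have SE : adjoint S = S'.
  apply/eqP; rewrite -subr_eq0; apply/eqP/rnorm0_eq0/eqP.
  rewrite eq_le rnorm_ge0 andbT; apply/ler_addgt0Pl => e e0; rewrite addr0.
  have e2 : 0 < e / 2 by rewrite divr_gt0.
  have [N NP] := lS _ e2; have [M MP] := SP _ e2.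
  rewrite -(subrK (adjoint (T (maxn N M))) (adjoint S)) -addrA (le_trans (rnormD _ _))//.
  rewrite [leRHS]splitr lerD//.
    by rewrite -adjointB (le_trans (rnorm_adjoint _))// NP// leq_maxl.
  rewrite (le_trans (rnorm_le_qnorm (ideal_sub (AT _) AS')))// ltW// MP//.
  exact: leq_maxr.
exists S; first by rewrite /dual_class /= SE.
by move=> e /SP[N NP]; exists N => n Nn; rewrite /dual_qnorm adjointB SE; exact: NP.
Qed.

Definition dual_ideal : operator_ideal R k := @OperatorIdeal R k (dual_class A) dual_qnorm
  dual_id dual_add dual_comp dual_qnorm_ge0 dual_qnorm_id dual_qnorm_add dual_qnorm_comp
  dual_complete.

End DualIdeal.

(** * Assembling finite rank factorizations into a member of A^min *)

Section Assembly.
Variables (R : realType) (k : scalar_kind).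
Local Notation K := (scalars R k).
Local Notation dual X := (operator X (scalar_space R k)).
Implicit Types X Y Z W : Banach R k.

Definition bsum_at (Z : nat -> Banach R k) i (z : Z i) : forall j, Z j :=
  @eqtype.dfwith _ (fun j => Z j : Type) (fun j => 0) i z.

Lemma bsum_in_subproof (Z : nat -> Banach R k) i (z : Z i) :
  exists c : R, forall j, rnorm (bsum_at z j) <= c.
Proof.
exists (rnorm z) => j; have [<-|ij] := eqVneq i j; first by rewrite /bsum_at dfwith_in.
by rewrite /bsum_at dfwith_out// rnorm0 rnorm_ge0.
Qed.

Lemma bsum_inj_subproof (Z : nat -> Banach R k) i :
  (fun z : Z i => BoundedSum (bsum_in_subproof z)) \in @bounded_linear R k (Z i)
    (bounded_sum Z).
Proof.
apply/bounded_linearP; split=> [a u v|].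
  apply: bsumP => j /=; have [<-|ij] := eqVneq i j; first by rewrite /bsum_at !dfwith_in.
  by rewrite /bsum_at !dfwith_out// scaler0 addr0.
exists 1 => z; rewrite mul1r rnorm_bsum; apply: bsum_norm_le => [|j];
  first exact: rnorm_ge0.
rewrite /=; have [<-|ij] := eqVneq i j; first by rewrite /bsum_at dfwith_in.
by rewrite /bsum_at dfwith_out// rnorm0 rnorm_ge0.
Qed.

Definition bsum_inj (Z : nat -> Banach R k) i : operator (Z i) (bounded_sum Z) :=
  Operator (@bsum_inj_subproof Z i).

Lemma bsum_injE (Z : nat -> Banach R k) i (z : Z i) : bsum_inj Z i z i = z.
Proof. by rewrite /= /bsum_at dfwith_in. Qed.

Lemma bsum_inj_neq (Z : nat -> Banach R k) i j (z : Z i) : i != j -> bsum_inj Z i z j = 0.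
Proof. by move=> ij; rewrite /= /bsum_at dfwith_out. Qed.

Lemma rnorm_bsum_inj (Z : nat -> Banach R k) i : rnorm (bsum_inj Z i) <= 1.
Proof.
apply: rnorm_le_op => // z; rewrite mul1r rnorm_bsum.
apply: bsum_norm_le => [|j]; first exact: rnorm_ge0.
have [<-|ij] := eqVneq i j; first by rewrite bsum_injE.
by rewrite bsum_inj_neq// rnorm0 rnorm_ge0.
Qed.

Lemma le0_half_expn (r C : R) (N : nat) :
  (forall n, (N <= n)%N -> r <= C * 2^-1 ^+ n) -> r <= 0.
Proof.
move=> rC; apply/ler_addgt0Pl => e e0; rewrite addr0.
have [|M MP] := @half_expn_small R (e / (`|C| + 1)); first by rewrite divr_gt0// ltr_wpDl.
rewrite (le_trans (rC _ (leq_maxl N M)))//.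
apply: (@le_trans _ _ (`|C| * (e / (`|C| + 1)))).
  apply: le_trans (ler_wpM2l (normr_ge0 C) (MP _ (leq_maxr N M))).
  by rewrite ler_wpM2r ?ler_norm// ltW// half_expn_gt0.
by rewrite mulrCA -[leRHS]mulr1 ler_wpM2l ?(ltW e0)// ler_pdivrMr ?ltr_wpDl// mul1r lerDl.
Qed.

(** The i-th coordinate is touched by the i-th term alone, so it is already final in every partial
    sum with more than i terms. *)
Lemma bsum_series_proj (Z : nat -> Banach R k) W (E : forall i, operator W (Z i))
    (S : operator W (bounded_sum Z)) (C : R) :
  (forall n, rnorm (S - \sum_(i < n) comp_op (bsum_inj Z i) (E i)) <= C * 2^-1 ^+ n) ->
  forall i w, S w i = E i w.
Proof.
move=> SC i w; apply/eqP; rewrite -subr_eq0; apply/eqP/rnorm0_eq0/eqP.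
rewrite eq_le rnorm_ge0 andbT.
apply: (@le0_half_expn _ (C * rnorm w) i.+1) => n ni.
rewrite mulrAC; apply: le_trans (ler_wpM2r (rnorm_ge0 w) (SC n)).
apply: le_trans (rnorm_apply _ _).
have -> : S w i - E i w = (S - \sum_(j < n) comp_op (bsum_inj Z j) (E j)) w i.
  change (S w i - E i w = S w i - (\sum_(j < n) comp_op (bsum_inj Z j) (E j)) w i).
  rewrite op_sumE bsum_sumE (bigD1 (Ordinal ni))//= big1.
    by rewrite addr0 /bsum_at dfwith_in.
  by move=> j ji; rewrite /bsum_at dfwith_out.
by rewrite rnorm_bsum bsum_norm_ub.
Qed.

Lemma finite_rank_bigsum X Y n (T : 'I_n -> operator X Y) :
  (forall i, finite_rank X Y (T i)) -> finite_rank X Y (\sum_i T i).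
Proof.
move=> TF; elim/big_ind : _ => //; first exact: finite_rank0.
by move=> S S'; exact: finite_rankD.
Qed.

Lemma finite_rank_series X Y (T : nat -> operator X Y) :
  (forall i, finite_rank X Y (T i)) -> (forall i, rnorm (T i) <= 2^-1 ^+ i.+1) ->
  exists2 S, approximable X Y S & forall n, rnorm (S - \sum_(i < n) T i) <= 1 * 2^-1 ^+ n.
Proof.
move=> TF T2; have [//|S SP] := @banach_series R k (operator X Y) T 1 ler01.
  by move=> n; rewrite mul1r.
exists S => //; apply/approximableP => e /(@half_expn_small R)[N NP].
exists (\sum_(i < N) T i); first exact: finite_rank_bigsum.
by rewrite (le_trans (SP N))// mul1r NP.
Qed.

(** Bundles the varying intermediate spaces with their operators, so that a whole sequence of
    factorizations can be chosen at once. *)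
Record factorization X Y := Factorization {
  fact_dom : Banach R k; fact_cod : Banach R k;
  fact_right : operator X fact_dom; fact_mid : operator fact_dom fact_cod;
  fact_left : operator fact_cod Y }.

(** The form of accessibility that [min_class_of_closure] consumes, shared by A and its dual ideal;
    the constant 4 only has to be the same for all [F]. *)
Definition finite_rank_factors (B : operator_ideal R k) := forall X Y (F : operator X Y),
  finite_rank X Y F -> exists f : factorization X Y,
  [/\ finite_rank _ _ (fact_right f) /\ rnorm (fact_right f) <= 1,
      finite_rank _ _ (fact_left f) /\ rnorm (fact_left f) <= 1,
      B _ _ (fact_mid f), qnorm B (fact_mid f) <= 4 * qnorm B F
    & F = comp_op (fact_left f) (comp_op (fact_mid f) (fact_right f))].

Lemma min_class_of_closure (B : operator_ideal R k) X Y (T : operator X Y) :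
  finite_rank_factors B -> B X Y T ->
  (forall e : R, 0 < e -> exists2 F, finite_rank X Y F & qnorm B (T - F) <= e) ->
  min_class B X Y T.
Proof.
move=> Bacc BT TF; have [kappa kP] := quasi_constant_exists B.
have k0 : 0 < kappa := lt_le_trans ltr01 kP.1.
(* Chosen so that 4 [th] = (2 kappa)^-1, the rate demanded by [ideal_series]; the 4 is the growth of
   the scalars [t n] below. *)
pose th : R := (8 * kappa)^-1.
have th0 : 0 < th by rewrite invr_gt0 mulr_gt0.
(* Comparing consecutive approximants loses a factor kappa; dividing by 2 kappa in advance leaves
   [th ^+ n.+2] for the increment [G n.+1]. *)
have eta0 n : 0 < th ^+ n.+2 / (2 * kappa) by rewrite divr_gt0 ?exprn_gt0 ?mulr_gt0.
have /choice[F FP] : forall n : nat, exists F, finite_rank X Y F /\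
    qnorm B (T - F) <= th ^+ n.+2 / (2 * kappa).
  by move=> n; have [F F1 F2] := TF _ (eta0 n); exists F.
have BF n : B X Y (F n) by apply: ideal_finite_rank; case: (FP n).
pose G n := if n is m.+1 then F m.+1 - F m else F 0%N.
have GF n : finite_rank X Y (G n).
  case: n => [|n]; first by case: (FP 0%N).
  by apply: finite_rankD; [|apply: finite_rankN]; case: (FP n.+1); case: (FP n).
have BG n : B X Y (G n) by exact: ideal_finite_rank.
have sumG n : \sum_(i < n.+1) G i = F n.
  elim: n => [|n ih]; first by rewrite big_ord1.
  by rewrite big_ord_recr /= ih addrC subrK.
(* The first increment is not small; [C0] absorbs it into a single geometric bound. *)
pose C0 := 1 + qnorm B (G 0%N) / th.
have C00 : 0 <= C0 by rewrite addr_ge0// divr_ge0 ?qnorm_ge0// ltW.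
have th1 : th <= 1.
  rewrite invf_le1 ?mulr_gt0// (le_trans kP.1)// ler_peMl ?(ltW k0)//.
  by rewrite ler1n.
have qG n : qnorm B (G n) <= C0 * th ^+ n.+1.
  case: n => [|n].
    by rewrite /C0 mulrDl mul1r expr1 divfK ?gt_eqF// lerDr ltW.
  have -> : G n.+1 = (T - F n) - (T - F n.+1) by rewrite /= opprB [RHS]addrC subrKA.
  rewrite (le_trans (qnorm_sub kP (ideal_sub BT (BF n)) (ideal_sub BT (BF n.+1))))//.
  have [_ h1] := FP n; have [_ h2] := FP n.+1.
  rewrite (le_trans (ler_wpM2l (ltW k0) (lerD h1 h2)))//.
  apply: (@le_trans _ _ (th ^+ n.+2)); last first.
    by rewrite ler_peMl ?exprn_ge0 ?(ltW th0)// /C0 lerDl divr_ge0 ?qnorm_ge0// ltW.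
  have kE c : kappa * (c / (2 * kappa)) = c / 2 by field; rewrite gt_eqF.
  rewrite -mulrDl kE ler_pdivrMr//.
  by rewrite mulr_natr mulr2n lerD2l exprS ler_piMl ?exprn_ge0 ?(ltW th0).
have acc n := Bacc X Y (G n) (GF n); have [f fP] := choice acc.
pose M n := fact_dom (f n); pose N n := fact_cod (f n).
(* The outer factors are shrunk by [s n] to make their series converge in norm, and [t n] in the
   middle undoes both shrinkings. *)
pose s n : K := emb (2^-1 ^+ n.+1 : R); pose t n : K := emb (4 ^+ n.+1 : R).
have sE : forall i, re `|s i| = 2^-1 ^+ i.+1.
  by move=> i; rewrite re_norm_emb gtr0_norm// half_expn_gt0.
have tE : forall i, re `|t i| = 4 ^+ i.+1.
  by move=> i; rewrite re_norm_emb ger0_norm// exprn_ge0.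
have sts n : s n * (t n * s n) = 1.
  rewrite -!embM -(@emb1 R k); congr emb.
  rewrite mulrA mulrAC -!exprMn (_ : 2^-1 * 2^-1 * 4 = 1) ?expr1n//.
  by rewrite -invfM -natrM mulVf.
have [||SD aD SDP] := @finite_rank_series X (bounded_sum M)
    (fun n => comp_op (bsum_inj M n) (s n *: fact_right (f n))).
- by move=> n; apply/finite_rank_compl/finite_rankZ; case: (fP n) => -[].
- move=> n; rewrite (le_trans (rnorm_comp _ _))// rnormZ sE -[leRHS]mul1r.
  rewrite ler_pM ?mulr_ge0 ?rnorm_ge0 ?rnorm_bsum_inj// ?(ltW (half_expn_gt0 _ _))//.
  by rewrite -[leRHS]mulr1 ler_wpM2l ?(ltW (half_expn_gt0 _ _))//; case: (fP n) => -[].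
have [||SU aU SUP] := @finite_rank_series (bounded_sum N) Y
    (fun n => comp_op (s n *: fact_left (f n)) (bsum_proj N n)).
- by move=> n; apply/finite_rank_compr/finite_rankZ; case: (fP n) => _ [].
- move=> n; rewrite (le_trans (rnorm_comp _ _))// rnormZ sE -[leRHS]mulr1.
  rewrite ler_pM ?mulr_ge0 ?rnorm_ge0 ?rnorm_bsum_proj// ?(ltW (half_expn_gt0 _ _))//.
  by rewrite -[leRHS]mulr1 ler_wpM2l ?(ltW (half_expn_gt0 _ _))//; case: (fP n) => _ [].
pose mid n := comp_op (t n *: fact_mid (f n)) (bsum_proj M n).
have Bt n : B _ _ (t n *: fact_mid (f n)) by apply: ideal_scale; case: (fP n).
have Bmid n : B _ _ (mid n) by exact: ideal_compr.
have [||n|SC BSC SCP] := @ideal_series R k B kappa (bounded_sum M) (bounded_sum N)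
    (fun n => comp_op (bsum_inj N n) (mid n)) (4 * C0) kP.
- by rewrite mulr_ge0.
- by move=> n; apply: ideal_compl; exact: Bmid.
- rewrite (le_trans (qnorm_compl _ (Bmid n)))// -[leRHS]mul1r.
  rewrite ler_pM ?rnorm_ge0 ?qnorm_ge0 ?rnorm_bsum_inj//.
  rewrite (le_trans (qnorm_compr _ (Bt n)))// -[leRHS]mulr1.
  rewrite ler_pM ?rnorm_ge0 ?qnorm_ge0 ?rnorm_bsum_proj//.
  have [_ _ Bf qf _] := fP n.
  rewrite (le_trans (qnorm_scale _ Bf))// tE.
  rewrite (le_trans (ler_wpM2l _ (le_trans qf (ler_wpM2l _ (qG n)))))// ?exprn_ge0//.
  have -> : (2 * kappa)^-1 = 4 * th by rewrite /th; field; rewrite gt_eqF.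
  by rewrite exprMn le_eqVlt; apply/orP; left; apply/eqP; ring.
have SCE := bsum_series_proj (E := mid) SCP.
have SDE := @bsum_series_proj M X (fun n => s n *: fact_right (f n)) SD 1 SDP.
exists (bounded_sum N), SU, (comp_op SC SD); split=> //;
  first by exists (bounded_sum M), SC, SD.
(* Through the n-th coordinate the assembled operators act as the n-th increment, so their
   composition telescopes to the limit of the [F n]. *)
have GE n x : (s n *: fact_left (f n)) (SC (SD x) n) = G n x.
  have [_ _ _ _ GE] := fP n.
  have -> : SC (SD x) n = t n *: fact_mid (f n) (s n *: fact_right (f n) x).
    by rewrite SCE; change (t n *: fact_mid (f n) (SD x n) = t n *: fact_mid (f n) (s n
      *: fact_right (f n) x)); rewrite SDE.
  by rewrite opZE !opvZ !scalerA sts scale1r [in RHS]GE.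
(* The two operators are compared in the operator norm, for which the decay 2^-n suffices. *)
have th2 n : th ^+ n.+2 / (2 * kappa) <= 2^-1 ^+ n.
  have th12 : th <= 2^-1.
    rewrite lef_pV2 ?posrE ?mulr_gt0// (le_trans (_ : 2 <= 8))// ?ler_nat// ler_peMr//.
    by case: kP.
  rewrite (@le_trans _ _ (th ^+ n))//.
    rewrite ler_pdivrMr ?mulr_gt0// (@le_trans _ _ (th ^+ n))//.
      by rewrite !exprSr -mulrA ler_piMr ?exprn_ge0 ?(ltW th0)// mulr_ile1// ltW.
    rewrite ler_peMr ?exprn_ge0 ?(ltW th0)// (le_trans kP.1)// ler_peMl ?(ltW k0)//.
    by rewrite ler1n.
  by rewrite lerXn2r ?nnegrE ?(ltW th0)// invr_ge0.
apply: operatorP => x; apply/eqP; rewrite -subr_eq0; apply/eqP/rnorm0_eq0/eqP.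
rewrite eq_le rnorm_ge0 andbT.
apply: (@le0_half_expn _ (rnorm x + rnorm (SC (SD x))) 0%N) => n _.
have TFx : rnorm (T x - F n x) <= 2^-1 ^+ n * rnorm x.
  rewrite -opBE (le_trans (rnorm_apply _ _))// ler_wpM2r ?rnorm_ge0//.
  rewrite (le_trans (rnorm_le_qnorm (ideal_sub BT (BF n))))//.
  by rewrite (le_trans _ (th2 n))//; case: (FP n).
rewrite -(subrK (F n x) (T x)) -addrA (le_trans (rnormD _ _))// mulrDl lerD//.
  by rewrite mulrC.
rewrite rnormB -sumG op_sumE /=.
under eq_bigr do rewrite -GE.
have := le_trans (rnorm_apply _ (SC (SD x))) (ler_wpM2r (rnorm_ge0 (SC (SD x))) (SUP
  n.+1)).
rewrite opBE op_sumE => /le_trans; apply.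
rewrite mul1r mulrC ler_wpM2l ?rnorm_ge0// -(half_expnS R n) lerDl.
exact/ltW/half_expn_gt0.
Qed.

End Assembly.

(** * Finite rank factorizations from right accessibility *)

Section Accessibility.
Variables (R : realType) (k : scalar_kind) (A : operator_ideal R k).
Local Notation K := (scalars R k).
Local Notation dual X := (operator X (scalar_space R k)).
Implicit Types X Y Z W : Banach R k.

(** The functionals that compose [T] are themselves finite-dimensional, and points of [X]
    biorthogonal to them determine [T]: [biorthogonal_system] with the two sides exchanged. *)
Lemma finite_rank_domain X Y (T : operator X Y) : finite_rank X Y T ->
  exists n (x : 'I_n -> X) (h : 'I_n -> dual X), forall u, T u = \sum_j (h j u : K) *:
    T (x j).
Proof.
move=> /finite_rank_rep[m [y [f [_ TE]]]].
have [||||n [h [x [_ gE]]]] := @biorthogonal_system R k (dual X) X (fun f z => f z) _ _ _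
    [set g | exists i, g = comp_op (f i) T].
- by [].
- by move=> g a u v; rewrite linearP.
- by move=> g g0; apply: operatorP => u; rewrite g0.
- exists m, (fun i => comp_op (f i) T) => _ [i ->]; exists (fun j => (j == i)%:R).
  rewrite (bigD1 i)//= eqxx scale1r big1 ?addr0// => j /negbTE ->.
  by rewrite scale0r.
exists n, x, h => u.
have E v : T v = \sum_i (f i (T v) : K) *: y i by rewrite {1}TE op_sumE.
rewrite (E u).
have gi i : [set g | exists i, g = comp_op (f i) T] (comp_op (f i) T) by exists i.
have fE i : f i (T u) = \sum_j (f i (T (x j)) : K) *: (h j u) :> K.
  have := gE _ (gi i); move=> /(congr1 (fun g : dual X => g u)) /=.
  by rewrite op_sumE.
under eq_bigr do rewrite fE scaler_suml.
rewrite exchange_big /=; apply: eq_bigr => j _.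
rewrite [in RHS](E (x j)) scaler_sumr; apply: eq_bigr => i _.
by rewrite scalerA; congr (_ *: _); exact: mulrC.
Qed.

Lemma finite_rank_cod X Y (T : operator X Y) : finite_dimensional [set: Y] ->
  finite_rank X Y T.
Proof. by move=> [n [e eY]]; exists n, e => v _; exact: eY. Qed.

Lemma image_finite_dimensional X Y (T : operator X Y) : finite_rank X Y T ->
  finite_dimensional [set: image_space T].
Proof.
move=> /finite_rank_domain[n [x [h TE]]].
have [S TS _] := image_factor T.
exists n, (fun j => S (x j)) => v _.
have [z zv _] := image_lift_exists v.
exists (fun j => h j z); apply: (@image_incl_inj _ _ _ _ T).
rewrite opv_sum -[LHS]zv TE; apply: eq_bigr => j _.
by rewrite opvZ; congr (_ *: _); rewrite [in LHS]TS.
Qed.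

Lemma rnorm_subspace_incl Y (N : closed_subspace Y) : rnorm (subspace_incl N) <= 1.
Proof. by apply: rnorm_le_op => // x; rewrite mul1r rnorm_subspace. Qed.

Lemma finite_rank_subspace_incl Y (N : closed_subspace Y) :
  finite_dimensional [set` N] -> finite_rank _ _ (subspace_incl N).
Proof.
move=> [n [e eN]]; exists n, e => _ [x _ <-]; apply: eN.
exact: subspace_valP.
Qed.

Lemma rnorm_eval_op X : rnorm (eval_op X) <= 1.
Proof. by apply: rnorm_le_op => // x; rewrite mul1r rnorm_eval. Qed.

Hypothesis A_sur : surjective_ideal A.
Hypothesis A_acc : right_accessible A.

(** The constant 4 is 1 + 1 from accessibility with tolerance 1, times the 2 of
    [ideal_image_incl]. *)
Lemma accessible_image X Y (T : operator X Y) : finite_rank X Y T ->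
  exists (N : closed_subspace Y) (S : operator (image_space T) (subspace_type N)),
    [/\ finite_dimensional [set` N], A _ _ S, image_incl T = comp_op (subspace_incl N) S
      & qnorm A S <= 4 * qnorm A T].
Proof.
move=> TF; have [Ai qi] := ideal_image_incl A_sur (ideal_finite_rank A TF).
have [N [S [Nf AS iE qS]]] := A_acc (image_finite_dimensional TF) Ai ltr01.
exists N, S; split=> //; rewrite (le_trans qS)// (le_trans (ler_wpM2l _ qi))//.
by rewrite mulrCA mulrC ler_wpM2r ?qnorm_ge0//; [exact: ideal_finite_rank|lra].
Qed.

Lemma finite_rank_factors_accessible : finite_rank_factors A.
Proof.
move=> X Y F FF; have [N [C [Nf AC iE qC]]] := accessible_image FF.
have [D FD D1] := image_factor F.
exists (Factorization D C (subspace_incl N)); split=> //=.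
- by split=> //; exact/finite_rank_cod/image_finite_dimensional.
- by split; [exact: finite_rank_subspace_incl|exact: rnorm_subspace_incl].
- by rewrite comp_opA -iE.
Qed.

Lemma finite_dimensional_reflexive X : finite_dimensional [set: X] ->
  exists2 S : operator (dual (dual X)) X, comp_op (eval_op X) S = id_op _ & rnorm S <= 1.
Proof.
move=> Xf; have /finite_rank_rep[n [y [f [_ idE]]]] := finite_rank_cod (id_op X) Xf.
have idE' x : x = \sum_i (f i x : K) *: y i.
  by have /(congr1 (fun T : operator X X => T x)) := idE; rewrite op_sumE.
pose S := \sum_i rank1 (eval_op (dual X) (f i)) (y i).
have SE : comp_op (eval_op X) S = id_op _.
  apply: operatorP => zeta; apply: operatorP => phi.
  rewrite /= op_sumE opv_sum.
  have phiE : phi = \sum_i (phi (y i) : K) *: f i.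
    apply: operatorP => x; rewrite {1}(idE' x) opv_sum op_sumE; apply: eq_bigr => i _.
    by rewrite opvZ; exact: mulrC.
  rewrite [in RHS]phiE opv_sum; apply: eq_bigr => i _.
  by rewrite !opvZ; exact: mulrC.
exists S => //; apply: rnorm_le_op => // zeta.
rewrite -rnorm_eval mul1r.
by have /(congr1 (fun T : operator _ _ => T zeta)) /= -> := SE.
Qed.

(** The adjoint of [F] is the inclusion of [N], after [S], after the quotient map [P] onto its range
    [M]. Each factor is turned around: functionals of [N] receive [X] by evaluation, the adjoint of
    [S] is the middle, and [U] is a preadjoint of [P]. *)
Lemma finite_rank_factors_dual : finite_rank_factors (dual_ideal A).
Proof.
move=> X Y F FF; have FF' := finite_rank_adjoint FF.
have [N [S [Nf AS iE qS]]] := accessible_image FF'.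
have [P FP P1] := image_factor (adjoint F).
pose M : Banach R k := image_space (adjoint F).
have [n [y [f [_ FE]]]] := finite_rank_rep FF.
have FE' x : F x = \sum_j (f j (F x) : K) *: y j by rewrite {1}FE op_sumE.
(* [P] is a finite sum of evaluations at the [y j], hence weak*-continuous; this is why it has a
   preadjoint with values in [Y] and not in its bidual. *)
pose U : operator (dual M) Y := \sum_j rank1 (eval_op M (P (f j))) (y j).
have PE phi : P phi = \sum_j (phi (y j) : K) *: P (f j).
  apply: (@image_incl_inj _ _ _ _ (adjoint F)).
  have E psi : image_incl (adjoint F) (P psi) = adjoint F psi by rewrite [in RHS]FP.
  rewrite E opv_sum; apply: operatorP => x; rewrite op_sumE.
  rewrite [LHS]/= (FE' x) opv_sum; apply: eq_bigr => j _.
  by rewrite opvZ [image_incl _ _]opvZ E opZE; exact: mulrC.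
have U1 : rnorm U <= 1.
  apply: rnorm_le_op => // phi; rewrite mul1r; apply: rnorm_le_dual => psi psi1.
  have -> : psi (U phi) = phi (P psi).
    rewrite PE !opv_sum op_sumE opv_sum; apply: eq_bigr => j _.
    by rewrite !opvZ; exact: mulrC.
  rewrite (le_trans (rnorm_apply _ _))// -[leRHS]mulr1 ler_wpM2l ?rnorm_ge0//.
  exact: le_trans (rnorm_apply_ball _ psi1) P1.
have [Q QE Q1] := finite_dimensional_reflexive (image_finite_dimensional FF').
(* By reflexivity of [M] the bidual of [S] is [S] up to contractions, so the adjoint of [S] belongs
   to the dual ideal with the quasi-norm of [S] as a bound. *)
have SE : adjoint (adjoint S) = comp_op (eval_op _) (comp_op S Q).
  apply: operatorP => zeta; have /(congr1 (fun T : operator _ _ => T zeta)) /= zE := QE.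
  by rewrite -[in LHS]zE; apply: operatorP => phi.
have D1 : rnorm (comp_op (adjoint (subspace_incl N)) (eval_op X)) <= 1.
  rewrite (le_trans (rnorm_comp _ _))// -[leRHS]mulr1 ler_pM ?rnorm_ge0 ?rnorm_eval_op//.
  by rewrite (le_trans (rnorm_adjoint _))// rnorm_subspace_incl.
exists (Factorization (comp_op (adjoint (subspace_incl N)) (eval_op X)) (adjoint S) U);
  split=> /=.
- by split=> //; apply/finite_rank_compr/finite_rank_adjoint/finite_rank_subspace_incl.
- by split=> //; exact: finite_rank_sum.
- by rewrite /dual_class /= SE; exact: ideal_comp.
- rewrite SE; apply: le_trans qS;
  rewrite (le_trans (qnorm_comp _ _ _ _ _ _ _ _ _ _ AS))//.
  rewrite -[leRHS]mulr1 ler_pM ?mulr_ge0 ?rnorm_ge0 ?qnorm_ge0//.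
  by rewrite -[leRHS]mul1r ler_wpM2r ?qnorm_ge0 ?rnorm_eval_op.
- apply: operatorP => x; rewrite /= op_sumE (FE' x); apply: eq_bigr => j _.
  congr (_ *: _); rewrite /=.
  have E1 := congr1 (fun T : operator (dual Y) (dual X) => T (f j) x) FP.
  have E2 := congr1 (fun T : operator M (dual X) => T (P (f j)) x) iE.
  exact: etrans E1 E2.
Qed.

End Accessibility.

(** * A c_0-type interpolation space *)

Section Interpolation.
Variables (R : realType) (k : scalar_kind).
Local Notation K := (scalars R k).
Local Notation dual X := (operator X (scalar_space R k)).
Variables (V Y : Banach R k) (J : operator V Y).

Definition scale_up (n : nat) : K := emb (2 ^+ n : R).
Definition scale_down (n : nat) : K := emb (2^-1 ^+ n : R).

Lemma scale_upK n : scale_up n * scale_down n = 1.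
Proof. by rewrite -embM -exprMn divff// expr1n emb1. Qed.

Lemma scale_downK n : scale_down n * scale_up n = 1.
Proof. by rewrite mulrC scale_upK. Qed.

Lemma re_scale_up n : re `|scale_up n| = 2 ^+ n.
Proof. by rewrite re_norm_emb ger0_norm// exprn_ge0. Qed.

Lemma re_scale_down n : re `|scale_down n| = 2^-1 ^+ n.
Proof. by rewrite re_norm_emb ger0_norm// exprn_ge0// invr_ge0. Qed.

(* [a n] and [b n] decompose y for the n-th gauge, whose unit ball is
   2^n J(B_V) + 2^-n B_Y; the gauges tend to 0 at y and are at most c. *)
Definition null_decomposition (y : Y) (c : R) (a : nat -> V) (b : nat -> Y) :=
  [/\ forall n, y = scale_up n *: J (a n) + scale_down n *: b n,
      forall n, rnorm (a n) <= c /\ rnorm (b n) <= c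
    & forall e : R, 0 < e -> exists N, forall n, (N <= n)%N -> rnorm (a n) <= e /\
      rnorm (b n) <= e].

Let fam (i : bool * nat) : Banach R k := if i.1 then V else Y.

Let pa n : operator (bounded_sum fam) V := bsum_proj fam (true, n).
Let pb n : operator (bounded_sum fam) Y := bsum_proj fam (false, n).
Let value n : operator (bounded_sum fam) Y := scale_up n *: comp_op J (pa n) +
  scale_down n *: pb n.

(** Pairs of null sequences that decompose one and the same vector at every level. The interpolation
    space is the range of this common value, so its completeness comes from [image_space]. *)
Definition null_pred : {pred bounded_sum fam} := fun x => `[<
  (forall n, (value n - value 0%N) x = 0) /\
  (forall e : R, 0 < e -> exists N, forall n, (N <= n)%N -> rnorm (pa n x) <= e /\
    rnorm (pb n x) <= e) >].

Lemma null_predP x : reflect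
  ((forall n, (value n - value 0%N) x = 0) /\
  (forall e : R, 0 < e -> exists N, forall n, (N <= n)%N -> rnorm (pa n x) <= e /\
    rnorm (pb n x) <= e))
  (x \in null_pred).
Proof. exact: asboolP. Qed.

Lemma null_submod : submod_closed null_pred.
Proof.
split.
  apply/null_predP; split=> [n|e e0]; first by rewrite opv0.
  by exists 0%N => n _; rewrite !opv0 !rnorm0 ltW.
move=> s u v /null_predP[u1 u2] /null_predP[v1 v2]; apply/null_predP; split=> [n|e e0].
  by rewrite opvD opvZ u1 v1 scaler0 addr0.
have s0 : 0 < re `|s| + 1 by rewrite ltr_wpDl ?re_norm_ge0.
have [|N NP] := u2 (e / 2 / (re `|s| + 1)); first by rewrite !divr_gt0.
have [|M MP] := v2 (e / 2); first by rewrite divr_gt0.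
exists (maxn N M) => n; rewrite geq_max => /andP[/NP[h1 h2] /MP[h3 h4]].
have le (W : normedModType K) (x y : W) : rnorm x <= e / 2 / (re `|s| + 1) -> rnorm y
  <= e / 2 ->
    rnorm (s *: x + y) <= e.
  move=> xe ye; rewrite (le_trans (rnormD _ _))// [leRHS]splitr lerD// rnormZ.
  rewrite (le_trans (ler_wpM2l (re_norm_ge0 _) xe))// mulrCA -[leRHS]mulr1.
  by rewrite ler_wpM2l ?divr_ge0 ?(ltW e0)// ler_pdivrMr// mul1r lerDl.
by split; rewrite opvD opvZ; exact: le.
Qed.

Lemma null_closed : closed [set` null_pred].
Proof.
move=> x /closure_rnormP xN; apply/null_predP; split=> [n|e e0].
  apply: rnorm0_eq0; apply/eqP; rewrite eq_le rnorm_ge0 andbT.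
  apply/ler_addgt0Pl => e e0; rewrite addr0.
  have L0 : 0 < rnorm (value n - value 0%N) + 1 by rewrite ltr_wpDl ?rnorm_ge0.
  have [|x' /null_predP[x'0 _] xx'] := xN (e / (rnorm (value n - value 0%N) + 1)).
    by rewrite divr_gt0.
  rewrite -[_ x]subr0 -(x'0 n) -opvB (le_trans (rnorm_apply _ _))//.
  rewrite (le_trans (ler_wpM2l (rnorm_ge0 _) xx'))// mulrCA -[leRHS]mulr1.
  by rewrite ler_wpM2l ?(ltW e0)// ler_pdivrMr// mul1r lerDl.
have e2 : 0 < e / 2 by rewrite divr_gt0.
have [x' /null_predP[_ x'0] xx'] := xN _ e2; have [N NP] := x'0 _ e2.
have xx'i i : rnorm (x i - x' i) <= e / 2.
  by apply: le_trans xx'; rewrite rnorm_bsum; exact: (bsum_norm_ub (x - x') i).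
exists N => n /NP[h1 h2]; split;
  [rewrite -(subrK (pa n x') (pa n x))|rewrite -(subrK (pb n x') (pb n x))];
  rewrite (le_trans (rnormD _ _))// [leRHS]splitr lerD//; exact: xx'i.
Qed.

Definition null_space := ClosedSubspace null_submod null_closed.

Definition null_value : operator (subspace_type null_space) Y := comp_op (value 0%N)
  (subspace_incl null_space).

Lemma null_value_intro y c a b : 0 <= c -> null_decomposition y c a b ->
  exists2 x, null_value x = y & rnorm x <= c.
Proof.
move=> c0 [yE abc ab0].
pose F (i : bool * nat) : fam i :=
  (if i.1 as t return (if t then V else Y : Banach R k) then a i.2 else b i.2).
have Fc (i : bool * nat) : rnorm (F i) <= c by case: i => -[] n; case: (abc n).
pose x := BoundedSum (ex_intro _ c Fc : exists c : R, forall i, rnorm (F i) <= c).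
have vE n : value n x = y by rewrite [RHS](yE n).
have xN : x \in null_pred.
  by apply/null_predP; split=> // n; rewrite opBE !vE subrr.
exists (SubspaceType (N := null_space) xN); first exact: vE.
by rewrite rnorm_subspace /= rnorm_bsum; apply: bsum_norm_le.
Qed.

Lemma null_value_elim (x : subspace_type null_space) (c : R) : rnorm x <= c ->
  exists a b, null_decomposition (null_value x) c a b.
Proof.
rewrite rnorm_subspace rnorm_bsum => xc.
have /null_predP[x1 x2] : val x \in null_pred by exact: subspace_valP.
exists (fun n => pa n (val x)), (fun n => pb n (val x)); split=> //.
- by move=> n; apply/eqP; rewrite eq_sym -subr_eq0; apply/eqP; exact: x1.
- by move=> n; split; apply: le_trans xc; exact: bsum_norm_ub.
Qed.

Let Z : Banach R k := image_space null_value.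
Let i : operator Z Y := image_incl null_value.

Lemma interpolation_intro y c a b : 0 <= c -> null_decomposition y c a b ->
  exists2 z : Z, i z = y & rnorm z <= c.
Proof.
move=> c0 /(null_value_intro c0)[x xy xc].
have yP : y \in image_pred null_value by apply/image_predP; exists x.
exists (ImageSpace yP) => //; apply: le_trans xc.
by rewrite rnorm_image; exact: image_norm_lb.
Qed.

Lemma interpolation_elim (z : Z) : exists a b, null_decomposition (i z) (2 * rnorm z) a b.
Proof.
have [x xz /null_value_elim[a [b d]]] := image_lift_exists z.
by exists a, b; rewrite xz in d.
Qed.

Lemma null_decompositionD y y' c c' a a' b b' :
  null_decomposition y c a b -> null_decomposition y' c' a' b' ->
  forall d, (forall n, rnorm (a n + a' n) <= d /\ rnorm (b n + b' n) <= d) ->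
  null_decomposition (y + y') d (a \+ a') (b \+ b').
Proof.
move=> [y1 _ y3] [y1' _ y3'] d abd; split=> // [n|e e0].
  by rewrite {1}(y1 n) {1}(y1' n) /= opvD !scalerDr addrACA.
have e2 : 0 < e / 2 by rewrite divr_gt0.
have [N NP] := y3 _ e2; have [M MP] := y3' _ e2.
exists (maxn N M) => n; rewrite geq_max => /andP[/NP[h1 h2] /MP[h3 h4]].
by split; rewrite (le_trans (rnormD _ _))// [leRHS]splitr lerD.
Qed.

(* Replacing finitely many terms of a decomposition by the trivial one is cheap
   for vectors of small norm. *)
Lemma null_decomposition_cut y c a b N : null_decomposition y c a b ->
  exists a' b', [/\ null_decomposition y (Num.max c (2 ^+ N * rnorm y)) a' b',
    forall n, (n < N)%N -> rnorm (a' n) <= 2 ^+ N * rnorm y /\ rnorm (b' n) <= 2 ^+ N *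
      rnorm y
  & forall n, (N <= n)%N -> rnorm (a' n) <= c /\ rnorm (b' n) <= c].
Proof.
move=> [y1 y2 y3].
pose a' n := if (n < N)%N then 0 else a n.
pose b' n := if (n < N)%N then scale_up n *: y else b n.
have small n : (n < N)%N -> rnorm (a' n) <= 2 ^+ N * rnorm y /\ rnorm (b' n) <= 2 ^+ N
  * rnorm y.
  move=> nN; rewrite /a' /b' nN rnorm0 mulr_ge0 ?rnorm_ge0 ?exprn_ge0//; split=> //.
  rewrite rnormZ re_scale_up ler_wpM2r ?rnorm_ge0//.
  by rewrite ler_weXn2l ?ler1n// ltnW.
have large n : (N <= n)%N -> rnorm (a' n) <= c /\ rnorm (b' n) <= c.
  by rewrite leqNgt => /negbTE nN; rewrite /a' /b' nN.
exists a', b'; split=> //; split=> [n|n|e /y3[M MP]].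
- rewrite /a' /b'; case: ifP => // _.
  by rewrite opv0 scaler0 add0r scalerA scale_downK scale1r.
- by have [/small[]|/large[]] := ltnP n N; rewrite !le_max => -> ->; rewrite ?orbT.
- exists (maxn N M) => n; rewrite geq_max => /andP[]; rewrite leqNgt => /negbTE nN /MP.
  by rewrite /a' /b' nN.
Qed.

Hypothesis J_compact : compact_op V Y J.

Lemma scaled_net (c : R) : 0 < c -> forall e : R, 0 < e ->
  exists n (s : 'I_n -> Y), forall v, rnorm v <= c -> exists j, rnorm (J v - s j) <= e.
Proof.
move=> c0 e e0; have [|n [s sP]] := (compact_opP J).1 J_compact (e / c).
  by rewrite divr_gt0.
exists n, (fun j => emb c *: s j) => v vc.
have v1 : `|emb c^-1 *: v| <= 1.
  by rewrite rnorm_le1 rnormZ re_norm_emb gtr0_norm ?invr_gt0// mulrC ler_pdivrMr// mul1r.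
have [j jP] := sP (exist (fun x : V => `|x| <= 1) _ v1); exists j.
have -> : J v - emb c *: s j = emb c *: (J (emb c^-1 *: v) - s j).
  by rewrite scalerBr opvZ scalerA -embM divff ?gt_eqF// emb1 scale1r.
by rewrite rnormZ re_norm_emb gtr0_norm// mulrC -ler_pdivlMr.
Qed.

(** At a high level N a vector of the unit ball is 2^N J(a) + 2^-N b with a and b of norm at most 2:
    the second term is uniformly small and the first stays in a precompact set. *)
Lemma interpolation_incl_compact : compact_op Z Y i.
Proof.
apply/compact_opP => e e0.
have [|N NP] := @half_expn_small R (e / 2 / 2); first by rewrite !divr_gt0.
have [//||n [s sP]] := @scaled_net 2 _ (e / 2 * 2^-1 ^+ N).
  by rewrite mulr_gt0 ?divr_gt0// half_expn_gt0.
exists n, (fun j => scale_up N *: s j) => z.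
have z1 : rnorm (val z) <= 1 by rewrite -rnorm_le1; exact: valP z.
have [a [b [zE abc _]]] := interpolation_elim (val z).
have le2 : 2 * rnorm (val z) <= 2 by rewrite ler_piMr.
have [aN bN] := abc N; have [j jP] := sP _ (le_trans aN le2); exists j.
rewrite (zE N) addrAC -scalerBr (le_trans (rnormD _ _))// [leRHS]splitr lerD//.
  rewrite rnormZ re_scale_up (le_trans (ler_wpM2l _ jP)) ?exprn_ge0//.
  by rewrite mulrCA -exprMn divff// expr1n mulr1.
rewrite rnormZ re_scale_down (@le_trans _ _ (e / 2 / 2 * 2))//.
  by rewrite ler_pM ?rnorm_ge0 ?exprn_ge0 ?invr_ge0 ?NP ?(le_trans bN).
by rewrite divfK.
Qed.

Lemma null_decomposition_image v : null_decomposition (J v) (rnorm v) (fun n =>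
  scale_down n *: v) (fun=> 0).
Proof.
split=> [n|n|e e0].
- by rewrite opvZ scalerA scale_upK scale1r scaler0 addr0.
- rewrite rnorm0 rnorm_ge0 rnormZ re_scale_down; split=> //.
  by rewrite ler_piMl ?rnorm_ge0// exprn_ile1// ?invr_ge0// invf_le1// ler1n.
have [|N NP] := @half_expn_small R (e / (rnorm v + 1));
  first by rewrite divr_gt0 ?ltr_wpDl ?rnorm_ge0.
exists N => n /NP h; rewrite rnorm0 (ltW e0) rnormZ re_scale_down; split=> //.
rewrite (le_trans (ler_wpM2r (rnorm_ge0 _) h))// mulrAC -[leRHS]mulr1 -mulrA.
by rewrite ler_wpM2l ?(ltW e0)// ler_pdivrMr ?ltr_wpDl ?rnorm_ge0// mul1r lerDl.
Qed.

(** For compactness of [h], let [w] be a difference of two points of the ball with [J w] tiny. Below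
    level N decompose [J w] by itself, above it by [w]: the factor 2^N is beaten by the smallness of
    [J w], and the factor 2^-n makes [w] small. *)
Lemma interpolation_lift : exists h : operator V Z,
  [/\ J = comp_op i h, rnorm h <= 1 & compact_op V Z h].
Proof.
have [v|h Jh h1] := @image_corestrict R k _ _ null_value V J 1 ler01.
  rewrite mul1r; apply: null_value_intro (null_decomposition_image v); exact: rnorm_ge0.
exists h; split=> //; apply/compact_opP => e e0.
have [|N NP] := @half_expn_small R (e / 2); first by rewrite divr_gt0.
have [|n [s sP]] := totally_bounded_net ((compact_opP J).1 J_compact) (e := e * 2^-1 ^+
  N).
  by rewrite mulr_gt0// half_expn_gt0.
exists n, (fun j => h (val (s j))) => v; have [j jP] := sP v; exists j.
rewrite -opvB; set w := val v - val (s j).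
have w2 : rnorm w <= 2.
  rewrite (le_trans (rnormD _ _))// rnormN -[leRHS](_ : 1 + 1 = _)// lerD//;
    rewrite -rnorm_le1;
    [exact: valP v|exact: valP (s j)].
have Jw : 2 ^+ N * rnorm (J w) <= e.
  rewrite -ler_pdivlMl ?exprn_gt0// -exprVn mulrC opvB.
  exact: jP.
pose a n := if (n < N)%N then 0 else scale_down n *: w.
pose b n := if (n < N)%N then scale_up n *: J w else 0.
have dec : null_decomposition (J w) e a b.
  have [d1 d2 d3] := null_decomposition_image w.
  split=> [m|m|d /d3[M MP]]; rewrite /a /b.
  - case: ifP => _; last exact: d1.
    by rewrite opv0 scaler0 add0r scalerA scale_downK scale1r.
  - case: ltnP => mN.
      rewrite rnorm0 (ltW e0) rnormZ re_scale_up; split=> //; apply: le_trans Jw.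
      by rewrite ler_wpM2r ?rnorm_ge0// ler_weXn2l ?ler1n// ltnW.
    rewrite rnorm0 (ltW e0) rnormZ re_scale_down; split=> //.
    by rewrite -[leRHS](divfK (_ : 2 != 0))// ler_pM ?rnorm_ge0 ?exprn_ge0 ?invr_ge0 ?NP.
  - exists (maxn N M) => m; rewrite geq_max => /andP[]; rewrite leqNgt => /negbTE -> /MP.
    by [].
have [z zw ze] := interpolation_intro (ltW e0) dec.
by have -> : h w = z; first by apply: (@image_incl_inj _ _ _ _ null_value);
  rewrite [RHS]zw [in RHS]Jh.
Qed.

(* Sliding hump: vectors of the unit ball which are small in Y can be added up
   with a norm growing much slower than their number. *)
Lemma interpolation_functional_continuous (g : dual Z) (e : R) : 0 < e ->
  exists2 d : R, 0 < d & forall z, rnorm z <= 1 -> rnorm (i z) <= d -> rnorm (g z) <= e.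
Proof.
move=> e0; apply: contrapT => nd.
have bad (d : R) : 0 < d -> exists z, [/\ rnorm z <= 1, rnorm (i z) <= d & e <= re (g z
  : K)].
  move=> d0; apply: contrapT => nz; apply: nd; exists d => // z z1 zd.
  rewrite leNgt; apply/negP => gz; apply: nz.
  have gz0 : (g z : K) != 0.
    by apply: contraTneq gz => ->; rewrite -leNgt rnorm0 ltW.
  pose c : K := `|g z : K| / (g z : K).
  have c1 : re `|c| = 1 by rewrite /c normrM normr_id normfV divff ?normr_eq0// re1.
  exists (c *: z); rewrite opvZ !rnormZ c1 !mul1r; split=> //.
  by rewrite opvZ scalarZ /c mulfVK// ltW.
(* With this choice m humps raise the norm bound by m [eta], which lets [g] grow by at most m e/2,
   half of the growth m e that is forced. *)
pose eta := e / (2 * (rnorm g + 1)).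
have g0 : 0 < rnorm g + 1 by rewrite ltr_wpDl ?rnorm_ge0.
have eta0 : 0 < eta by rewrite divr_gt0// mulr_gt0.
(* [s] is the sum of m humps. *)
have key m : exists s a b, null_decomposition (i s) (2 + m%:R * eta) a b /\ m%:R * e <=
  re (g s : K).
  elim: m => [|m [s [a [b [sd sg]]]]].
    exists 0, (fun=> 0), (fun=> 0); rewrite !opv0 !mul0r addr0 -(@emb0 R k) embK;
      split=> //.
    split=> [n|n|d d0]; first by rewrite opv0 !scaler0 addr0.
      by rewrite !rnorm0.
    by exists 0%N => n _; rewrite !rnorm0 ltW.
  have [_ sd2 /(_ _ eta0)[N NP]] := sd.
  (* Beyond level N the old sum is at most [eta] and the new hump at most 2; below N the old bound
     stands and the cut hump adds at most 2^N |i z|, hence the 2^-N in its size. *)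
  have [|z [z1 zd gz]] := bad (eta * 2^-1 ^+ N); first by rewrite mulr_gt0 ?half_expn_gt0.
  have [a1 [b1 zdec]] := interpolation_elim z.
  have [a' [b' [zdec' small large]]] := null_decomposition_cut N zdec.
  have iz : 2 ^+ N * rnorm (i z) <= eta.
    by rewrite -ler_pdivlMl ?exprn_gt0// -exprVn mulrC.
  have z2 : 2 * rnorm z <= 2 by rewrite ler_piMr.
  exists (s + z), (a \+ a'), (b \+ b'); split; last first.
    by rewrite opvD reD -natr1 mulrDl mul1r lerD.
  rewrite opvD; apply: null_decompositionD sd zdec' _ _ => n.
  have bound : 2 + m%:R * eta + eta = 2 + m.+1%:R * eta by rewrite -natr1; ring.
  rewrite -bound; have [nN|nN] := ltnP n N.
    have [s1 s2] := sd2 n; have [t1 t2] := small n nN.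
    by split; rewrite (le_trans (rnormD _ _))// lerD// (le_trans _ iz).
  have [s1 s2] := NP n nN; have [t1 t2] := large n nN.
  split; rewrite (le_trans (rnormD _ _))// addrC lerD// (le_trans _ (_ : 2 <= _))
    ?(le_trans _ z2)//;
    by rewrite lerDl mulr_ge0// ltW.
have archi : exists m : nat, 2 * (rnorm g + 1) < m%:R * (e / 2).
  exists (Num.truncn (2 * (rnorm g + 1) / (e / 2))).+1; rewrite -ltr_pdivrMr ?divr_gt0//.
  have /truncn_itv/andP[] : 0 <= 2 * (rnorm g + 1) / (e / 2) by rewrite divr_ge0
    ?mulr_ge0 ?(ltW g0) ?divr_ge0 ?(ltW e0).
  by [].
have [m mP] := archi; have [s [a [b [sd sg]]]] := key m.
have [|s' s's s'n] := interpolation_intro _ sd;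
  first by rewrite addr_ge0// mulr_ge0// ltW.
have {s's} ss' : s' = s by apply: (@image_incl_inj _ _ _ _ null_value).
rewrite {}ss' in s'n.
have : m%:R * e <= (rnorm g + 1) * (2 + m%:R * eta).
  rewrite (le_trans sg)// (le_trans (re_le_norm _))// (le_trans (rnorm_apply g s))//.
  by rewrite ler_pM ?rnorm_ge0// lerDl.
have -> : (rnorm g + 1) * (2 + m%:R * eta) = 2 * (rnorm g + 1) + m%:R * (e / 2).
  by rewrite /eta; field; rewrite gt_eqF.
have -> : m%:R * e = m%:R * (e / 2) + m%:R * (e / 2) by rewrite -mulrDr -splitr.
by rewrite lerD2r leNgt mP.
Qed.

(** On the graph of the inclusion, [g] is dominated by M |y| + (e/2) |z|. An extension to Y x Z
    splits into a functional on Y and a remainder on Z, of norm at most e/2. *)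
Lemma interpolation_dense_dual (g : dual Z) (e : R) : 0 < e ->
  exists f : dual Y, forall z, `|z| <= 1 -> rnorm (f (i z) - g z) < e.
Proof.
move=> e0; have e2 : 0 < e / 2 by rewrite divr_gt0.
have [d d0 dP] := interpolation_functional_continuous g e2.
pose M := e / 2 / d.
pose p (w : Y * Z) := M * rnorm w.1 + e / 2 * rnorm w.2.
have M0 : 0 <= M by rewrite divr_ge0 ?(ltW d0)// ltW.
have pD u v : p (u + v) <= p u + p v.
  by rewrite /p addrACA -!mulrDr lerD// ler_wpM2l ?rnormD// ltW.
have pZ a v : p (a *: v) <= re `|a| * p v.
  by rewrite /p /= !rnormZ mulrDr ![re _ * (_ * _)]mulrCA.
have [||z|G [Gl Gp] Gi] := hahn_banach pD pZ (j := fun z : Z => (i z, z)) (g := fun z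
  => g z : K).
- by move=> a u v; congr (_, _); rewrite opvD opvZ.
- by move=> a u v; rewrite opvD opvZ.
(* Dividing by [r] puts [z] in the unit ball and its image within distance [d] of 0, so the
   continuity estimate holds for all [z] after rescaling. *)
- rewrite /p /=; pose r := rnorm z + rnorm (i z) / d.
  have [z0|z0] := eqVneq z 0; first by rewrite z0 !opv0 re_norm0 !rnorm0 !mulr0 addr0.
  have r0 : 0 < r.
    rewrite ltr_pwDl ?divr_ge0 ?rnorm_ge0 ?(ltW d0)//.
    exact: rnorm_gt0.
  have := dP (emb r^-1 *: z); rewrite !opvZ !rnormZ re_norm_emb gtr0_norm ?invr_gt0//.
  rewrite ![r^-1 * _]mulrC !ler_pdivrMr// mul1r => h.
  apply: (le_trans (h _ _)).
  + by rewrite /r lerDl divr_ge0 ?rnorm_ge0// ltW.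
  + by rewrite /r mulrDr [d * (_ / _)]mulrC divfK ?gt_eqF// lerDr mulr_ge0 ?rnorm_ge0//
    ltW.
  + by rewrite /r /M mulrDr addrC mulrA mulrAC.
have G0 : forall a u v, G (a *: u + v, 0) = a * G (u, 0) + G (v, 0).
  by move=> a u v; rewrite -Gl; congr G; congr (_, _); rewrite /= scaler0 addr0.
have Gb y : re `|G (y, 0)| <= M * rnorm y.
  by rewrite (le_trans (Gp _))// /p /= rnorm0 mulr0 addr0.
have [f fE _] := @operator_exists R k Y (scalar_space R k) (fun y => G (y, 0)) M G0 M0 Gb.
exists f => z; rewrite rnorm_le1 => z1.
have -> : f (i z) - g z = - G (0, z) :> K.
  rewrite fE -[g z]Gi -[(i z, z)](_ : 1 *: (i z, 0) + (0, z) = _).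
    by rewrite Gl mul1r opprD addrA subrr add0r.
  by congr (_, _); rewrite /= ?scale1r ?scaler0 ?addr0 ?add0r.
rewrite rnorm_scalar normrN (le_lt_trans (Gp _))// /p /= rnorm0 mulr0 add0r.
rewrite (@le_lt_trans _ _ (e / 2))//; first by rewrite ler_piMr// ltW.
by rewrite ltr_pdivrMr// ltr_pMr// ltr1n.
Qed.

End Interpolation.

(** Both factors are compact, so a compact inclusion can itself be split into two compact maps, as
    the dual half requires. *)
Theorem compact_interpolation (R : realType) (k : scalar_kind) (V Y : Banach R k) (J :
  operator V Y) :
  compact_op V Y J -> exists (Z : Banach R k) (i : operator Z Y) (h : operator V Z),
    [/\ J = comp_op i h, rnorm h <= 1, compact_op V Z h
      & forall C, C `<=` i @` [set z | `|z| <= 1] -> admissible C i].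
Proof.
move=> Jc; have [h [Jh h1 hc]] := interpolation_lift Jc.
exists (image_space (null_value J)), (image_incl (null_value J)), h; split=> // C CZ.
split=> //; first exact: image_incl_inj.
  exact: interpolation_incl_compact.
by move=> g e e0; exact: interpolation_dense_dual.
Qed.

(** * The approximation property and approximation in the quasi-norm *)

Section ApproximationProperty.
Variables (R : realType) (k : scalar_kind) (A : operator_ideal R k).
Local Notation K := (scalars R k).
Local Notation dual X := (operator X (scalar_space R k)).
Implicit Types X Y Z W E : Banach R k.

Lemma admissible_subset E (C D : set E) Z (i : operator Z E) :
  D `<=` C -> admissible C i -> admissible D i.
Proof. by move=> DC [i1 i2 i3 i4]; split=> //; exact: subset_trans i3. Qed.

Lemma totally_bounded_bounded (V : normedModType K) (I : Type) (f : I -> V) :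
  totally_bounded f -> exists2 c : R, 0 <= c & forall i, rnorm (f i) <= c.
Proof.
move=> /(_ 1 ltr01)[n [s sP]].
have s0 : 0 <= \sum_j rnorm (s j) by apply: sumr_ge0 => j _; exact: rnorm_ge0.
exists (1 + \sum_j rnorm (s j)) => [|i]; first by rewrite addr_ge0.
have [j jP] := sP i; rewrite -(subrK (s j) (f i)) (le_trans (rnormD _ _))// lerD//.
by rewrite (bigD1 j)//= lerDl sumr_ge0// => l _; exact: rnorm_ge0.
Qed.

(** The operator on l_1(C) that sends unit vectors to the points of [C] is compact, and [C] lies in
    the image of its unit ball; interpolation does the rest. *)
Lemma admissible_exists E (C : set E) : compact C ->
  exists Z (i : operator Z E), admissible C i.
Proof.
move=> /compact_totally_bounded Ct; have [c c0 cP] := totally_bounded_bounded Ct.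
have [J JE _] := @ell1_op_exists R k C E (fun x : C => val x) c c0 cP.
have Jc : compact_op _ E J.
  apply/approximable_compact/totally_bounded_ell1_approximable => e /Ct[n [s sP]].
  by exists n, s => x; have [j jP] := sP x; exists j; rewrite JE.
have [Z [i [h [Jh h1 _ iadm]]]] := compact_interpolation Jc.
exists Z, i; apply: iadm => x Cx.
exists (h (delta1 R k (SigSub (mem_set Cx)))).
  rewrite /= rnorm_le1 (le_trans _ h1)// rnorm_apply_ball//.
  exact: rnorm_delta1.
have -> : i (h (delta1 R k (SigSub (mem_set Cx)))) = J (delta1 R k (SigSub (mem_set Cx))).
  by rewrite [in RHS]Jh.
by rewrite JE.
Qed.

Lemma injective_corestrict E Y Z (i : operator Z E) (T : operator Y E) : injective i ->
  (forall y, rnorm y <= 1 -> exists2 z, i z = T y & rnorm z <= 1) ->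
  exists2 S : operator Y Z, T = comp_op i S & rnorm S <= 1.
Proof.
move=> iinj iT.
have /choice[f fP] : forall y, exists z, i z = T y /\ rnorm z <= 1 * rnorm y.
  move=> y; have [->|y0] := eqVneq y 0.
    by exists 0; rewrite !opv0 !rnorm0 mulr0.
  have ny : 0 < rnorm y by exact: rnorm_gt0.
  have [|z zE z1] := iT (emb (rnorm y)^-1 *: y).
    by rewrite rnormZ re_norm_emb gtr0_norm ?invr_gt0// mulVf ?gt_eqF.
  exists (emb (rnorm y) *: z); split.
    by rewrite opvZ zE opvZ scalerA -embM divff ?gt_eqF// emb1 scale1r.
  by rewrite rnormZ re_norm_emb gtr0_norm// mulrC ler_wpM2r// rnorm_ge0.
have [a u v|y|S SE S1] := @operator_exists R k Y Z f 1 _ ler01.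
- apply: iinj; rewrite opvD opvZ; case: (fP u) => -> _; case: (fP v) => -> _.
  by case: (fP (a *: u + v)) => -> _; rewrite opvD opvZ.
- by case: (fP y).
by exists S => //; apply: operatorP => y; rewrite /= SE; case: (fP y).
Qed.

(** A space admissible for the closed image [D] of the unit ball contains the values of [C], which
    therefore corestricts to it with norm at most 1; the composition norm on that space bounds the
    quasi-norm. *)
Lemma approximation_property_compact X Z Y (T : operator Z X) (C : operator Y Z) (e : R) :
  approximation_property A X -> A Z X T -> compact_op Y Z C -> 0 < e ->
  exists2 S, finite_rank Z X S & qnorm A (comp_op T C - comp_op S C) <= e.
Proof.
move=> Xap AT Cc e0.
pose D := closure (C @` [set y | `|y| <= 1]).
have [|S [SD SF]] := Xap Z T AT [set S | (lambda_norm A D (S - T)%R < e%:E)%E].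
  exists 1%N, (fun=> D), e; split=> //; last by move=> S _ /(_ ord0).
  by move=> _; rewrite -precompactE.
exists S => //.
have [_ [W [i [[iinj _ iD _] ->]]]] := ereal_inf_lt SD.
move=> /ereal_inf_lt[_ [P [T1 [T2 [AT1 _ TE ->]]]]]; rewrite lte_fin => Te.
have [|C' CE C1] := injective_corestrict (T := C) iinj.
  move=> y; rewrite -rnorm_le1 => y1.
  have [|z z1 zE] := iD (C y); first by apply: subset_closure; exists y.
  by exists z => //; rewrite -rnorm_le1.
have E1 : comp_op T C - comp_op S C = - comp_op T1 (comp_op T2 C').
  rewrite -comp_opBl -[T - S]opprB comp_opA -TE -comp_opA -CE.
  exact: operatorP.
have AT2 : A _ _ (comp_op T1 (comp_op T2 C')) by exact: ideal_compr.
rewrite E1 (le_trans (qnorm_opp AT2))// (le_trans (qnorm_compr _ AT1))//.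
apply: le_trans (ltW Te); rewrite ler_wpM2l ?qnorm_ge0// (le_trans (rnorm_comp _ _))//.
by rewrite ler_piMr// rnorm_ge0.
Qed.

(** A finite rank approximant of the approximable factor uses functionals on [Z]. Density of the
    functionals of [Y] replaces them by restrictions, and the approximant then extends to all of
    [Y]. *)
Lemma lambda_norm_approx X Y Z (T : operator Y X) (i : operator Z Y) (C : set Y) (e : R) :
  admissible C i -> comp_class A approximable Z X (comp_op T i) -> 0 < e ->
  exists2 S, finite_rank Y X S &
    forall D, D `<=` C -> (lambda_norm A D (S - T)%R < e%:E)%E.
Proof.
move=> Ci [W [U [V [AU Va TE]]]] e0.
have U0 : 0 < qnorm A U + 1 by rewrite ltr_wpDl ?qnorm_ge0.
(* Half of e for each of two errors: the finite rank approximation, and the change of its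
   functionals. *)
pose eta := e / 2 / (qnorm A U + 1).
have eta0 : 0 < eta by rewrite !divr_gt0.
have [V0 V0F VV0] := (approximableP V).1 Va eta eta0.
have [n [y [f [_ V0E]]]] := finite_rank_rep V0F.
have s0 : 0 < \sum_j rnorm (y j) + 1.
  by rewrite ltr_wpDl// sumr_ge0// => j _; exact: rnorm_ge0.
have /choice[h hP] : forall j, exists g : dual Y, forall z, `|z| <= 1 ->
    rnorm (g (i z) - comp_op (f j) V0 z) < eta / (\sum_j rnorm (y j) + 1).
  by move=> j; case: Ci => _ _ _; apply; rewrite divr_gt0.
pose V1 := \sum_j rank1 (comp_op (h j) i) (y j).
have V01 : rnorm (V1 - V0) <= eta.
  apply: rnorm_le_ball => [|z z1]; first exact: ltW.
  rewrite {1}V0E opBE !op_sumE -sumrB (le_trans (rnorm_sum _ _))//.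
  rewrite (@le_trans _ _ (\sum_j eta / (\sum_j rnorm (y j) + 1) * rnorm (y j)))//.
    apply: ler_sum => j _; rewrite /= -scalerBl rnormZ ler_wpM2r ?rnorm_ge0//.
    by apply/ltW/hP; rewrite rnorm_le1.
  by rewrite -mulr_sumr mulrAC ler_pdivrMr// ler_wpM2l ?(ltW eta0)// lerDl.
pose S := \sum_j rank1 (h j) (U (y j)).
exists S; first exact: finite_rank_sum.
move=> D DC.
have STE : comp_op (S - T) i = comp_op U (V1 - V).
  rewrite comp_opBl comp_opBr -TE; congr (_ - _).
  apply: operatorP => z; rewrite /= !op_sumE opv_sum.
  by apply: eq_bigr => j _; rewrite /= opvZ.
have V1c : compact_op Z W (V1 - V).
  apply/approximable_compact/approximableP => d /((approximableP V).1 Va)[F FF VF].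
  exists (V1 - F); first by apply: finite_rankD;
    [exact: finite_rank_sum|exact: finite_rankN].
  by rewrite opprB addrC subrKA rnormB.
apply: (@le_lt_trans _ _ (qnorm A U * rnorm (V1 - V))%:E); last first.
  rewrite lte_fin (@le_lt_trans _ _ (qnorm A U * (eta + eta)))//.
    rewrite ler_wpM2l ?qnorm_ge0// -(subrK V0 V1) -addrA (le_trans (rnormD _ _))// lerD//.
    by rewrite rnormB.
  have -> : eta + eta = e / (qnorm A U + 1) by rewrite -mulrDl -splitr.
  by rewrite mulrCA -[ltRHS]mulr1 ltr_pM2l// ltr_pdivrMr// mul1r ltrDl.
apply: (@le_trans _ _ (kappa_norm A (comp_op (S - T) i))); apply: ereal_inf_lbound.
  by exists Z, i; split=> //; exact: admissible_subset Ci.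
by exists W, U, (V1 - V); split.
Qed.

(** A neighbourhood involves finitely many compact sets; one space admissible for their union serves
    them all. *)
Lemma approximation_propertyI X :
  (forall Y (T : operator Y X) (C : set Y), A Y X T -> compact C ->
     exists Z (i : operator Z Y), admissible C i /\ comp_class A approximable Z X
       (comp_op T i)) ->
  approximation_property A X.
Proof.
move=> H Y T AT U [n [C [e [Cc e0 CU]]]].
have Cuc : compact (\big[setU/set0]_(j < n) C j) by apply: bigsetU_compact => j _.
have [Z [i [iadm Ti]]] := H Y T _ AT Cuc.
have [S SF SP] := lambda_norm_approx iadm Ti e0.
exists S; split=> //; apply: CU; first exact: ideal_finite_rank.
by move=> j; apply: SP; rewrite (bigD1 j)//= => x Cx; left.
Qed.

End ApproximationProperty.

(** * A^min through one-sided compositions *)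

Section MinClass.
Variables (R : realType) (k : scalar_kind) (B : operator_ideal R k).
Implicit Types X Y Z W : Banach R k.

Lemma min_class_right X Y (T : operator X Y) :
  min_class B X Y T -> comp_class B approximable X Y T.
Proof.
move=> [Z [U [_ [_ [W [C [V [BC Va ->]]]] ->]]]].
by exists W, (comp_op U C), V; split; [exact: ideal_compl| |exact: comp_opA].
Qed.

Lemma min_class_left X Y (T : operator X Y) :
  min_class B X Y T -> comp_class approximable B X Y T.
Proof.
move=> [Z [U [_ [Ua [W [C [V [BC _ ->]]]] ->]]]].
by exists Z, U, (comp_op C V); split=> //; exact: ideal_compr.
Qed.

Lemma min_class_compr X Y Z (T : operator Z Y) (V : operator X Z) :
  min_class B Z Y T -> min_class B X Y (comp_op T V).
Proof.
move=> [W [U [_ [Ua [P [C [D [BC Da ->]]]] ->]]]].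
exists W, U, (comp_op C (comp_op D V)); split=> //; last exact: operatorP.
by exists P, C, (comp_op D V); split=> //; exact: approximable_compr.
Qed.

Lemma min_class_compl X Y Z (U : operator Z Y) (T : operator X Z) :
  min_class B X Z T -> min_class B X Y (comp_op U T).
Proof.
move=> [W [V [D [Va CD ->]]]].
by exists W, (comp_op U V), D; split; [exact: approximable_compl| |exact: comp_opA].
Qed.

Hypothesis Bacc : finite_rank_factors B.

(** Approximating [V] already approximates the product in the quasi-norm of the ideal; the
    approximable factor on the left is then created by [min_class_of_closure]. *)
Lemma right_min_class X Y (T : operator X Y) :
  comp_class B approximable X Y T -> min_class B X Y T.
Proof.
move=> [Z [U [V [BU Va ->]]]]; apply: min_class_of_closure => // [|e e0];
  first exact: ideal_compr.
have U0 : 0 < qnorm B U + 1 by rewrite ltr_wpDl ?qnorm_ge0.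
have [|F FF VF] := (approximableP V).1 Va (e / (qnorm B U + 1));
  first by rewrite divr_gt0.
exists (comp_op U F); first exact: finite_rank_compl.
rewrite -comp_opBr (le_trans (qnorm_compr _ BU))// (le_trans (ler_wpM2l _ VF))
  ?qnorm_ge0//.
by rewrite mulrCA -[leRHS]mulr1 ler_wpM2l ?(ltW e0)// ler_pdivrMr// mul1r lerDl.
Qed.

Lemma left_min_class X Y (T : operator X Y) :
  comp_class approximable B X Y T -> min_class B X Y T.
Proof.
move=> [Z [U [V [Ua BV ->]]]]; apply: min_class_of_closure => // [|e e0];
  first exact: ideal_compl.
have V0 : 0 < qnorm B V + 1 by rewrite ltr_wpDl ?qnorm_ge0.
have [|F FF UF] := (approximableP U).1 Ua (e / (qnorm B V + 1));
  first by rewrite divr_gt0.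
exists (comp_op F V); first exact: finite_rank_compr.
rewrite -comp_opBl (le_trans (qnorm_compl _ BV))// (le_trans (ler_wpM2r _ UF))
  ?qnorm_ge0//.
by rewrite mulrAC ler_pdivrMr// ler_wpM2l ?(ltW e0)// lerDl.
Qed.

End MinClass.

(** * Part (a): surjective hulls *)

Section Surjective.
Variables (R : realType) (k : scalar_kind) (A : operator_ideal R k).
Hypotheses (A_acc : right_accessible A) (A_sur : surjective_ideal A).
Local Notation dual X := (operator X (scalar_space R k)).
Implicit Types X Y Z W E : Banach R k.

Lemma rnorm_sur_quotient X : rnorm (sur_quotient X) <= 1.
Proof.
apply: ell1_op_norm => // b; rewrite sur_quotient_delta1 -rnorm_le1; exact: valP b.
Qed.

Lemma sur_quotient_lift X (x : X) : exists2 l, sur_quotient X l = x & rnorm l <= rnorm x.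
Proof.
have [->|x0] := eqVneq x 0; first by exists 0; rewrite ?opv0// !rnorm0.
have nx : 0 < rnorm x by exact: rnorm_gt0.
have b1 : `|emb (rnorm x)^-1 *: x| <= 1.
  by rewrite rnorm_le1 rnormZ re_norm_emb gtr0_norm ?invr_gt0// mulVf ?gt_eqF.
exists (emb (rnorm x) *: delta1 R k (exist (fun x : X => `|x| <= 1) _ b1)).
  by rewrite opvZ sur_quotient_delta1 /= scalerA -embM divff ?gt_eqF// emb1 scale1r.
by rewrite rnormZ re_norm_emb gtr0_norm// ler_piMr ?(ltW nx) ?rnorm_delta1.
Qed.

(** With [P] the quotient map onto the range of [U], the corestriction [C] satisfies [C] o
    [sur_quotient Y] = [P] o [V]. Compactness of [C] is read at the unit vectors of l_1, which the
    quotient map sends onto the unit ball. *)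
Lemma sur_hull_approximable X Y (T : operator Y X) :
  sur_hull (min_class A) Y X T -> exists Z (U : operator Z X) (C : operator Y Z),
    [/\ A Z X U, compact_op Y Z C & T = comp_op U C].
Proof.
move=> /min_class_right[W [U [V [AU Va TqE]]]].
have TqE' l : T (sur_quotient Y l) = U (V l).
  by have /(congr1 (fun S : operator _ X => S l)) := TqE.
(* Lifting [y] to l_1 without increasing its norm exhibits [T y] as a value of [U]. *)
have [y|C CE _] := @image_corestrict R k W X U Y T (rnorm V) (rnorm_ge0 V).
  have [l lE ln] := sur_quotient_lift y; exists (V l); first by rewrite -TqE' lE.
  by rewrite (le_trans (rnorm_apply _ _))// ler_wpM2l ?rnorm_ge0.
exists (image_space U), (image_incl U), C; split=> //.
  by case: (ideal_image_incl A_sur AU).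
have [P PE P1] := image_factor U.
have CqE : comp_op C (sur_quotient Y) = comp_op P V.
  apply: operatorP => l; apply: (@image_incl_inj _ _ _ _ U).
  have E1 := congr1 (fun S : operator Y X => S (sur_quotient Y l)) CE.
  have E2 := congr1 (fun S : operator W X => S (V l)) PE.
  by rewrite /= in E1 E2; rewrite /= -E1 TqE' E2.
have /approximable_compact/compact_opP Cqc := approximable_compl (U := P) Va.
apply/compact_opP => e /Cqc[n [s sP]]; exists n, s => y.
have d1 : `|delta1 R k y| <= 1 by rewrite rnorm_le1 rnorm_delta1.
have [j jP] := sP (exist (fun x : ell1 R k (unit_ball Y) => `|x| <= 1) _ d1); exists j.
by have <- : comp_op P V (delta1 R k y) = C (val y) by rewrite -CqE -[in
  RHS](sur_quotient_delta1 y).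
Qed.

Lemma approximation_property_sur_hull X : approximation_property A X ->
  forall Y, sur_hull (min_class A) Y X = min_class A Y X.
Proof.
move=> Xap Y; apply/seteqP; split=> T; last exact: min_class_compr.
move=> /sur_hull_approximable[Z [U [C [AU Cc ->]]]].
apply: min_class_of_closure => [||e e0]; first exact: finite_rank_factors_accessible.
  exact: ideal_compr.
have [S SF Se] := approximation_property_compact Xap AU Cc e0.
by exists (comp_op S C) => //; exact: finite_rank_compr.
Qed.

Lemma sur_hull_approximation_property X :
  (forall Y, sur_hull (min_class A) Y X = min_class A Y X) -> approximation_property A X.
Proof.
move=> H; apply: approximation_propertyI => Y T C AT /admissible_exists[Z [i iadm]].
exists Z, i; split=> //; apply: min_class_right; rewrite -H.
apply: right_min_class; first exact: finite_rank_factors_accessible.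
exists Y, T, (comp_op i (sur_quotient Z)); split=> //; last exact: operatorP.
apply: compact_ell1_approximable.
rewrite -(comp_op1l (comp_op i _)); apply: compact_comp (rnorm_sur_quotient Z).
by case: iadm.
Qed.

End Surjective.

(** * Part (b): injective hulls *)

Section Injective.
Variables (R : realType) (k : scalar_kind) (A : operator_ideal R k).
Hypotheses (A_acc : right_accessible A) (A_sur : surjective_ideal A).
Local Notation dual X := (operator X (scalar_space R k)).
Implicit Types X Y Z W E : Banach R k.

Section Pullback.
Variables (X Y Z E : Banach R k) (i : operator Y E) (U : operator Z E).
Hypothesis i_isometry : forall y, rnorm (i y) = rnorm y.

(** The preimage under [U] of the range of [i]. When [i] o [T] = [U] o [V], the operator [V] lands
    here and [U] returns to [Y]: the counterpart of corestricting to a range. *)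
Definition pullback_pred : {pred Z} := fun z => `[< exists y, i y = U z >].

Lemma pullback_predP z : reflect (exists y, i y = U z) (z \in pullback_pred).
Proof. exact: asboolP. Qed.

Lemma pullback_submod : submod_closed pullback_pred.
Proof.
split; first by apply/pullback_predP; exists 0; rewrite !opv0.
move=> a u v /pullback_predP[x xu] /pullback_predP[y yv].
by apply/pullback_predP; exists (a *: x + y); rewrite !opvD !opvZ xu yv.
Qed.

Lemma pullback_closed : closed [set` pullback_pred].
Proof.
move=> z /closure_rnormP zP; apply/pullback_predP.
suff /(isometry_range_closed i_isometry)[y _ yz] : closure (range i) (U z) by exists y.
apply/closure_rnormP => e e0; have U0 : 0 < rnorm U + 1 by rewrite ltr_wpDl ?rnorm_ge0.
have [|z' /pullback_predP[y yz'] zz'] := zP (e / (rnorm U + 1));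
  first by rewrite divr_gt0.
exists (U z'); first by exists y.
rewrite -opvB (le_trans (rnorm_apply _ _))// (le_trans (ler_wpM2l (rnorm_ge0 _) zz'))//.
by rewrite mulrCA -[leRHS]mulr1 ler_wpM2l ?(ltW e0)// ler_pdivrMr// mul1r lerDl.
Qed.

Definition pullback := ClosedSubspace pullback_submod pullback_closed.

Lemma pullback_factor (T : operator X Y) (V : operator X Z) : comp_op i T = comp_op U V ->
  exists (U' : operator (subspace_type pullback) Y) (V' : operator X (subspace_type
    pullback)),
    [/\ T = comp_op U' V', V = comp_op (subspace_incl pullback) V'
      & comp_op i U' = comp_op U (subspace_incl pullback)].
Proof.
move=> TE.
have TE' x : i (T x) = U (V x) by have /(congr1 (fun S : operator X E => S x)) := TE.
have iinj : injective i.
  move=> x y xy; apply/eqP; rewrite -subr_eq0; apply/eqP/rnorm0_eq0.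
  by rewrite -i_isometry opvB xy subrr rnorm0.
have VP x : V x \in pullback by apply/pullback_predP; exists (T x).
have [a u v|x|V' V'E _] := @operator_exists R k X (subspace_type pullback)
    (fun x => SubspaceType (VP x)) (rnorm V) _ (rnorm_ge0 V).
- by apply: val_inj; rewrite /= opvD opvZ.
- exact: rnorm_apply.
have /choice[f fP] : forall z : subspace_type pullback, exists y, i y = U (val z).
  by move=> z; apply/pullback_predP; exact: subspace_valP.
have [a u v|z|U' U'E _] := @operator_exists R k (subspace_type pullback) Y f (rnorm U)
  _ (rnorm_ge0 U).
- by apply: iinj; rewrite opvD opvZ !fP /= opvD opvZ.
- by rewrite -i_isometry fP rnorm_subspace; exact: rnorm_apply.
exists U', V'; split; apply: operatorP => x.
- by apply: iinj; rewrite /= U'E fP V'E /=.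
- by rewrite /= V'E.
- by rewrite /= U'E fP.
Qed.

End Pullback.

(* Restriction of functionals to a subspace is a metric surjection, so it can be
   cancelled in a surjective ideal. *)
Lemma ideal_adjoint_subspace X Z (N : closed_subspace Z) (V : operator X (subspace_type
  N)) :
  A _ _ (adjoint (comp_op (subspace_incl N) V)) -> A _ _ (adjoint V).
Proof.
rewrite adjoint_comp => AV.
have lift (w : dual (subspace_type N)) : rnorm w <= 1 ->
    exists2 z, adjoint (subspace_incl N) z = w & rnorm z <= 1.
  move=> w1.
  have [||u|f f1 fE] := @hahn_banach_dual R k (subspace_type N) Z (subspace_incl N)
    (fun u => w u) 1 ler01.
  - by move=> a u v; rewrite opvD opvZ.
  - by move=> a u v; rewrite opvD opvZ.
  - by rewrite -rnorm_scalar (le_trans (rnorm_apply _ _))// ler_wpM2r ?rnorm_ge0.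
  by exists f => //; apply: operatorP => u; rewrite -[RHS]fE.
by have [] := surjective_lift A_sur ler01 lift AV.
Qed.

Lemma inj_hull_factor X Y (T : operator X Y) :
  inj_hull (min_class (dual_class A)) X Y T -> exists Z (C : operator Z Y) (V :
    operator X Z),
    [/\ compact_op Z Y C, dual_class A X Z V & T = comp_op C V].
Proof.
move=> /(@min_class_left _ _ (dual_ideal A))[Z [U [V [Ua AV TE]]]].
have [U' [V' [TE' VE UE]]] := pullback_factor (@rnorm_inj_embedding R k Y) TE.
exists (subspace_type (pullback U (@rnorm_inj_embedding R k Y))), U', V'; split=> //;
  last first.
  by apply: ideal_adjoint_subspace; rewrite -VE.
(* Compactness of [U'] is checked after the isometric embedding, where it becomes that of the
   restriction of [U]. *)
have := approximable_compr (V := subspace_incl (pullback U (@rnorm_inj_embedding R k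
  Y))) Ua.
rewrite -UE => /approximable_compact/compact_opP Uc.
apply/compact_opP => e /(totally_bounded_net Uc)[n [s sP]].
exists n, (fun j => U' (val (s j))) => z; have [j jP] := sP z; exists j.
by rewrite -(@rnorm_inj_embedding R k Y) opvB.
Qed.

Lemma approximation_property_inj_hull X : approximation_property A (dual X) ->
  forall Y, inj_hull (min_class (dual_class A)) X Y = min_class (dual_class A) X Y.
Proof.
move=> Xap Y; apply/seteqP; split=> T.
  move=> /inj_hull_factor[Z [C [V [Cc AV ->]]]].
  apply: (@min_class_of_closure _ _ (dual_ideal A)) => [||e e0].
  - exact: finite_rank_factors_dual.
  - exact: (@ideal_compl _ _ (dual_ideal A)).
  have [S SF Se] := approximation_property_compact Xap AV (schauder Cc) e0.
  have [n [x [f [_ SE]]]] := finite_rank_rep SF.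
  (* The coefficients of [S] are functionals on the dual of [Z]; the bidual of [C] sends them into
     [Y], so [S] composed with the adjoint of [C] is the adjoint of a finite rank operator [F]. *)
  have [D DE] := compact_bidual Cc.
  pose F := \sum_j rank1 (x j) (D (comp_op (f j) S)).
  exists F; first exact: finite_rank_sum.
  apply: le_trans Se; change (qnorm A (adjoint (comp_op C V - F)) <= qnorm A (comp_op
    (adjoint V) (adjoint C) - comp_op S (adjoint C))).
  rewrite adjointB adjoint_comp.
  suff -> : adjoint F = comp_op S (adjoint C) by [].
  apply: operatorP => phi; rewrite adjoint_rank1.
  have -> : comp_op S (adjoint C) phi = S (adjoint C phi) by [].
  by rewrite [in RHS]SE op_sumE; apply: eq_bigr => j _; rewrite DE.
exact: (@min_class_compl _ _ (dual_ideal A)).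
Qed.

Lemma inj_hull_approximation_property X :
  (forall Y, inj_hull (min_class (dual_class A)) X Y = min_class (dual_class A) X Y) ->
  approximation_property A (dual X).
Proof.
move=> H; apply: approximation_propertyI => Y T C AT /admissible_exists[Z [i iadm]].
exists Z, i; split=> //.
have [_ ic _ _] := iadm.
(* The compact inclusion [i] is split into two compact maps: [i2] serves to put [G2] in the dual
   ideal, [i1] to make the composition with the embedding into l_infty approximable. *)
have [W [i2 [i1 [iE _ i1c i2adm]]]] := compact_interpolation ic.
have [_ i2c _ _] := i2adm set0 (@sub0set _ _).
(* [G2] is the preadjoint of the extension of T to W^**. *)
pose G2 : operator X (dual W) := comp_op (adjoint (comp_op T i2)) (eval_op X).
have AG2 : dual_class A X (dual W) G2.
  (* The adjoint of [G2] is defined on the bidual of [W]; compactness of [i2] brings that bidual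
     into [Y], where [T] applies. *)
  have [S SE] := compact_bidual i2c.
  rewrite /dual_class /= (_ : adjoint G2 = comp_op T S); first exact: ideal_compr.
  apply: operatorP => zeta; apply: operatorP => x.
  have -> : comp_op T S zeta x = comp_op (eval_op X x) T (S zeta) by [].
  by rewrite SE /=; congr (op_fun zeta _); exact: operatorP.
pose G := comp_op (adjoint i1) G2.
have : min_class (dual_class A) X (dual Z) G.
  rewrite -H; apply: (@left_min_class _ _ (dual_ideal A));
    first exact: finite_rank_factors_dual.
  exists (dual W), (comp_op (inj_embedding (dual Z)) (adjoint i1)), G2; split=> //;
    last exact: comp_opA.
  apply: compact_ell_inf_approximable; rewrite -(comp_op1r (adjoint i1)).
  by apply: compact_comp (rnorm_id _); exact: schauder.
move=> /(@min_class_left _ _ (dual_ideal A))[P [U [V [Ua AV GE]]]].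
(* [G x z] equals [T (i z) x], so transposing the factorization of [G] factors [T] o [i], with the
   approximable factor now on the right. *)
exists (dual P), (adjoint V), (comp_op (adjoint U) (eval_op Z)); split=> //.
  by apply: approximable_compr; exact: approximable_adjoint.
apply: operatorP => z; apply: operatorP => x.
have := congr1 (fun S : operator X (dual Z) => S x z) GE.
by rewrite iE.
Qed.

End Injective.

Theorem corollary6p7 (R : realType) (k : scalar_kind) (A : operator_ideal R k)
    (A_right_accessible : right_accessible A)
    (A_surjective : surjective_ideal A) (X : Banach R k) :
  (approximation_property A X <->
     forall Y : Banach R k, sur_hull (min_class A) Y X = min_class A Y X) /\
  (approximation_property A (dual X) <->
     forall Y : Banach R k,
       inj_hull (min_class (dual_class A)) X Y = min_class (dual_class A) X Y).
Proof.
split; split.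
- exact: approximation_property_sur_hull.
- exact: sur_hull_approximation_property.
- exact: approximation_property_inj_hull.
- exact: inj_hull_approximation_property.
Qed.
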